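(* Let $\mathbf{d}:0<d_1<\cdots<d_m<n$ be a sequence of integers, let $w\in I_{\mathbf{d}}$, and set $r:=|w|=\dim X_w$. Then, for any list of numbers $i_1,\ldots,i_r\in\{1,\ldots,m\}$, there exist real numbers $s_1,\ldots,s_r$ such that the intersection $$X_wF_\bullet(0)\cap X_{i_1}F_\bullet(s_1)\cap\cdots\cap X_{i_r}F_\bullet(s_r)$$ in $\mathbb{F}\ell_{\mathbf{d}}$ is transverse and consists only of real points.
   Context: $\mathbb{F}\ell_{\mathbf{d}}$ is the manifold of partial flags $E_\bullet:\ E_{d_1}\subset E_{d_2}\subset\cdots\subset E_{d_m}\subset\mathbb{C}^n$ of linear subspaces with $\dim E_{d_i}=d_i$. A complete flag $F_\bullet$ is $F_1\subset\cdots\subset F_n=\mathbb{C}^n$ with $\dim F_i=i$. $I_{\mathbf{d}}$ is the set of permutations $w=w_1\ldots w_n\in\mathcal{S}_n$ whose descent set $\{i\mid w_i>w_{i+1}\}$ is contained in $\{d_1,\ldots,d_m\}$. A complete flag $F_\bullet$ induces the Bruhat (Schubert cell) decomposition $\mathbb{F}\ell_{\mathbf{d}}=\coprod_{w\in I_{\mathbf{d}}}X_w^\circ F_\bullet$, where $$X_w^\circ F_\bullet=\{E_\bullet\mid\dim(E_{d_i}\cap F_j)=\#\{l\le d_i: w_l\le j\}\text{ for all }i,j\},$$ and the Schubert variety $X_wF_\bullet$ is the closure of $X_w^\circ F_\bullet$; its dimension is $|w|=\ell(w)$, the number of inversions of $w$. For $i=1,\ldots,m$ the simple (codimension-1) Schubert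 variety is $X_iF_\bullet:=\{E_\bullet\in\mathbb{F}\ell_{\mathbf{d}}\mid E_{d_i}\cap F_{n-d_i}\ne\{0\}\}$. Fix any real rational normal curve $\gamma:\mathbb{C}\to\mathbb{C}^n$, i.e. $\gamma(s)=(p_1(s),\ldots,p_n(s))$ with $p_1,\ldots,p_n$ a basis of the space of real polynomials of degree less than $n$. For $s\in\mathbb{C}$, $F_\bullet(s)$ is the complete flag osculating $\gamma$ at $\gamma(s)$: $F_i(s)$ is the linear span of $\gamma(s),\gamma'(s),\ldots,\gamma^{(i-1)}(s)$. *)

(* Defs.v *)
From HB Require Import structures.
From mathcomp Require Import all_boot all_order all_algebra all_fingroup.
From mathcomp Require Import all_classical all_reals topology normedtype derive.
From mathcomp Require Import complex.

Set Implicit Arguments.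
Unset Strict Implicit.
Unset Printing Implicit Defensive.

Import Order.TTheory GRing.Theory Num.Theory numFieldNormedType.Exports.

Local Open Scope classical_set_scope.
Local Open Scope ring_scope.

(* Indices start at 0: i : 'I_m stands for i + 1, so d i is d_(i+1), while     *)
(* positions and values of w : 'S_n range over 0, .., n - 1.                  *)

Section Flags.
Variables (K : fieldType) (n m : nat) (d : 'I_m -> nat).

Definition is_flag (E : {ffun 'I_m -> {vspace 'rV[K]_n}}) : bool :=
  [forall i, \dim (E i) == d i] &&
  [forall i : 'I_m, forall j : 'I_m, (i <= j)%N ==> (E i <= E j)%VS].

Record flag := Flag {
  flag_val :> {ffun 'I_m -> {vspace 'rV[K]_n}};
  _ : is_flag flag_val }.

HB.instance Definition _ := [isSub for flag_val].
HB.instance Definition _ := [Choice of flag by <:].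

(* g is a basis of K^n (listed by rows) adapted to E. *)
Definition adapted (g : 'M[K]_n) (E : flag) : bool :=
  (g \in unitmx) &&
  [forall i, E i == (\sum_(a < n | (a < d i)%N) <[row a g]>)%VS].

(* The (a, b) such that, in the ordering of the rows by blocks cut out by d,   *)
(* the block of a comes strictly before that of b: #|flag_pos| is the          *)
(* dimension of the flag manifold.                                            *)
Definition flag_pos : {set 'I_n * 'I_n} :=
  [set ab : 'I_n * 'I_n | [exists i, (ab.1 < d i <= ab.2)%N]].

Definition flag_dim : nat := #|flag_pos|.

Definition chart_mx (v : 'rV[K]_flag_dim) : 'M[K]_n :=
  1%:M + \sum_k v 0 k *: delta_mx (enum_val k).1 (enum_val k).2.

(* The trace of X on the affine chart which sends the coordinates v to the     *)
(* flag with adapted basis chart_mx v *m g. This chart is centred at the flag  *)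
(* with adapted basis g, and such charts form an atlas of the flag manifold.   *)
Definition chart_set (g : 'M[K]_n) (X : set flag) : set 'rV[K]_flag_dim :=
  [set v | exists2 E, X E & adapted (chart_mx v *m g) E].

Definition schubert_cell (w : 'S_n) (F : nat -> {vspace 'rV[K]_n}) : set flag :=
  [set E | forall (i : 'I_m) (j : nat), (j <= n)%N ->
     \dim (E i :&: F j)%VS = #|[pred l : 'I_n | (l < d i)%N && (w l < j)%N]|].

Definition simple_schubert (i : 'I_m) (F : nat -> {vspace 'rV[K]_n}) :
    set flag :=
  [set E | (E i :&: F (n - d i)%N)%VS != 0%VS].

End Flags.

Definition in_Id (n m : nat) (d : 'I_m -> nat) (w : 'S_n) : Prop :=
  forall a b : 'I_n, b = a.+1 :> nat -> (w b < w a)%N ->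
  exists i, d i = b.

Definition perm_length (n : nat) (w : 'S_n) : nat :=
  #|[pred ab : 'I_n * 'I_n | (ab.1 < ab.2)%N && (w ab.2 < w ab.1)%N]|.

Section FlagTopology.
Variables (K : numFieldType) (n m : nat) (d : 'I_m -> nat).

(* The quotient topology of GL_n(K): U is open iff the set of the invertible   *)
(* matrices adapted to some E in U is open.                                   *)
Definition flag_open (U : set (flag K n d)) : Prop :=
  forall (g : 'M[K]_n) (E : flag K n d), adapted g E -> U E ->
  \forall h \near g, forall E' : flag K n d, adapted h E' -> U E'.

Lemma flag_openT : flag_open setT.
Proof. by move=> g E _ _; near=> h. Unshelve. all: by end_near. Qed.

Lemma flag_openI : setI_closed flag_open.
Proof.
move=> U V oU oV g E gE [UE VE].
near=> h => E' hE'; split.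
- by move: E' hE'; near: h; exact: (oU g E).
- by move: E' hE'; near: h; exact: (oV g E).
Unshelve. all: by end_near. Qed.

Lemma flag_open_bigU (I : Type) (f : I -> set (flag K n d)) :
  (forall i, flag_open (f i)) -> flag_open (\bigcup_i f i).
Proof.
move=> of_ g E gE [i _ fiE].
near=> h => E' hE'; exists i => //.
by move: E' hE'; near: h; exact: (of_ i g E).
Unshelve. all: by end_near. Qed.

HB.instance Definition _ := isOpenTopological.Build (flag K n d)
  flag_openT flag_openI flag_open_bigU.

Definition schubert_variety (w : 'S_n) (F : nat -> {vspace 'rV[K]_n}) :
    set (flag K n d) :=
  closure (schubert_cell w F).

End FlagTopology.

(* Near v, the set X is a complex submanifold with tangent space T at v (for   *)
(* K = C): it is cut out by holomorphic functions whose differentials at v are *)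
(* linearly independent and have T as common kernel. For an algebraic variety  *)
(* X this says that v is a smooth point of X, with tangent space T.            *)
Definition smooth_at (K : numFieldType) (N : nat) (X : set 'rV[K]_N)
    (v : 'rV[K]_N) (T : {vspace 'rV[K]_N}) : Prop :=
  exists (c : nat) (f : 'I_c -> 'rV[K]_N -> K^o),
    [/\ forall k, \forall u \near v, differentiable (f k) u,
        \forall u \near v, X u <-> (forall k, f k u = 0),
        forall a : 'I_c -> K,
          (forall h, \sum_k a k * 'd (f k) v h = 0) -> forall k, a k = 0
      & forall h, h \in T <-> (forall k, 'd (f k) v h = 0)].

Section Transversality.
Variables (K : numFieldType) (n m : nat) (d : 'I_m -> nat) (I : finType).

(* Every X a is smooth at E, and the codimensions of the tangent spaces add up *)
(* in their intersection; this does not depend on the chart g centred at E.    *)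
Definition transverse_at (X : I -> set (flag K n d)) (E : flag K n d) : Prop :=
  exists2 g, adapted g E &
  exists2 T : I -> {vspace 'rV[K]_(flag_dim n d)},
    forall a, smooth_at (chart_set g (X a)) 0 (T a) &
    (flag_dim n d - \dim (\bigcap_a T a)%VS)%N =
    (\sum_a (flag_dim n d - \dim (T a)))%N.

Definition transverse (X : I -> set (flag K n d)) : Prop :=
  forall E, (forall a, X a E) -> transverse_at X E.

End Transversality.

Section RealFlags.
Variables (R : realType) (n : nat).

Definition complexify (U : {vspace 'rV[R]_n}) : {vspace 'rV[R[i]]_n} :=
  <<map (map_mx (real_complex R)) (vbasis U)>>%VS.

Definition real_flag (m : nat) (d : 'I_m -> nat) (E : flag R[i] n d) : Prop :=
  exists E0 : flag R n d, forall i, E i = complexify (E0 i).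

(* The l-th derivative at s of the curve (p_1, .., p_n). *)
Definition curve_deriv (p : n.-tuple {poly_n R}) (l : nat) (s : R[i]) :
    'rV[R[i]]_n :=
  \row_k (map_poly (real_complex R) (tnth p k))^`(l).[s].

Definition osculating (p : n.-tuple {poly_n R}) (s : R[i]) (j : nat) :
    {vspace 'rV[R[i]]_n} :=
  <<[seq curve_deriv p l s | l <- iota 0 j]>>%VS.

End RealFlags.

(* Main.v *)
(* In the Bruhat cell of w a flag has, up to a fixed change of basis of C^n,
   an adapted basis x *m perm_mx w with x unipotent and supported on the
   inversions of w, and the condition imposed by X_i F(s) is the vanishing of
   the determinant of incidence. Call a list of conditions good if no cell of
   dimension less than its length contains a flag which satisfies all of
   them, and if, in the cells whose dimension is that length, every such flag
   is real and the differentials of the conditions have no common zero. Good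
   lists are built one condition at a time: a further condition at s > 0
   preserves goodness when s is small enough.

   Otherwise follow bad flags of one cell w along an ultrafilter at s = 0+.
   They converge to a flag of a cell v below w, which satisfies the old
   conditions. The torus element diag(s^i) moves the condition at s to the
   condition at 1, and the torus fixed points never satisfy the latter, so v
   <> w; counting dimensions, v is covered by w, and the limit is real and
   nondegenerate in its cell. Near the cell v, the cell w has one more
   coordinate, a transvection parameter tau; the condition at s forces tau /
   s^e to converge to a fixed limit. Two bad flags with the same limit (a
   flag and its conjugate) then coincide, since their normalised difference
   would converge to a common zero of the differentials, and a degenerate
   tangent vector is excluded in the same way.

   A flag of the whole intersection lies in a cell w' with w' <= w, so
   goodness of the r conditions forces w' = w; reality is then part of
   goodness, and nondegeneracy gives transversality by counting codimensions. *)

Require Import Defs.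
From HB Require Import structures.
From mathcomp Require Import all_boot all_order all_algebra all_fingroup zify ring.

Set Implicit Arguments.
Unset Strict Implicit.
Unset Printing Implicit Defensive.

Import Order.TTheory GRing.Theory Num.Theory.

Local Open Scope ring_scope.

(** * Matrices supported on a relation *)

Section Supports.
Variables (K : fieldType) (n : nat).
Implicit Types (P Q : rel 'I_n) (S : pred 'I_n) (X Y : 'M[K]_n).

(** Uniqueness of a bad flag and nondegeneracy of its tangent space are one statement about limits.
    Exchanging rows one at a time gives the exact formula [\det M - \det N = det_slope M N (M - N)],
    and [det_slope M M] is the differential of the determinant; so a difference of two flags and a
    tangent vector both solve equations [det_slope M N H = 0], linear in [H] and stable under
    limits. The obstacle is that tau tends to 0, so in the limit the old conditions lose sight of
    it. Two scales are therefore used. In the original one the increment of tau is negligible and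
    the old conditions control the increments along the cell of v. After the torus element these are
    negligible, and the condition at 1 becomes affine in tau, with a slope tending to its nonzero
    determinant at the torus fixed point of w. An ultrafilter takes the place of curve selection:
    bounded functions converge, and one of finitely many alternatives holds throughout, so the cell,
    the pivots and the dominant coordinate can be fixed. The induction runs over all of ['S_n]; the
    sequence [d] enters only when conditions are read on partial flags. *)

Definition mask S : 'M[K]_n := diag_mx (\row_k (S k)%:R).

Lemma eq_mask S1 S2 : S1 =1 S2 -> mask S1 = mask S2.
Proof. by move=> e; apply/matrixP=> i j; rewrite !mxE e. Qed.

Lemma maskl m S (X : 'M_(n, m)) i j : (mask S *m X) i j = (S i)%:R * X i j.
Proof. by rewrite mul_diag_mx !mxE. Qed.

Lemma maskr m S (X : 'M_(m, n)) i j : (X *m mask S) i j = X i j * (S j)%:R.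
Proof. by rewrite mul_mx_diag !mxE. Qed.

Lemma maskM S1 S2 : mask S1 *m mask S2 = mask (fun k => S1 k && S2 k).
Proof.
apply/matrixP=> i j; rewrite maskr !mxE mulrnAl -natrM -mulnb.
by case: eqP => [->|_]; rewrite ?mul0n ?mulr0n.
Qed.

Lemma maskC S : 1%:M = mask S + mask (predC S).
Proof.
apply/matrixP=> i j; rewrite !mxE /=.
by case: (i == j); case: (S i); rewrite ?mulr0n ?mulr1n ?addr0 ?add0r.
Qed.

Lemma rank_mask_le S : (\rank (mask S) <= #|S|)%N.
Proof.
have -> : mask S = \sum_(k | S k) delta_mx k k.
  apply/matrixP=> i j; rewrite summxE !mxE.
  have [->|ij] := eqVneq i j.
    rewrite (bigID (pred1 j)) /= [X in _ + X]big1 ?addr0; last first.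
      by move=> k /andP[_ kj]; rewrite mxE eq_sym (negbTE kj).
    case Sj: (S j).
      rewrite (big_pred1 j) ?mxE ?eqxx // => k /=.
      by case: eqP => [->|]; rewrite ?Sj // andbF.
    rewrite big1 // => k /andP[Sk /eqP kj]; by rewrite kj Sj in Sk.
  rewrite big1 ?mulr0n // => k _; rewrite mxE.
  by case: eqP => // <-; rewrite eq_sym (negbTE ij).
rewrite -sum1_card.
apply: (big_ind2 (fun (M : 'M[K]_n) m => \rank M <= m)%N) => [|M1 m1 M2 m2 le1 le2|k _].
- by rewrite mxrank0.
- exact: leq_trans (mxrank_add _ _) (leq_add le1 le2).
- by rewrite mxrank_delta.
Qed.

Definition supported P X := forall i j, ~~ P i j -> X i j = 0.

Lemma supported_mulP P Q (P' : rel 'I_n) X Y :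
  (forall i k j, P i k -> Q k j -> P' i j) ->
  supported P X -> supported Q Y -> supported P' (X *m Y).
Proof.
move=> trP sX sY i j nPij; rewrite mxE big1 // => k _.
have [Pik|/sX->] := boolP (P i k); last by rewrite mul0r.
have [Pkj|/sY->] := boolP (Q k j); last by rewrite mulr0.
by rewrite (trP _ _ _ Pik Pkj) in nPij.
Qed.

Lemma supported_mul P X Y : transitive P -> supported P X -> supported P Y ->
  supported P (X *m Y).
Proof. by move=> trP; apply: supported_mulP => i k j; apply: trP. Qed.

(* If the mask E of the rows that may not meet column j satisfies             *)
(* E *m X = E *m X *m E, then so does the inverse of X, because E *m X and E   *)
(* have the same row space.                                                   *)
Lemma supported_inv P X : reflexive P -> transitive P -> X \in unitmx ->
  supported P X -> supported P (invmx X).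
Proof.
move=> rP tP uX sX i j nPij.
pose E := mask (fun k => ~~ P k j).
have EX : E *m X = E *m X *m E.
  apply/matrixP=> a b; rewrite maskr maskl.
  have [Pbj /=|_] := boolP (P b j); last by rewrite mulr1.
  rewrite mulr0; have [_|nPaj] := boolP (P a j); first by rewrite mul0r.
  by rewrite sX ?mulr0 //; apply: contra nPaj => Pab; apply: tP Pbj.
have sub : (E *m X <= E)%MS by rewrite EX submxMl.
have rkE : \rank (E *m X) = \rank E by rewrite mxrankMfree // row_free_unit.
have /submxP[D ED] : (E <= E *m X)%MS.
  by move: (mxrank_leqif_eq sub); rewrite rkE => -[_]; rewrite eqxx => /esym/andP[].
have : (E *m invmx X) i j = (D *m E) i j.
  by rewrite {1}ED !mulmxA mulmxK.
by rewrite maskl maskr nPij rP mulr0 mul1r.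
Qed.

End Supports.

(** * First-order terms of the determinant *)

Section DetSlope.
Variables (R : comNzRingType) (n : nat).
Implicit Types (M N H : 'M[R]_n).

Definition splice (a : nat) M N H : 'M[R]_n :=
  \matrix_(i, j) (if (i < a)%N then N i j else if i == a :> nat then H i j else M i j).

(** A discrete derivative of the determinant: rows pass from [M] to [N] one at a time, with [H] in
    the row being exchanged. Keeping both endpoints makes the difference formula exact; for [M = N]
    it is the differential at [M] in the direction [H]. *)
Definition det_slope M N H : R := \sum_(a < n) \det (splice a M N H).

Lemma det_spliceD (a : 'I_n) M N b c H1 H2 :
  \det (splice a M N (b *: H1 + c *: H2)) =
  b * \det (splice a M N H1) + c * \det (splice a M N H2).
Proof.
apply: (determinant_multilinear (i0 := a)).
- by apply/rowP=> j; rewrite !mxE ltnn eqxx.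
- by apply/matrixP=> i j; rewrite !mxE (inj_eq val_inj) eq_sym (negbTE (neq_lift _ _)).
- by apply/matrixP=> i j; rewrite !mxE (inj_eq val_inj) eq_sym (negbTE (neq_lift _ _)).
Qed.

Lemma det_slopeD M N b c H1 H2 :
  det_slope M N (b *: H1 + c *: H2) = b * det_slope M N H1 + c * det_slope M N H2.
Proof.
rewrite !mulr_sumr -big_split; apply: eq_bigr => a _; exact: det_spliceD.
Qed.

Lemma det_slopeZ M N b H : det_slope M N (b *: H) = b * det_slope M N H.
Proof.
by rewrite -[b *: H]addr0 -[0 in LHS](scale0r H) det_slopeD mul0r addr0.
Qed.

Lemma det_slope_add M N H1 H2 :
  det_slope M N (H1 + H2) = det_slope M N H1 + det_slope M N H2.
Proof. by rewrite -[H1]scale1r -[H2]scale1r det_slopeD !scale1r !mul1r. Qed.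

Lemma detB_slope M N : \det M - \det N = det_slope M N (M - N).
Proof.
(* [D k] takes its first [k] rows from [N], so consecutive values differ in a single row. *)
pose D (k : nat) := \det (\matrix_(i, j) (if (i < k)%N then N i j else M i j)).
have D0 : D 0%N = \det M by congr (\det _); apply/matrixP=> i j; rewrite mxE ltn0.
have Dn : D n = \det N by congr (\det _); apply/matrixP=> i j; rewrite mxE ltn_ord.
rewrite -D0 -Dn -opprB -(telescope_sumr D) // -sumrN big_mkord.
apply: eq_bigr => a _; rewrite -[M in M - N]scale1r -scaleN1r det_spliceD.
rewrite mulN1r mul1r opprB; congr (_ - _); congr (\det _).
  apply/matrixP=> i j; rewrite !mxE.
  by case: ltngtP => // /val_inj->.
by apply/matrixP=> i j; rewrite !mxE ltnS leq_eqVlt; case: ltngtP.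
Qed.

End DetSlope.

Lemma map_det_slope (R S : comNzRingType) (f : {rmorphism R -> S}) n (M N H : 'M[R]_n) :
  det_slope (map_mx f M) (map_mx f N) (map_mx f H) = f (det_slope M N H).
Proof.
rewrite rmorph_sum; apply: eq_bigr => a _; rewrite -det_map_mx; congr (\det _).
by apply/matrixP=> i j; rewrite !mxE; case: ifP => // _; case: ifP.
Qed.

Section DetDerivative.
Variables (K : comNzRingType) (n : nat).
Implicit Types (M H L : 'M[K]_n).
Local Notation "A ^p" := (map_mx polyC A) (at level 2).

(** Applying [detB_slope] over the polynomials to [M + X H] and [M] and dividing by [X] identifies
    the slope with a coefficient, a form in which multiplicativity of the determinant applies. *)
Lemma det_slope_diag M H : det_slope M M H = (\det (M^p + 'X *: H^p))`_1.
Proof.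
have := detB_slope (M^p + 'X *: H^p) M^p.
rewrite addrAC subrr add0r det_slopeZ => /(canRL (subrK _))->.
rewrite coefD coefXM /= det_map_mx coefC addr0 -horner_coef0.
rewrite -/(horner_eval 0 _) -map_det_slope; congr det_slope.
- by apply/matrixP=> i j; rewrite !mxE /= /horner_eval !hornerE ?addr0.
- by apply/matrixP=> i j; rewrite !mxE /= /horner_eval !hornerE ?addr0.
- by apply/matrixP=> i j; rewrite !mxE /= /horner_eval !hornerE ?addr0.
Qed.

Lemma det_slope_diagM (c d : 'M[K]_n) M H :
  det_slope (c *m M *m d) (c *m M *m d) (c *m H *m d) =
  \det c * det_slope M M H * \det d.
Proof.
rewrite !det_slope_diag !map_mxM scalemxAl scalemxAr -mulmxDl -mulmxDr.
by rewrite !det_mulmx !det_map_mx coefMC coefCM.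
Qed.

Lemma det_slope_diag_mull L M : \det M = 0 -> det_slope M M (L *m M) = 0.
Proof.
move=> M0; rewrite det_slope_diag map_mxM scalemxAl -{1}[M^p]mul1mx -mulmxDl.
by rewrite det_mulmx det_map_mx M0 mulr0 coef0.
Qed.

End DetDerivative.

(** * The Bruhat order *)

Section BruhatOrder.
Variable n : nat.
Implicit Types (v w : 'S_n) (a b c : 'I_n) (i j : nat).

Lemma perm_neq w a b : a != b -> w a != w b :> nat.
Proof. by move=> ab; rewrite (inj_eq val_inj) (inj_eq perm_inj). Qed.

(** Comparing these counts for all [i] and [j] is the Bruhat order. They complement the counts in
    the definition of a Schubert cell. *)
Definition corner w i j := #|[pred l : 'I_n | (l < i)%N && (j <= w l)%N]|.

Lemma cornerE w i j : corner w i j = (\sum_(l < n) ((l < i)%N && (j <= w l)%N))%N.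
Proof. by rewrite /corner -sum1_card [LHS]big_mkcond /=; apply: eq_bigr => l _; rewrite inE; case: (_ && _). Qed.

(** The map [f] applies the transposition to both entries of an inversion when this keeps their
    order, and fixes the inversion otherwise. It embeds the inversions of [v] into those of the new
    permutation and misses [(a, b)]. *)
Lemma length_tperm v a b : (a < b)%N -> (v a < v b)%N ->
  (perm_length v < perm_length (tperm a b * v))%N.
Proof.
move=> ab vab; set t := tperm a b.
pose I (u : 'S_n) := [set x : 'I_n * 'I_n | (x.1 < x.2)%N && (u x.2 < u x.1)%N].
have lenE (u : 'S_n) : perm_length u = #|I u|.
  by rewrite /perm_length; apply: eq_card => x; rewrite !inE.
pose f (x : 'I_n * 'I_n) := if (t x.1 < t x.2)%N then (t x.1, t x.2) else x.
have tE c : t c = (if c == a then b else if c == b then a else c).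
  by rewrite /t; case: tpermP => [->|->|/eqP/negbTE-> /eqP/negbTE->//];
    rewrite ?eqxx //; case: eqP.
have fI : {in I v &, injective f}.
  move=> [c d] [c' d']; rewrite !inE /= /f /= => /andP[cd vcd] /andP[cd' vcd'].
  case: ifP => h1; case: ifP => h2.
  - by case=> /perm_inj-> /perm_inj->.
  - case=> e1 e2; move: h2; rewrite -e1 -e2 !tpermK cd.
    by [].
  - case=> e1 e2; move: h1; rewrite e1 e2 !tpermK cd'.
    by [].
  - by [].
rewrite !lenE -(card_in_imset fI) proper_card //.
apply/properP; split.
  apply/subsetP=> y /imsetP[[c d]]; rewrite inE /= => /andP[cd vcd] ->.
  rewrite inE /f /=; case: ifP => [h|] /=; rewrite !permM -/t ?tpermK ?h //.
  rewrite !tE cd /=.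
  case: (c =P a) => [?|_]; case: (c =P b) => [?|_];
  case: (d =P a) => [?|_]; case: (d =P b) => [?|_]; subst; lia.
exists (a, b); first by rewrite inE /= ab !permM tpermL tpermR.
apply/negP=> /imsetP[[c d]]; rewrite inE /= => /andP[cd vcd]; rewrite /f /=.
case: ifP => _ [e1 e2].
  have ec : c = b by apply: (@perm_inj _ t); rewrite -e1 /t tpermR.
  have ed : d = a by apply: (@perm_inj _ t); rewrite -e2 /t tpermL.
  by move: cd; rewrite ec ed; lia.
by move: vcd; rewrite -e1 -e2; lia.
Qed.

Lemma corner_tperm v a b i j : (a < b)%N -> (v a < v b)%N ->
  corner (tperm a b * v) i j =
  (corner v i j + ((a < i <= b)%N && (v a < j <= v b)%N))%N.
Proof.
move=> ab vab; rewrite !cornerE.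
have ba : b != a by rewrite -(inj_eq val_inj) /=; lia.
rewrite (bigD1 a) // (bigD1 b) //= [in RHS](bigD1 a) // [in RHS](bigD1 b) //=.
rewrite !permM tpermL tpermR.
rewrite (eq_bigr (fun l : 'I_n => ((l < i)%N && (j <= v l)%N) : nat)); last first.
  by move=> l /andP[la lb]; rewrite permM tpermD // eq_sym.
by lia.
Qed.

(** Position [a] is the first one where [v] and [w] differ, which forces [v a < w a]; [b] is the
    first later position with [v a < v b <= w a], so the exchange is a cover. *)
Lemma bruhat_step v w : (forall i j, corner v i j <= corner w i j)%N -> v != w ->
  exists a b, [/\ (a < b)%N, (v a < v b)%N,
    forall c, (a < c < b)%N -> ~~ (v a < v c < v b)%N &
    forall i j, (corner (tperm a b * v) i j <= corner w i j)%N].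
Proof.
move=> le vw.
have [a0 a0P] : exists a, v a != w a.
  apply/existsP; apply: contraNT vw; rewrite negb_exists => /forallP h.
  by apply/eqP/permP=> a; have := h a; rewrite negbK => /eqP.
case: (@arg_minnP _ a0 (fun a => v a != w a) (fun a : 'I_n => nat_of_ord a) a0P) => a /= vwa amin.
have vwlt c : (c < a)%N -> v c = w c.
  by move=> ca; apply/eqP; apply: contraTT ca => /amin; rewrite -leqNgt.
have va : (v a < w a)%N.
  suff : (v a <= w a)%N by move: vwa; rewrite -(inj_eq val_inj) /=; lia.
  have := le a.+1 (v a); rewrite !cornerE (bigD1 a) //= [X in (_ <= X)%N](bigD1 a) //=.
  rewrite ltnSn leqnn /= (eq_bigr (fun l : 'I_n => ((l < a.+1)%N && (v a <= w l)%N) : nat)).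
    by case: (leqP (v a) (w a)) => //=; lia.
  move=> l la; case: (ltnP l a.+1) => //= la'; rewrite (vwlt l) //.
  by rewrite ltn_neqAle -ltnS la' andbT (inj_eq val_inj).
pose B b := (a < b)%N && (v a < v b <= w a)%N.
have Bb0 : B ((v^-1)%g (w a)).
  rewrite /B permKV va leqnn andbT; set b0 := (v^-1)%g (w a).
  have vb0 : v b0 = w a by rewrite permKV.
  case: (ltngtP b0 a) => // h.
    by move: (vwlt _ h); rewrite vb0 => /perm_inj e; move: h; rewrite -e ltnn.
  by move: va; rewrite -vb0 (val_inj h) ltnn.
case: (@arg_minnP _ _ B (fun a : 'I_n => nat_of_ord a) Bb0) => b /andP[ab /andP[vab vbw]] bmin.
exists a, b; split=> // [c /andP[ac cb]|i j].
  apply/negP=> /andP[vac vcb]; suff /bmin : B c by lia.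
  by rewrite /B; lia.
rewrite corner_tperm //.
case: (boolP (_ && _)) => [/andP[/andP[ai ib] /andP[vaj jvb]]|_]; last by rewrite addn0.
rewrite addn1 !cornerE.
(* The values of [v] from [j] on are split at [w a]. By minimality of [b], those up to [w a] sit
   before position [a], where [v] and [w] agree; those above are compared by the hypothesis at
   [(w a).+1]. Position [a] itself gives [w] the additional one. *)
apply: (@leq_trans (\sum_(l < n) ((l < i)%N && (w a < v l)%N) +
    \sum_(l < n) ((l < a)%N && (j <= w l <= w a)%N)).+1).
  rewrite ltnS -big_split /=; apply: leq_sum => l _.
  case: (ltnP l i) => //= li; case: (ltnP (w a) (v l)) => [|vlw]; first by case: leqP => //; lia.
  case: (leqP j (v l)) => // jv; rewrite add0n.
  have [la|al] := ltnP l a; first by rewrite -vwlt // jv vlw.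
  have : ~~ B l by apply/negP=> /bmin; lia.
  rewrite /B; move: al; rewrite leq_eqVlt => /orP[/eqP/val_inj e|]; last by lia.
  by move: jv; rewrite -e; lia.
apply: (@leq_trans (\sum_(l < n) ((l < i)%N && (w a < w l)%N) +
    \sum_(l < n) ((l < a)%N && (j <= w l <= w a)%N)).+1).
  by rewrite ltnS leq_add2r; have := le i (w a).+1; rewrite !cornerE.
rewrite -big_split /= (bigD1 a) // [X in (_ <= X)%N](bigD1 a) //= -addSn.
apply: leq_add; first by rewrite ltnn; lia.
by apply: leq_sum => l la; lia.
Qed.

(** Climbing from [v] by [bruhat_step] raises the length each time; the induction is on the room
    left below [n * n]. If the lengths differ by one, a single step is made, and it is a cover. *)
Lemma bruhat_length v w : (forall i j, corner v i j <= corner w i j)%N ->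
  [/\ (perm_length v <= perm_length w)%N,
      perm_length v = perm_length w -> v = w &
      perm_length w = (perm_length v).+1 ->
      exists a b, [/\ (a < b)%N, (v a < v b)%N,
        forall c, (a < c < b)%N -> ~~ (v a < v c < v b)%N & w = (tperm a b * v)%g]].
Proof.
have [k] := ubnP (n * n - perm_length v)%N.
have lemax (u : 'S_n) : (perm_length u <= n * n)%N.
  by apply: leq_trans (max_card _) _; rewrite card_prod card_ord.
elim: k v => // k IHk v lek le.
have [->|vw] := eqVneq v w; first by split=> //; lia.
have [a [b [ab vab cov le']]] := bruhat_step le vw.
have lt := length_tperm ab vab.
have [] := IHk _ _ le'; first by have := lemax (tperm a b * v)%g; lia.
move=> h1 h2 _; split; try lia.
by move=> e; exists a, b; split=> //; rewrite h2 //; lia.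
Qed.

Lemma corner_inj v w : (forall i j, corner v i j = corner w i j) -> v = w.
Proof.
move=> e; have [] := @bruhat_length v w; first by move=> i j; rewrite e.
move=> h1 h2 _; apply: h2; apply/eqP; rewrite eqn_leq h1.
by have [] := @bruhat_length w v => // i j; rewrite e.
Qed.

Lemma corner_full v j : corner v n j = (n - j)%N.
Proof.
rewrite cornerE.
rewrite (eq_bigr (fun l => (j <= v l)%N : nat)) => [|l _]; last by rewrite ltn_ord.
rewrite (reindex_inj (@perm_inj _ (v^-1)%g)) /=.
rewrite (eq_bigr (fun l : 'I_n => (j <= l)%N : nat)) => [|l _]; last by rewrite permKV.
rewrite -(big_mkord xpredT (fun l => (j <= l)%N : nat)).
have [jn|nj] := leqP n j.
  rewrite big_nat big1; first by lia.
  by move=> l /andP[_ ln]; lia.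
rewrite (big_cat_nat (n := j)) //=; last by lia.
rewrite big_nat big1 => [|l /andP[_ ln]]; last by lia.
rewrite add0n big_nat (eq_bigr (fun=> 1%N)) => [|l /andP[-> //]].
by rewrite -big_nat sum_nat_const_nat muln1.
Qed.

Lemma cornerS v (a : 'I_n) j : corner v a.+1 j = (corner v a j + (j <= v a)%N)%N.
Proof.
rewrite !cornerE (bigD1 a) //= [in RHS](bigD1 a) //= ltnSn ltnn /= addnC; congr addn.
apply: eq_bigr => l la; rewrite ltnS leq_eqVlt.
by case: eqP => // /val_inj e; rewrite e eqxx in la.
Qed.

(* Inside a block where v increases, the values of v that are at least j come  *)
(* last, so the difference of the two counts is minimal at an end of the block.*)
Lemma corner_le_blocks (D : pred nat) v w :
  (forall a b, b = a.+1 :> nat -> ~~ D b -> (v a < v b)%N) ->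
  (forall i j, D i -> corner v i j <= corner w i j)%N ->
  forall i j, (i <= n)%N -> (corner v i j <= corner w i j)%N.
Proof.
move=> vD le i j lein; rewrite leqNgt; apply/negP => lt.
have up k : (i + k <= n)%N -> (forall a : 'I_n, a = i :> nat -> (j <= v a)%N) ->
    (corner w (i + k) j < corner v (i + k) j)%N /\
    forall a : 'I_n, a = (i + k)%N :> nat -> (j <= v a)%N.
  elim: k => [|k IHk] lek va; first by rewrite addn0.
  have [] := IHk _ va; first by lia.
  have ltk : (i + k < n)%N by lia.
  move=> lt' va'; have jv := va' (Ordinal ltk) erefl.
  have lt2 : (corner w (i + k.+1) j < corner v (i + k.+1) j)%N.
    by rewrite addnS (cornerS w (Ordinal ltk)) (cornerS v (Ordinal ltk)) /=; lia.
  split=> // a ea; have := vD (Ordinal ltk) a; rewrite ea addnS => /(_ erefl).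
  case: (boolP (D (i + k).+1)) => [/(le _ j)|_ /(_ isT)]; first by rewrite addnS in lt2; lia.
  by lia.
have [ein|nin] := eqVneq i n; first by move: lt; rewrite ein !corner_full ltnn.
have ltin : (i < n)%N by lia.
have [jv|vj] := leqP j (v (Ordinal ltin)).
  have [|a ea|lt' _] := up (n - i)%N; first by lia.
    by rewrite (_ : a = Ordinal ltin) //; apply: val_inj.
  by move: lt'; rewrite subnKC // !corner_full ltnn.
have down k : (k <= i)%N -> (corner w (i - k) j < corner v (i - k) j)%N /\
    forall a : 'I_n, a = (i - k)%N :> nat -> (v a < j)%N.
  elim: k => [|k IHk] lek.
    by rewrite subn0; split=> // a ea; rewrite (_ : a = Ordinal ltin) //; apply: val_inj.
  have [|lt' va'] := IHk; first by lia.
  have ltk : (i - k.+1 < n)%N by lia. 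
  have ltk' : (i - k < n)%N by lia.
  have e : (i - k = (i - k.+1).+1)%N by lia.
  have vv := va' (Ordinal ltk') erefl.
  have vv' : (v (Ordinal ltk) < j)%N.
    have := vD (Ordinal ltk) (Ordinal ltk') e.
    by case: (boolP (D _)) => [/(le _ j)|_ /(_ isT)] /=; lia.
  split; last by move=> a ea; rewrite (_ : a = Ordinal ltk) //; apply: val_inj.
  move: lt'; rewrite e (cornerS w (Ordinal ltk)) (cornerS v (Ordinal ltk)) /=; lia.
have [_ ] := down i (leqnn _); rewrite subnn.
have [lt0 _] := down i (leqnn _); move: lt0.
by rewrite subnn !cornerE !big1.
Qed.

End BruhatOrder.

(** * Schubert cells *)

Section SchubertCells.
Variables (K : fieldType) (n : nat).
Implicit Types (v w : 'S_n) (a b c : 'I_n) (i j : nat) (L x y u X : 'M[K]_n).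

Definition lower_rel : rel 'I_n := fun c d => (d <= c)%N.
Definition upper_rel : rel 'I_n := fun c d => (c <= d)%N.
Definition inversion w : rel 'I_n := fun c d => (c < d)%N && (w d < w c)%N.
Definition weak_inversion w : rel 'I_n := fun c d => (c == d) || inversion w c d.

Definition unipotent u := forall c d : 'I_n, (d <= c)%N -> u c d = (c == d)%:R.

(* The Schubert cell of w consists of the flags of x *m perm_mx w, for x in    *)
(* cell_mx w.                                                                  *)
Definition cell_mx w x := forall c d, ~~ inversion w c d -> x c d = (c == d)%:R.

Lemma lower_trans : transitive lower_rel.
Proof. by move=> c b d; rewrite /lower_rel => h1 h2; apply: leq_trans h1. Qed.

Lemma upper_trans : transitive upper_rel.
Proof. by move=> c b d; apply: leq_trans. Qed.

Lemma weak_inversion_trans w : transitive (weak_inversion w).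
Proof.
move=> c b d; rewrite /weak_inversion /inversion.
case: eqP => [->//|_] /=; case: eqP => [->|_] /=; first by move=> ->; rewrite orbT.
by lia.
Qed.

Lemma weak_inversion_refl w : reflexive (weak_inversion w).
Proof. by move=> c; rewrite /weak_inversion eqxx. Qed.

Lemma cell_unipotent w x : cell_mx w x -> unipotent x.
Proof. by move=> cx c d dc; apply: cx; rewrite /inversion; lia. Qed.

Lemma cell_supported w x : cell_mx w x -> supported (weak_inversion w) x.
Proof.
move=> cx c d; rewrite negb_or => /andP[/negbTE cd /cx->]; by rewrite cd.
Qed.

Lemma unipotent_supported u : unipotent u -> supported upper_rel u.
Proof.
move=> uu c d; rewrite -ltnNge => dc; rewrite uu ?(ltnW dc) //.
by rewrite -(inj_eq val_inj) gtn_eqF.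
Qed.

Lemma det_unipotent u : unipotent u -> \det u = 1.
Proof.
move=> uu; rewrite -det_tr det_trig.
  by rewrite big1 // => k _; rewrite mxE uu // eqxx.
apply/is_trig_mxP=> c d cd; rewrite mxE uu ?(ltnW cd) //.
by rewrite -(inj_eq val_inj) gtn_eqF.
Qed.

Lemma unipotent_unit u : unipotent u -> u \in unitmx.
Proof. by move=> /det_unipotent; rewrite unitmxE => ->; rewrite unitr1. Qed.

(** [L = u *m invmx u'] is triangular both ways with unit diagonal. Unipotent coordinates in a chart
    are therefore unique. *)
Lemma lower_unipotent_eq L u u' : supported lower_rel L -> unipotent u ->
  unipotent u' -> u = L *m u' -> L = 1%:M.
Proof.
move=> sL uu uu' e; have U := unipotent_unit uu'.
have eL : L = u *m invmx u' by rewrite e mulmxK.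
have sU : supported upper_rel L.
  rewrite eL; apply: supported_mul upper_trans (unipotent_supported uu) _.
  exact: supported_inv (fun c => leqnn c) upper_trans U (unipotent_supported uu').
have off c d : c != d -> L c d = 0.
  rewrite -(inj_eq val_inj) neq_ltn => /orP[h|h]; [apply: sL|apply: sU].
    by rewrite /lower_rel -ltnNge.
  by rewrite /upper_rel -ltnNge.
apply/matrixP=> c d; rewrite mxE; have [<-|/off->//] := eqVneq c d.
move: (congr1 (fun M : 'M_n => M c c) e); rewrite mxE (bigD1 c) //= big1 => [|k kc].
  by rewrite uu // uu' // !eqxx mulr1 addr0 => ->.
by rewrite off ?mul0r // eq_sym.
Qed.

Lemma mul_permE X w c d : (X *m perm_mx w) c (w d) = X c d.
Proof. by rewrite -[w in perm_mx w]invgK -col_permE mxE permK. Qed.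

Lemma perm_mx_mask v (J : pred 'I_n) :
  perm_mx v *m mask K J = mask K (fun l => J (v l)) *m perm_mx v.
Proof.
apply/matrixP=> c d; rewrite maskr -[d in RHS](permKV v) mul_permE !mxE.
rewrite -[c == _](inj_eq (@perm_inj _ v)) permKV.
by case: eqP => [->|_]; rewrite ?mul0r ?mulr1n ?mul1r ?mulr0n.
Qed.

(** On the cell of [w] this rank is [corner w i j]. It measures by how much the dimension of an
    intersection with the reference flag falls short of [i]. *)
Definition corner_rank X i j :=
  \rank (mask K (fun l : 'I_n => (l < i)%N) *m X *m mask K (fun l : 'I_n => (j <= l)%N)).

Lemma corner_rank_mul L X i j :
  (forall c d : 'I_n, (c < i)%N -> (i <= d)%N -> L c d = 0) ->
  (corner_rank (L *m X) i j <= corner_rank X i j)%N.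
Proof.
move=> L0; rewrite /corner_rank.
have -> : mask K (fun l : 'I_n => (l < i)%N) *m (L *m X) =
    mask K (fun l : 'I_n => (l < i)%N) *m L *m
    (mask K (fun l : 'I_n => (l < i)%N) *m X).
  rewrite !mulmxA; congr (_ *m _).
  apply/matrixP=> c d; rewrite maskr !maskl.
  case: (ltnP c i) => ci; rewrite ?mul0r // !mul1r.
  by case: (ltnP d i) => di; rewrite ?mulr1 // L0 ?mul0r.
by rewrite -mulmxA mxrankM_maxr.
Qed.

(** Row [c] of [x *m perm_mx w] vanishes beyond column [w c], so only rows with [j <= w c] reach the
    block. *)
Lemma corner_rank_cell w x i j : cell_mx w x ->
  (corner_rank (x *m perm_mx w) i j <= corner w i j)%N.
Proof.
move=> cx; rewrite /corner_rank.
pose S := [pred l : 'I_n | (l < i)%N && (j <= w l)%N].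
set M := _ *m _.
suff -> : M = mask K S *m M.
  exact: leq_trans (mxrankM_maxl _ _) (rank_mask_le _ _).
apply/matrixP=> c d; rewrite maskl maskr maskl /S /=.
case: (ltnP c i) => ci /=; rewrite ?mul0r // mul1r.
case: (leqP j (w c)) => jw /=; rewrite ?mul1r // mul0r.
rewrite -[d](permKV w) mul_permE permKV; case: (leqP j d) => jd; last by rewrite mulr0.
have wcd : (w c < d)%N by apply: leq_trans jd.
rewrite cx /inversion ?permKV; last by lia.
case: eqP => [e|_]; last by rewrite mul0r.
by rewrite e permKV ltnn in wcd.
Qed.

(** On the rows [S] and the columns [v] of [S] sits a principal submatrix of [y], which is
    unitriangular; ones are put on the rest of the diagonal to read off its rank. *)
Lemma rank_mask_unipotent v y i j : unipotent y ->
  (corner v i j <= \rank (mask K [pred l : 'I_n | (l < i)%N && (j <= v l)%N] *m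
     (y *m perm_mx v *m mask K (fun l : 'I_n => (j <= l)%N))))%N.
Proof.
move=> uy; set S := [pred l : 'I_n | _]; set B := y *m _ *m _.
have -> : corner v i j = #|S| by [].
apply: leq_trans (mxrankM_maxl _ (perm_mx v^-1 *m mask K S)).
have e : mask K S *m B *m (perm_mx v^-1 *m mask K S) = mask K S *m y *m mask K S.
  rewrite /B -mulmxA -[y *m _ *m _]mulmxA perm_mx_mask -!mulmxA.
  rewrite (mulmxA (perm_mx v)) -perm_mxM mulgV perm_mx1 mul1mx maskM.
  by congr (_ *m (_ *m _)); apply: eq_mask => l /=; rewrite /S /=; lia.
rewrite e.
have : unipotent (mask K S *m y *m mask K S + mask K (predC S)).
  move=> c d dc; rewrite mxE maskr maskl uy // !mxE.
  have [->|] := eqVneq c d; last by rewrite mulr0 mul0r mulr0n addr0.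
  have -> : predC S d = ~~ S d by [].
  by case: (S d); rewrite ?mulr1 ?mulr1n ?addr0 ?mulr0 ?add0r.
move=> /unipotent_unit; rewrite -row_free_unit /row_free => /eqP rn.
have := mxrank_add (mask K S *m y *m mask K S) (mask K (predC S)).
have := rank_mask_le K (predC S); rewrite rn.
have : (#|S| + #|predC S| = #|'I_n|)%N by exact: cardC.
rewrite card_ord => h1 h2 h3; rewrite -(leq_add2r #|predC S|) h1.
by apply: leq_trans h3 _; rewrite leq_add2l; exact: h2.
Qed.

Lemma corner_rank_unipotent v y i j : unipotent y ->
  (corner v i j <= corner_rank (y *m perm_mx v) i j)%N.
Proof.
move=> uy; apply: leq_trans (rank_mask_unipotent v i j uy) _; rewrite /corner_rank.
set S := [pred l : 'I_n | _].
have -> : mask K S = mask K S *m mask K (fun l : 'I_n => (l < i)%N).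
  by rewrite maskM; apply/eq_mask => l /=; lia.
by rewrite -!mulmxA mxrankM_maxr.
Qed.

(** The rank of one block is bounded below on the chart of [v] and above on the cell of [w], so a
    common flag compares the two counts. *)
Lemma corner_le_of_cells v w x y L i j : cell_mx w x -> unipotent y ->
  (forall c d : 'I_n, (c < i)%N -> (i <= d)%N -> L c d = 0) ->
  y *m perm_mx v = L *m (x *m perm_mx w) -> (corner v i j <= corner w i j)%N.
Proof.
move=> cx uy L0 e; apply: leq_trans (corner_rank_unipotent v i j uy) _.
by rewrite e; apply: leq_trans (corner_rank_mul _ _ L0) (corner_rank_cell _ _ cx).
Qed.
End SchubertCells.
Arguments lower_trans {n}.
Arguments upper_trans {n}.
Arguments lower_rel {n}.
Arguments upper_rel {n}.

(** * Coordinates near a cell of codimension one *)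

Section BruhatCovers.
Variables (K : fieldType) (n : nat).
Implicit Types (v w : 'S_n) (a b c : 'I_n) (i j : nat) (L x y u X : 'M[K]_n).

(** The combination involves rows of an upper unitriangular matrix: evaluated at the columns of [S]
    in increasing order, it shows the coefficients to vanish one after the other. *)
Lemma unipotent_comb_eq0 u (S J : pred 'I_n) (D z : 'I_n -> K) : unipotent u ->
  (forall l, S l -> J l) ->
  (forall l, J l -> z l = \sum_(k | S k) D k * u k l) ->
  (forall l, S l -> z l = 0) -> forall l, J l -> z l = 0.
Proof.
move=> uu SJ zE z0.
suff D0 : forall m (k : 'I_n), (k < m)%N -> S k -> D k = 0.
  move=> l /zE->; rewrite big1 // => k Sk; by rewrite (D0 n) ?mul0r.
elim=> // m IHm k km Sk; have := zE k (SJ _ Sk); rewrite z0 // (bigD1 k) //=.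
rewrite big1 => [|l /andP[Sl lk]].
  by rewrite uu // eqxx mulr1 addr0.
have [lk'|kl] := ltnP l k; first by rewrite IHm ?mul0r //; lia.
by rewrite uu // (negbTE lk) mulr0.
Qed.

(** When the counts agree, the lower bound from the chart and the upper bound from the cell meet, so
    the rows [k] with [j <= v k] already span the block. *)
Lemma corner_row_comb v w x y L i j (c : 'I_n) : cell_mx w x -> unipotent y ->
  supported lower_rel L -> y *m perm_mx v = L *m (x *m perm_mx w) ->
  corner v i j = corner w i j -> (c < i)%N ->
  exists D : 'I_n -> K, forall l, (j <= v l)%N ->
    y c l = \sum_(k : 'I_n | (k < i)%N && (j <= v k)%N) D k * y k l.
Proof.
move=> cx uy lL e eq_c ci.
set S := [pred l : 'I_n | (l < i)%N && (j <= v l)%N].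
set J := mask K (fun l : 'I_n => (j <= l)%N).
have ge := rank_mask_unipotent v i j uy; rewrite -/S -/J in ge.
set B := y *m _ *m _ in ge.
have le : (\rank (mask K (fun l : 'I_n => (l < i)%N) *m B) <= corner v i j)%N.
  rewrite eq_c /B mulmxA e; apply: leq_trans (corner_rank_cell i j cx).
  apply: corner_rank_mul => k l ki il; apply: lL; rewrite /lower_rel; lia.
have sub : (mask K S *m B <= mask K (fun l : 'I_n => (l < i)%N) *m B)%MS.
  have -> : mask K S = mask K S *m mask K (fun l : 'I_n => (l < i)%N).
    by rewrite maskM; apply/eq_mask => l /=; lia.
  by rewrite -mulmxA submxMl.
have /submxP[D eD] : (mask K (fun l : 'I_n => (l < i)%N) *m B <= mask K S *m B)%MS.
  have [_ /esym] := mxrank_leqif_eq sub; rewrite eqn_leq (leq_trans le ge) andbT.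
  by rewrite (mxrankS sub) => /andP[].
exists (fun k => D c k) => l jl; move: (congr1 (fun M : 'M_n => M c (v l)) eD).
rewrite maskl ci mul1r /B maskr mul_permE jl mulr1 => ->.
rewrite mxE [RHS]big_mkcond /=; apply: eq_bigr => k _.
rewrite maskl maskr mul_permE jl mulr1 /S /=.
by case: (_ && _); rewrite ?mul1r ?mul0r ?mulr0.
Qed.

Lemma corner_row_vanish v w x y L i j (c : 'I_n) : cell_mx w x -> unipotent y ->
  supported lower_rel L -> y *m perm_mx v = L *m (x *m perm_mx w) ->
  corner v i j = corner w i j -> (c < i)%N ->
  (forall k : 'I_n, (k < i)%N -> (j <= v k)%N -> (k < c)%N) ->
  forall l, (j <= v l)%N -> y c l = 0.
Proof.
move=> cx uy lL e eq_c ci lt l jl.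
have [D eD] := corner_row_comb cx uy lL e eq_c ci.
apply: (unipotent_comb_eq0 (S := fun k : 'I_n => (k < i)%N && (j <= v k)%N)
  (J := fun k => (j <= v k)%N) uy _ eD _ jl) => [k /andP[]//|k /andP[h1 h2]].
have kc := lt _ h1 h2; rewrite uy ?(ltnW kc) // -(inj_eq val_inj) /= gtn_eqF //.
Qed.

Section Cover.
Variables (v : 'S_n) (a b : 'I_n).
Hypothesis ab : (a < b)%N.

Definition transvection (t : K) : 'M[K]_n := 1%:M + t *: delta_mx a b.

Lemma delta_mull X c d : (delta_mx a b *m X) c d = (c == a)%:R * X b d.
Proof.
rewrite mxE (bigD1 b) //= big1 => [|k kb]; rewrite !mxE; last first.
  by rewrite (negbTE kb) andbF mul0r.
by rewrite eqxx andbT addr0.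
Qed.

Lemma delta_mulr X c d : (X *m delta_mx a b) c d = X c a * (d == b)%:R.
Proof.
rewrite mxE (bigD1 a) //= big1 => [|k ka]; rewrite !mxE; last first.
  by rewrite (negbTE ka) mulr0.
by rewrite eqxx addr0.
Qed.

Lemma transvection_mulE t X c d :
  (transvection t *m X) c d = X c d + (c == a)%:R * (t * X b d).
Proof.
by rewrite mulmxDl mul1mx -scalemxAl mxE [X in _ + X]mxE delta_mull mulrCA.
Qed.

Lemma transvectionM s t : transvection s *m transvection t = transvection (s + t).
Proof.
apply/matrixP=> c d; rewrite transvection_mulE !mxE.
have -> : (b == a) = false by apply/negbTE; rewrite -(inj_eq val_inj) /=; lia.
rewrite [b == d]eq_sym; case: (c == a); case: (d == b); case: (c == d); rewrite /=; ring.
Qed.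

Lemma transvection0 : transvection 0 = 1%:M.
Proof. by rewrite /transvection scale0r addr0. Qed.

Lemma transvection_unipotent t : unipotent (transvection t).
Proof.
move=> c d dc; rewrite !mxE; case: andP => [[/eqP ca /eqP db]|_].
  by move: dc; rewrite ca db; lia.
by rewrite mulr0 addr0.
Qed.

Hypothesis vab : (v a < v b)%N.
Hypothesis cov : forall c, (a < c < b)%N -> ~~ (v a < v c < v b)%N.

(** In the chart of [v], points of the covering cell differ from the cell of [v] by a transvection
    only. The counts of [v] and of its cover differ just on the rectangle cut out by [a] and [b];
    for a row [c] other than [a], the corner at [c.+1], [(v c).+1] avoids it by the cover
    hypothesis, and the row vanishes at non-inversions. *)
Lemma cover_coordinates x y L : cell_mx (tperm a b * v) x -> unipotent y ->
  supported lower_rel L ->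
  y *m perm_mx v = L *m (x *m perm_mx (tperm a b * v)) ->
  cell_mx v (transvection (- y a b) *m y).
Proof.
move=> cx uy lL e c d nvcd.
have row i j c' := @corner_row_vanish v _ x y L i j c' cx uy lL e.
rewrite transvection_mulE.
have ba : (b == a) = false by apply/negbTE; rewrite -(inj_eq val_inj) /=; lia.
have [dc|cd] := leqP d c.
  rewrite uy //; have [ca|_] := eqVneq c a; last by rewrite mul0r addr0.
  rewrite [y b d]uy; last by rewrite ca in dc; lia.
  have -> : (b == d) = false by apply/negbTE; rewrite -(inj_eq val_inj) /= gtn_eqF //; rewrite ca in dc; lia.
  by rewrite !mulr0 addr0.
have -> : (c == d) = false by apply/negbTE; rewrite -(inj_eq val_inj) ltn_eqF.
have vcd : (v c < v d)%N.
  have := perm_neq v (a := c) (b := d); rewrite -(inj_eq val_inj) ltn_eqF // => /(_ isT).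
  by move: nvcd; rewrite /inversion cd /=; lia.
have [ca|ca] := eqVneq c a; last first.
  rewrite mul0r addr0; apply: (row c.+1 (v c).+1 c) => //.
    rewrite corner_tperm // -[LHS]addn0; congr addn; apply/esym/eqP; rewrite eqb0.
    apply/negP=> /andP[/andP[h1 h2] /andP[h3 h4]].
    have := cov (c := c); have := perm_neq v ca; have : (a < c)%N; last by lia.
    by rewrite ltn_neqAle -ltnS h1 andbT (inj_eq val_inj) eq_sym.
  move=> k; rewrite ltnS leq_eqVlt => /orP[/eqP/val_inj->|//].
  by lia.
move: cd vcd {nvcd}; rewrite {}ca mul1r mulNr => ad vad.
have rowa l : (v b < v l)%N -> y a l = 0.
  apply: (row a.+1 (v b).+1 a) => //.
    rewrite corner_tperm // -[LHS]addn0; congr addn; apply/esym/eqP; rewrite eqb0.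
    by lia.
  move=> k; rewrite ltnS leq_eqVlt => /orP[/eqP/val_inj->|//]; by lia.
(* The rows up to [b] form a block just outside the rectangle. Row [b] is one of its spanning rows,
   so row [a] minus [y a b] times row [b] is again a combination of them, and it vanishes in their
   columns. *)
have [||D eD] := @corner_row_comb v _ x y L b.+1 (v a).+1 a cx uy lL e.
- rewrite corner_tperm // -[LHS]addn0; congr addn; apply/esym/eqP; rewrite eqb0.
  by lia.
- by lia.
pose D' k := D k - y a b * (k == b)%:R.
pose S := fun k : 'I_n => (k < b.+1)%N && (v a < v k)%N.
apply: (unipotent_comb_eq0 (S := S) (J := fun k => (v a < v k)%N) (D := D')
   (z := fun l => y a l - y a b * y b l) uy _ _ _ vad).
- by move=> k /andP[].
- move=> l /eD->; rewrite /D'; under [RHS]eq_bigr do rewrite mulrBl.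
  rewrite sumrB; congr (_ - _); rewrite (bigD1 b) /=; last by rewrite /S ltnSn.
  rewrite eqxx mulr1 big1 ?addr0 // => k /andP[_ /negbTE->]; by rewrite mulr0 mul0r.
- move=> k /andP[kb vak]; have [->|kb'] := eqVneq k b.
    by rewrite [y b b]uy // eqxx mulr1 subrr.
  have kb2 : (k < b)%N by rewrite ltn_neqAle -ltnS kb andbT (inj_eq val_inj).
  rewrite [y b k]uy ?(ltnW kb2) // [b == k]eq_sym (negbTE kb') mulr0 subr0.
  have [ka|ak] := leqP k a.
    rewrite uy //; have [eak|//] := eqVneq a k; by move: vak; rewrite eak ltnn.
  apply: rowa; have := cov (c := k); have := perm_neq v kb'; lia.
Qed.

(** Splits an infinitesimal motion, conjugated by the transvection, into a motion inside the cell of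
    [v], a change [k] of the transvection parameter, and a lower triangular part [Z] that leaves the
    flag in place. *)
Lemma transvection_lie t X : (forall c d, (v c < v d)%N -> X c d = 0) ->
  exists (X' : 'M[K]_n) (k : K) (Z : 'M[K]_n),
  [/\ supported (inversion v) X', supported lower_rel Z &
  transvection t *m X =
    transvection t *m X' + k *: delta_mx a b + Z *m transvection t].
Proof.
move=> sX.
(* Conjugation adds row [b] to row [a] and subtracts column [a] from column [b]. Lower triangular
   entries that thereby land above the diagonal are absorbed by [X']; entry [(a, b)] is left to
   [k]. *)
pose X' : 'M[K]_n := \matrix_(c, d) if inversion v c d
  then X c d + ((c == a) && (d < b)%N)%:R * (t * X b d)
    - ((d == b) && (a < c)%N)%:R * (t * X c a) else 0.
pose Y := X - X'.
pose k := Y a b + t * Y b b - t * Y a a - t * t * Y b a.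
exists X', k, (transvection t *m Y *m transvection (- t) - k *: delta_mx a b).
have sX' : supported (inversion v) X' by move=> c d h; rewrite mxE (negbTE h).
split=> //; last first.
  rewrite mulmxBl -!mulmxA transvectionM addNr transvection0 mulmx1 mulmxBr.
  have -> : k *: delta_mx a b *m transvection t = k *: delta_mx a b.
    rewrite mulmxDr mulmx1 -scalemxAl -scalemxAr mul_delta_mx_0 ?scaler0 ?addr0 //.
    by rewrite -(inj_eq val_inj) /= gtn_eqF.
  move: (_ *m X) (_ *m X') (k *: _) => A B C.
  by apply/matrixP=> c d; rewrite !mxE; ring.
have ZE c d : (transvection t *m Y *m transvection (- t) - k *: delta_mx a b) c d
  = Y c d + (c == a)%:R * (t * Y b d) - (d == b)%:R * (t * Y c a)
    - (c == a)%:R * (d == b)%:R * (t * t * Y b a) - k * ((c == a) && (d == b))%:R.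
  rewrite mxE [in X in _ + X]mxE [in X in _ + - X]mxE [delta_mx _ _ _ _]mxE.
  congr (_ - _); rewrite mulmxDr mulmx1 -scalemxAr mxE [X in _ + X]mxE delta_mulr.
  rewrite !transvection_mulE; ring.
move=> c d; rewrite /lower_rel -ltnNge => cd; rewrite ZE.
have na (e : 'I_n) : (a < e)%N -> (e == a) = false.
  by move=> h; apply/negbTE; rewrite -(inj_eq val_inj) /= gtn_eqF.
have YE e f : Y e f = X e f - X' e f by rewrite !mxE.
have X'0 e f : ~~ inversion v e f -> X' e f = 0 by exact: sX'.
have [ca|ca] := eqVneq c a; have [db|db] := eqVneq d b; rewrite /= ?andbF ?mul0r ?mul1r ?mulr0 ?mulr1 ?subr0 ?addr0.
- by rewrite /k ca db; ring.
- rewrite !YE; move: cd; rewrite ca => ad.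
  have vbd := perm_neq v db; have vad : v d != v a :> nat by rewrite perm_neq // na.
  have [dltb|bltd] := ltnP d b.
    rewrite (X'0 b d) /inversion ?[X' a d]mxE /inversion ?ad ?dltb ?(negbTE db) ?eqxx /=; last by lia.
    case: ifP => h; first by ring.
    by rewrite (sX a d) ?(sX b d); [ring | have := cov (c := d); lia | lia].
  have bd : (b < d)%N by rewrite ltn_neqAle bltd eq_sym andbT.
  have db' : (d < b)%N = false by lia.
  rewrite !mxE /inversion ad bd db' (negbTE db) (na b) // eqxx /=.
  case: ifP => h1; case: ifP => h2; do ?[by ring].
  - by rewrite (sX b d); [ring | lia].
  - by rewrite (sX a d); [ring | lia].
  - by rewrite (sX a d) ?(sX b d); [ring | lia | lia].
- rewrite !YE; move: cd; rewrite db => cb.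
  have vca := perm_neq v ca; have vcb : v c != v b :> nat.
    by rewrite perm_neq // -(inj_eq val_inj) /= ltn_eqF.
  have [cles|altc] := leqP c a.
    have clta : (c < a)%N by rewrite ltn_neqAle cles andbT.
    have ac : (a < c)%N = false by lia.
    have ab' : (a == b) = false by rewrite eq_sym na.
    rewrite !mxE /inversion cb clta ac (negbTE ca) eqxx ab' /=.
    case: ifP => h1; case: ifP => h2; do ?[by ring].
    - by rewrite (sX c a); [ring | lia].
    - by rewrite (sX c b); [ring | lia].
    - by rewrite (sX c b) ?(sX c a); [ring | lia | lia].
  rewrite (X'0 c a) /inversion ?[X' c b]mxE /inversion ?cb ?altc ?(negbTE ca) ?eqxx /=; last by lia.
  case: ifP => h; first by ring.
  by rewrite (sX c b) ?(sX c a); [ring | have := cov (c := c); lia | lia].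
- rewrite YE mxE; case: (boolP (inversion v c d)) => h.
    by rewrite (negbTE ca) (negbTE db) !mul0r addr0 subr0 subrr.
  rewrite subr0; apply: sX; have := perm_neq v (a := c) (b := d).
  by rewrite -(inj_eq val_inj) ltn_eqF // => /(_ isT); move: h; rewrite /inversion cd /=; lia.
Qed.
End Cover.

End BruhatCovers.

(** * Osculating conditions *)

Section Incidence.
Variables (K : numFieldType) (n : nat).
Implicit Types (v w : 'S_n) (a b : 'I_n) (A H X L : 'M[K]_n) (s t : K) (del : nat).

Definition top del : 'M[K]_n := mask K (fun l : 'I_n => (l < del)%N).

(** Row [del + l] is the [l]-th derivative at [s] of the monomial curve [(1, x, .., x^(n-1))]; a
    rational normal curve is this one up to a change of basis. *)
Definition osc_mx del s : 'M[K]_n := \matrix_(i, j)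
  (if (i < del)%N then 0 else (j ^_ (i - del))%:R * s ^+ (j - (i - del))).

(* The span of the first del rows of A meets the osculating space of dimension *)
(* n - del at s iff this matrix is singular.                                   *)
Definition incidence del s A : 'M[K]_n := top del *m A + osc_mx del s.

Lemma incidenceE del s A (i j : 'I_n) : incidence del s A i j =
  if (i < del)%N then A i j else osc_mx del s i j.
Proof.
by rewrite mxE maskl [osc_mx _ _ _ _]mxE; case: ltnP => _;
  rewrite ?mul1r ?mul0r ?addr0 ?add0r.
Qed.

(** The factor by which a change of basis [L] that preserves the span of the first [del] rows
    multiplies the incidence matrix. *)
Definition corner_mull del L : 'M[K]_n :=
  top del *m L *m top del + mask K (predC (fun l : 'I_n => (l < del)%N)).

Section MulLeft.
Variables (del : nat) (L : 'M[K]_n).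
Hypothesis L0 : forall c d : 'I_n, (c < del)%N -> (del <= d)%N -> L c d = 0.

Lemma top_mull H : top del *m (L *m H) = corner_mull del L *m (top del *m H).
Proof.
rewrite mulmxDl mulmxA [mask _ _ *m (_ *m _)]mulmxA maskM.
rewrite (_ : mask _ _ = 0) ?mul0mx ?addr0; last first.
  by apply/matrixP=> c d; rewrite !mxE /= andNb mul0rn.
rewrite !mulmxA; congr (_ *m _); rewrite -mulmxA maskM.
apply/matrixP=> c d; rewrite maskl !maskr maskl andbb.
case: (ltnP c del) => hc; rewrite ?mul0r // mul1r.
by case: (ltnP d del) => hd; rewrite ?mulr1 // L0 ?mul0r.
Qed.

Lemma incidence_mull s A :
  incidence del s (L *m A) = corner_mull del L *m incidence del s A.
Proof.
rewrite /incidence top_mull mulmxDr; congr (_ + _).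
rewrite mulmxDl -mulmxA [top del *m osc_mx _ _](_ : _ = 0); last first.
  by apply/matrixP=> c d; rewrite maskl !mxE; case: ltnP => _; rewrite ?mul0r ?mulr0.
rewrite mulmx0 add0r; apply/matrixP=> c d; rewrite maskl !mxE /=.
by case: ltnP => _; rewrite ?mul1r ?mul0r.
Qed.

Lemma incidence_mull_eq0 s A :
  \det (incidence del s A) = 0 -> \det (incidence del s (L *m A)) = 0.
Proof. by rewrite incidence_mull det_mulmx => ->; rewrite mulr0. Qed.

Lemma incidence_slope_mull s A H :
  det_slope (incidence del s A) (incidence del s A) (top del *m H) = 0 ->
  det_slope (incidence del s (L *m A)) (incidence del s (L *m A))
    (top del *m (L *m H)) = 0.
Proof.
move=> e; rewrite incidence_mull top_mull.
have := det_slope_diagM (corner_mull del L) 1%:M (incidence del s A) (top del *m H).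
by rewrite !mulmx1 e mulr0 mul0r.
Qed.

(** An infinitesimal change of basis within the flag acts on the incidence matrix by left
    multiplication, so a singular one stays singular to first order. *)
Lemma incidence_slope_lower s A : \det (incidence del s A) = 0 ->
  det_slope (incidence del s A) (incidence del s A) (top del *m (L *m A)) = 0.
Proof.
move=> d0; rewrite (_ : _ *m _ = (top del *m L) *m incidence del s A).
  exact: det_slope_diag_mull.
rewrite /incidence mulmxDr !mulmxA [X in _ + X](_ : _ = 0) ?addr0; last first.
  apply/matrixP=> c d; rewrite -mulmxA maskl !mxE.
  case: (ltnP c del) => hc; rewrite ?mul0r // big1 ?mulr0 // => k _; rewrite mxE.
  by case: (ltnP k del) => hk; rewrite ?mulr0 // L0 ?mul0r.
congr (_ *m _); apply/matrixP=> c d; rewrite maskr !maskl.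
case: (ltnP c del) => hc; rewrite ?mul0r // mul1r.
by case: (ltnP d del) => hd; rewrite ?mulr1 // L0 ?mul0r.
Qed.

End MulLeft.

Section Rescale.
Variables (del : nat) (s : K) (r : 'I_n -> K).
Hypothesis s0 : s != 0.

(** The torus acts through the column factors [s ^- j], which carry the osculating spaces of the
    monomial curve at [s] to those at 1; the row factors [r] only rescale basis vectors. *)
Definition rescale A : 'M[K]_n := \matrix_(i, j) (r i * A i j * s ^- j).

Let C : 'M[K]_n := diag_mx (\row_i if (i < del)%N then r i else s ^+ (i - del)).
Let D : 'M[K]_n := diag_mx (\row_j (s ^- j)).

Let CD (M : 'M[K]_n) i j : (C *m M *m D) i j =
  (if (i < del)%N then r i else s ^+ (i - del)) * M i j * s ^- j.
Proof. by rewrite mul_mx_diag mul_diag_mx !mxE. Qed.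

Lemma incidence_rescale A : C *m incidence del s A *m D = incidence del 1 (rescale A).
Proof.
apply/matrixP=> i j; rewrite CD !incidenceE !mxE expr1n mulr1.
case: ltnP => // _.
have [le|lt] := leqP (i - del) j; last by rewrite ffact_small // !mul0r mulr0 mul0r.
by rewrite mulrCA -exprD subnKC // mulfK // expf_eq0 negb_and s0 orbT.
Qed.

Lemma top_rescale H : C *m (top del *m H) *m D = top del *m rescale H.
Proof.
apply/matrixP=> i j; rewrite CD !maskl mxE.
by case: ltnP => _; rewrite ?mul1r ?mul0r ?mulr0 ?mul0r.
Qed.

Lemma incidence_rescale_eq0 A : \det (incidence del s A) = 0 ->
  \det (incidence del 1 (rescale A)) = 0.
Proof. by move=> e; rewrite -incidence_rescale !det_mulmx e mulr0 mul0r. Qed.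

Lemma incidence_slope_rescale A H :
  det_slope (incidence del s A) (incidence del s A) (top del *m H) = 0 ->
  det_slope (incidence del 1 (rescale A)) (incidence del 1 (rescale A))
    (top del *m rescale H) = 0.
Proof.
by move=> e; rewrite -incidence_rescale -top_rescale det_slope_diagM e mulr0 mul0r.
Qed.

End Rescale.

Definition ffact_poly l : {poly K} := \prod_(k <- iota 0 l) ('X - k%:R%:P).

Lemma ffact_polyE l (j : nat) : (ffact_poly l).[j%:R] = (j ^_ l)%:R.
Proof.
rewrite /ffact_poly; elim: l => [|l IHl]; first by rewrite big_nil hornerC ffactn0.
rewrite -addn1 iotaD big_cat big_seq1 /= add0n hornerM IHl hornerXsubC addn1 ffactnSr natrM.
have [le|lt] := leqP l j; first by rewrite natrB.
by rewrite ffact_small // !mul0r.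
Qed.

(** A row dependency yields a combination of falling factorials of degree less than [n - del] that
    vanishes at the [n - del] integers [j] with [del <= (w^-1)%g j]. These are distinct in
    characteristic zero, so the polynomial is 0. *)
Lemma incidence_perm_neq0 del w : \det (incidence del 1 (perm_mx w)) != 0.
Proof.
rewrite -unitfE -unitmxE -row_free_unit; apply/inj_row_free => lam e.
have eE (j : 'I_n) : \sum_i lam 0 i * incidence del 1 (perm_mx w) i j = 0.
  by have := congr1 (fun M : 'rV_n => M 0 j) e; rewrite !mxE.
pose P := \sum_(i < n | (del <= i)%N) lam 0 i *: ffact_poly (i - del).
have PE (j : nat) : P.[j%:R] = \sum_(i < n | (del <= i)%N) lam 0 i * (j ^_ (i - del))%:R.
  by rewrite horner_sum; apply: eq_bigr => i _; rewrite hornerZ ffact_polyE.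
have lam0 : forall i : 'I_n, (del <= i)%N -> lam 0 i = 0.
  have [P0|nP0] := eqVneq P 0; last first.
    pose rs := [seq (val j)%:R : K | j <- enum [pred j : 'I_n | (del <= (w^-1)%g j)%N]].
    have : (size rs < size P)%N.
      apply: max_poly_roots => //.
        apply/allP=> x /mapP[j]; rewrite mem_enum inE => dj ->.
        rewrite rootE PE -[X in _ == X](eE j) [X in _ == X](bigID (fun i : 'I_n => (i < del)%N)) /=.
        rewrite [X in _ == X + _]big1 ?add0r => [|i idel].
          apply/eqP; apply: eq_big => i; first by rewrite -leqNgt.
          by rewrite leqNgt => /negbTE h; rewrite incidenceE h mxE h expr1n mulr1.
        rewrite incidenceE idel !mxE; case: eqP => [e'|_]; last by rewrite mulr0.
        by move: dj; rewrite -e' permK leqNgt idel.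
      rewrite map_inj_uniq ?enum_uniq // => i j /eqP; rewrite eqr_nat => /eqP; exact: val_inj.
    have -> : size rs = (n - del)%N.
      rewrite size_map -cardE -(corner_full (w^-1)%g del).
      by apply: eq_card => j; rewrite !inE ltn_ord.
    have : (size P <= n - del)%N; last by lia.
    apply: leq_trans (size_sum _ _ _) _; apply/bigmax_leqP => i di.
    apply: leq_trans (size_scale_leq _ _) _; rewrite size_prod_XsubC size_iota.
    by have := ltn_ord i; lia.
  (* Evaluation at 0, 1, 2, .. is triangular on falling factorials. *)
  suff H : forall l (i : 'I_n), i = (del + l)%N :> nat -> lam 0 i = 0.
    by move=> i di; apply: (H (i - del)%N); lia.
  elim/ltn_ind=> l IHl i ei; have := PE l; rewrite P0 horner0 (bigD1 i) /=; last by lia.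
  rewrite big1 ?addr0 => [/esym/eqP|k /andP[dk ki]].
    by rewrite ei addKn ffactnn mulf_eq0 pnatr_eq0 (gtn_eqF (fact_gt0 _)) orbF => /eqP.
  have [lt|ge] := ltnP (k - del) l; first by rewrite (IHl _ lt) ?mul0r //; lia.
  rewrite ffact_small ?mulr0 //; move: ki; rewrite -(inj_eq val_inj) /=; lia.
apply/rowP=> i; rewrite mxE; have [/lam0//|idel] := leqP del i.
rewrite -[RHS](eE (w i)) (bigD1 i) //= incidenceE idel !mxE eqxx mulr1.
rewrite big1 ?addr0 // => k ki; have [/lam0->|kd] := leqP del k; first by rewrite mul0r.
by rewrite incidenceE kd !mxE (inj_eq perm_inj) (negbTE ki) mulr0.
Qed.

Section Transvection.
Variables (v : 'S_n) (a b : 'I_n) (del : nat).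
Hypothesis (ab : (a < b)%N).

(** The first [del] rows contain both or neither of the rows [a] and [b], so the transvection
    preserves their span, and it has determinant one. *)
Lemma incidence_transvection_out s t A : ~~ (a < del <= b)%N ->
  \det (incidence del s (transvection a b t *m A)) = \det (incidence del s A).
Proof.
rewrite negb_and -leqNgt -ltnNge => /orP[da|bd].
  congr (\det _); apply/matrixP=> i j; rewrite !incidenceE transvection_mulE.
  case: ltnP => // id; have [ia|_] := eqVneq i a; last by rewrite mul0r addr0.
  by rewrite ia in id; lia.
rewrite (_ : incidence _ _ _ = transvection a b t *m incidence del s A).
  by rewrite det_mulmx (det_unipotent (transvection_unipotent ab t)) mul1r.
apply/matrixP=> i j; rewrite transvection_mulE !incidenceE bd transvection_mulE.
case: ltnP => // id; have [ia|_] := eqVneq i a; last by rewrite mul0r addr0.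
by rewrite ia in id; lia.
Qed.

(** Replacing row [a] by row [b] gives the coefficient of [t] in the determinant of the transvected
    incidence matrix. *)
Definition copy_row A : 'M[K]_n := \matrix_(i, j) A (if i == a then b else i) j.

Hypothesis delab : (a < del <= b)%N.

Lemma incidence_transvection s t A :
  \det (incidence del s (transvection a b t *m A)) =
  \det (incidence del s A) + t * \det (incidence del s (copy_row A)).
Proof.
rewrite -[X in X + _]mul1r; have /andP[ad _] := delab.
apply: (determinant_multilinear (i0 := a)).
- apply/rowP=> j; rewrite [LHS]mxE [RHS]mxE ![fun_of_matrix (_ *: _) _ _]mxE ![row _ _ _ _]mxE.
  by rewrite !incidenceE ad transvection_mulE eqxx [copy_row _ _ _]mxE eqxx !mul1r.
- apply/matrixP=> i j; rewrite ![row' _ _ _ _]mxE !incidenceE transvection_mulE.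
  by rewrite eq_sym (negbTE (neq_lift _ _)) mul0r addr0.
- apply/matrixP=> i j; rewrite ![row' _ _ _ _]mxE !incidenceE transvection_mulE.
  by rewrite [copy_row _ _ _]mxE eq_sym (negbTE (neq_lift _ _)) mul0r addr0.
Qed.

(** As [del <= b], the original row [b] is invisible to the condition, so copying amounts to a
    transposition. The coefficient of [t] is thus a determinant at a torus fixed point. *)
Lemma incidence_copy_row s : incidence del s (copy_row (perm_mx v)) =
  incidence del s (perm_mx (tperm a b * v)).
Proof.
apply/matrixP=> i j; rewrite !incidenceE; case: ltnP => // id.
rewrite !mxE permM; case: (i =P a) => [->|ia]; first by rewrite tpermL.
rewrite tpermD // 1?eq_sym; first exact/eqP.
by rewrite -(inj_eq val_inj) /= ltn_eqF //; lia.
Qed.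

Lemma incidence_slope_transvection s t k :
  det_slope (incidence del s (transvection a b t *m perm_mx v))
    (incidence del s (transvection a b t *m perm_mx v))
    (top del *m (k *: delta_mx a b *m perm_mx v)) =
  k * \det (incidence del s (perm_mx (tperm a b * v))).
Proof.
have /andP[ad _] := delab.
rewrite -scalemxAl -scalemxAr det_slopeZ; congr (_ * _).
rewrite /det_slope (bigD1 a) //= big1 ?addr0 => [|c ca]; last first.
  rewrite (expand_det_row _ c) big1 // => j _.
  rewrite mxE ltnn eqxx maskl delta_mull (negbTE ca) mul0r mulr0 mul0r //.
rewrite -incidence_copy_row; congr (\det _); apply/matrixP=> i j.
rewrite mxE maskl delta_mull !incidenceE transvection_mulE (inj_eq val_inj).
rewrite [copy_row _ _ _]mxE; have [->|ia] := eqVneq i a; first by rewrite ltnn ad !mul1r.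
by rewrite !mul0r addr0 if_same.
Qed.

End Transvection.

End Incidence.

From mathcomp Require Import all_classical all_reals topology normedtype derive.
Import Order.TTheory GRing.Theory Num.Theory numFieldNormedType.Exports.

Local Open Scope classical_set_scope.
Local Open Scope ring_scope.

(** * Limits along filters *)

Section MatrixLimits.
Variables (K : numClosedFieldType) (T : Type) (F : set_system T).
Context {FF : ProperFilter F}.
Variable n : nat.
Implicit Types (A B H : T -> 'M[K]_n) (M N Q : 'M[K]_n) (f g : T -> K) (l : K).

Definition mx_lim A M := forall i j, A t i j @[t --> F] --> M i j.

Lemma cvg_sum_fin (I : finType) (P : pred I) (f : I -> T -> K) (l : I -> K) :
  (forall i, P i -> f i t @[t --> F] --> l i) ->
  (\sum_(i | P i) f i t) @[t --> F] --> \sum_(i | P i) l i.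
Proof.
move=> h; rewrite (_ : (fun t => _) = \sum_(i | P i) f i); last first.
  by apply/funext => t; rewrite fct_sumE.
elim/big_ind2: _ => // [|g m g' m' hg hg'].
  exact: cvg_cst.
exact: cvgD.
Qed.

Lemma cvg_prod_fin (I : finType) (P : pred I) (f : I -> T -> K) (l : I -> K) :
  (forall i, P i -> f i t @[t --> F] --> l i) ->
  (\prod_(i | P i) f i t) @[t --> F] --> \prod_(i | P i) l i.
Proof.
move=> h; rewrite (_ : (fun t => _) = \prod_(i | P i) f i); last first.
  by apply/funext => t; rewrite fct_prodE.
elim/big_ind2: _ => // [|g m g' m' hg hg'].
  exact: cvg_cst.
exact: cvgM.
Qed.

Lemma cvg_expn f l m : f t @[t --> F] --> l -> (f t ^+ m) @[t --> F] --> l ^+ m.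
Proof.
move=> fl; elim: m => [|m IHm]; first exact: cvg_cst.
by rewrite exprS; under eq_fun do rewrite exprS; exact: cvgM.
Qed.

Lemma mx_lim_cst M : mx_lim (fun=> M) M.
Proof. by move=> i j; exact: cvg_cst. Qed.

Lemma mx_limD A B M N : mx_lim A M -> mx_lim B N ->
  mx_lim (fun t => A t + B t) (M + N).
Proof.
move=> hA hB i j; rewrite mxE; under eq_fun do rewrite mxE; exact: cvgD.
Qed.

Lemma mx_limM A B M N : mx_lim A M -> mx_lim B N ->
  mx_lim (fun t => A t *m B t) (M *m N).
Proof.
move=> hA hB i j; rewrite mxE; under eq_fun do rewrite mxE.
by apply: cvg_sum_fin => k _; exact: cvgM.
Qed.

Lemma mx_limZ f A l M : f t @[t --> F] --> l -> mx_lim A M ->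
  mx_lim (fun t => f t *: A t) (l *: M).
Proof.
move=> hf hA i j; rewrite mxE; under eq_fun do rewrite mxE; exact: cvgM.
Qed.

Lemma cvg_det A M : mx_lim A M -> \det (A t) @[t --> F] --> \det M.
Proof.
move=> hA; apply: cvg_sum_fin => s _; apply: cvgM; first exact: cvg_cst.
by apply: cvg_prod_fin => i _; exact: hA.
Qed.

Lemma cvg_det_slope A B H M N Q : mx_lim A M -> mx_lim B N -> mx_lim H Q ->
  det_slope (A t) (B t) (H t) @[t --> F] --> det_slope M N Q.
Proof.
move=> hA hB hH; apply: cvg_sum_fin => a _; apply: cvg_det => i j.
rewrite mxE; under eq_fun do rewrite mxE.
by case: ifP => _; [exact: hB | case: ifP => _; [exact: hH | exact: hA]].
Qed.

Lemma cvg_eq0 f l : f t @[t --> F] --> l -> (\forall t \near F, f t = 0) -> l = 0.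
Proof.
move=> fl f0; apply: (norm_cvg_unique (F := f @ F)) fl _.
exact: cvg_near_cst.
Qed.

Lemma cvg_inj f l l' : f t @[t --> F] --> l -> f t @[t --> F] --> l' -> l = l'.
Proof. exact: norm_cvg_unique. Qed.

Lemma cvg_neq0 f l : f t @[t --> F] --> l -> l != 0 -> \forall t \near F, f t != 0.
Proof. by move=> fl l0; exact: cvgr_neq0 fl l0. Qed.

Lemma cvg_conj f l : f t @[t --> F] --> l -> (f t)^* @[t --> F] --> l^*.
Proof.
move=> /cvgrPdist_lt h; apply/cvgrPdist_lt => e e0.
by near=> t; rewrite -rmorphB norm_conjC; near: t; exact: h.
Unshelve. all: by end_near. Qed.

End MatrixLimits.

(** An ultrafilter cannot contain the complements of finitely many sets that together cover one of
    its members. *)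
Lemma ultra_exists (T : Type) (F : set_system T) (I : finType) (P : I -> T -> Prop) :
  UltraFilter F -> (\forall t \near F, exists i, P i t) ->
  exists i, \forall t \near F, P i t.
Proof.
move=> UF h; apply: contrapT => /forallNP nP.
have : \forall t \near F, forall i, ~ P i t.
  by apply: filter_forall => i; have [/nP//|] := in_ultra_setVsetC [set t | P i t] UF.
move=> h'; have [t [[i Pi] nPi]] := filter_ex (filterI h h'); exact: (nPi i).
Qed.

Lemma finite_max (K : numDomainType) (I : finType) (g : I -> K) (i0 : I) :
  (forall i, 0 <= g i) -> exists j, forall i, g i <= g j.
Proof.
move=> g0; suff [j jP] : exists j, forall i, i \in enum I -> g i <= g j.
  by exists j => i; apply: jP; rewrite mem_enum.
elim: (enum I) => [|x s [j jP]]; first by exists i0.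
have /orP[xj|jx] := ger_leVge (g0 x) (g0 j).
  by exists j => i; rewrite inE => /orP[/eqP->//|/jP].
exists x => i; rewrite inE => /orP[/eqP->//|/jP ij]; exact: le_trans jx.
Qed.

(** * Compactness of the flag manifold in explicit coordinates *)

Section LimitChart.
Variables (K : numClosedFieldType) (T : Type) (F : set_system T).
Context {UF : UltraFilter F}.
(** Compactness of the unit disc, phrased for ultrafilters; [complex_ultra_cvg] provides it for
    [R[i]]. *)
Hypothesis ultra_cvg : forall f : T -> K,
  (\forall t \near F, `|f t| <= 1) -> exists l : K, f t @[t --> F] --> l.
Variables (n : nat) (A : T -> 'M[K]_n).
Hypothesis unitA : \forall t \near F, A t \in unitmx.

Let reduced (k : nat) (c : 'I_n -> 'I_n) (B : T -> 'M[K]_n) (M : 'M[K]_n) :=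
  [/\ \forall t \near F, exists2 L, supported lower_rel L /\ L \in unitmx & A t = L *m B t,
    forall a j : 'I_n, (a < k)%N -> B t a j @[t --> F] --> M a j,
    forall a : 'I_n, (a < k)%N -> \forall t \near F, B t a (c a) = 1,
    forall a j : 'I_n, (a < k)%N -> (c a < j)%N -> M a j = 0 &
    forall a b : 'I_n, (a < k)%N -> (a < b)%N -> \forall t \near F, B t b (c a) = 0].

(* Gaussian elimination along F: after scaling its largest entry to 1, row k    *)
(* has a nonzero limit, and the pivot is the last nonzero entry of that limit.  *)
Let reduced_step k c B M : (k < n)%N -> reduced k c B M ->
  exists c' B' M', reduced k.+1 c' B' M'.
Proof.
move=> kn [AB Blim Bc Mc B0]; pose k' := Ordinal kn.
have unitB : \forall t \near F, B t \in unitmx.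
  near=> t; have : A t \in unitmx by near: t.
  have [L [_ _]] : exists2 L, supported lower_rel L /\ L \in unitmx & A t = L *m B t.
    by near: t.
  by move=> ->; rewrite unitmx_mul => /andP[].
have [j jP] : exists j, \forall t \near F,
    B t k' j != 0 /\ forall l, `|B t k' l| <= `|B t k' j|.
  apply: ultra_exists; near=> t.
  have [j jP] := @finite_max K _ (fun l => `|B t k' l|) k' (fun=> normr_ge0 _).
  exists j; split=> //; apply/eqP => Bj.
  have : B t \in unitmx by near: t.
  rewrite unitmxE (expand_det_row _ k') big1 ?unitr0 // => l _.
  have := jP l; rewrite Bj normr0 normr_le0 => /eqP->; exact: mul0r.
have /choice[rho rhoP] : forall l, exists r : K, (B t k' l / B t k' j) @[t --> F] --> r.
  move=> l; apply: ultra_cvg; near=> t.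
  have [Bj h] : B t k' j != 0 /\ forall l, `|B t k' l| <= `|B t k' j| by near: t.
  by rewrite normrM normfV ler_pdivrMr ?normr_gt0 // mul1r.
have rhoj : rho j != 0.
  rewrite (_ : rho j = 1) ?oner_eq0 //; apply: (cvg_inj (rhoP j)).
  by apply: cvg_near_cst; apply: filterS jP => t [Bj _]; rewrite divff.
case: (@arg_maxnP _ j (fun l => rho l != 0) (fun l : 'I_n => l : nat) rhoj) => ck rck ckmax.
have Bck : \forall t \near F, B t k' ck != 0.
  by apply: filterS (cvg_neq0 (rhoP ck) rck) => t; rewrite mulf_eq0 negb_or => /andP[].
pose B' t : 'M[K]_n := \matrix_(i, l) if (i < k)%N then B t i l else
  if i == k' then B t k' l / B t k' ck else B t i l - B t i ck / B t k' ck * B t k' l.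
pose c' a := if a == k' then ck else c a.
pose M' : 'M[K]_n := \matrix_(i, l) if i == k' then rho l / rho ck else M i l.
have ltSk (a : 'I_n) : (a < k.+1)%N -> a = k' \/ (a < k)%N /\ (a == k') = false.
  rewrite ltnS leq_eqVlt => /orP[/eqP e|ak]; first by left; exact: val_inj.
  by right; rewrite -(inj_eq val_inj) /= ltn_eqF.
have kk' : (k' < k)%N = false by rewrite ltnn.
exists c', B', M'; split.
- near=> t; have Bt : B t k' ck != 0 by near: t.
  have [L [lL uL] ->] : exists2 L, supported lower_rel L /\ L \in unitmx & A t = L *m B t.
    by near: t.
  (* The inverse of the elimination step: column [k'] stores the old pivot column from row [k]
     on. *)
  pose L' : 'M[K]_n := \matrix_(i, l) if l == k'
    then (if (i < k)%N then 0 else B t i ck) else (i == l)%:R.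
  have lL' : supported lower_rel L'.
    move=> i l; rewrite /lower_rel -ltnNge mxE => il.
    case: eqP => [e|_]; first by move: il; rewrite e /= => ->.
    by rewrite -(inj_eq val_inj) ltn_eqF.
  exists (L *m L'); first split.
  + exact: supported_mul lower_trans lL lL'.
  + rewrite unitmx_mul uL unitmxE det_trig; last first.
      by apply/is_trig_mxP => i l il; rewrite lL' // /lower_rel -ltnNge.
    rewrite unitfE; apply/prodf_neq0 => i _; rewrite mxE eqxx.
    by have [->|_] := eqVneq i k'; rewrite ?kk' ?oner_eq0.
  + rewrite -mulmxA; congr (_ *m _); apply/matrixP=> i l.
    rewrite mxE (bigD1 k') //= !mxE eqxx kk'.
    have [->|ik] := eqVneq i k'.
      rewrite kk' mulrCA divff // mulr1 big1 ?addr0 // => b bk.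
      by rewrite mxE (negbTE bk) eq_sym (negbTE bk) mul0r.
    rewrite (bigD1 i) //= big1 => [|b /andP[bk bi]]; last first.
      by rewrite mxE (negbTE bk) eq_sym (negbTE bi) mul0r.
    rewrite !mxE eqxx (negbTE ik) mul1r addr0; case: ifP => _; first by rewrite mul0r add0r.
    by rewrite mulrA [B t i ck * _]mulrC -mulrA [X in X + _]mulrC; field.
- move=> a l /ltSk[->|[ak ak']]; rewrite mxE ?eqxx ?ak'; under eq_fun do rewrite mxE ?eqxx ?ak' ?kk' ?ak; last exact: Blim.
  have : (B t k' l / B t k' j / (B t k' ck / B t k' j)) @[t --> F] --> rho l / rho ck.
    by apply: cvgM (rhoP l) _; apply: cvgV (rhoP ck).
  apply: cvg_trans; apply: near_eq_cvg; near=> t.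
  have Bt : B t k' ck != 0 by near: t.
  have [Bj _] : B t k' j != 0 /\ forall l, `|B t k' l| <= `|B t k' j| by near: t.
  by field; rewrite Bt.
- move=> a /ltSk[->|[ak ak']]; rewrite /c' ?eqxx ?ak'.
    by apply: filterS Bck => t Bt; rewrite mxE kk' eqxx divff.
  by apply: filterS (Bc _ ak) => t; rewrite mxE ak.
- move=> a l /ltSk[->|[ak ak']]; rewrite /c' ?eqxx ?ak' => h; rewrite mxE ?eqxx ?ak'; last exact: Mc h.
  apply/eqP; rewrite mulf_eq0; apply/orP; left; apply: contraTT h => /ckmax.
  by rewrite -leqNgt.
- move=> a b /ltSk[->|[ak ak']] ab; rewrite /c' ?eqxx ?ak'.
    apply: filterS Bck => t Bt; rewrite mxE ltnNge (ltnW ab) /=.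
    have -> : (b == k') = false by rewrite -(inj_eq val_inj) gtn_eqF.
    by rewrite divfK // subrr.
  have B0b := B0 _ _ ak ab; have B0k := B0 a k' ak ak.
  apply: filterS (filterI B0b B0k) => t [e1 e2]; rewrite mxE e1 e2.
  by rewrite !(mul0r, mulr0) subrr !if_same.
Unshelve. all: by end_near. Qed.

(** The pivot columns form the permutation [v]. Since each row of the limit ends at its pivot, the
    limit lies in the cell of [v] itself and not merely in its chart. *)
Lemma limit_chart : exists (v : 'S_n) (y : T -> 'M[K]_n) (y0 : 'M[K]_n),
  [/\ \forall t \near F, unipotent (y t) /\ exists2 L, supported lower_rel L /\ L \in unitmx &
        A t = L *m (y t *m perm_mx v),
      mx_lim F y y0 & cell_mx v y0].
Proof.
have [c [B [M [AB Blim Bc Mc B0]]]] : exists c B M, reduced n c B M.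
  suff : forall k, (k <= n)%N -> exists c B M, reduced k c B M by apply.
  elim=> [|k IHk] kn; last by have [c [B [M h]]] := IHk (ltnW kn); exact: reduced_step h.
  exists id, A, 0; split=> //; near=> t; exists 1%:M; rewrite ?mul1mx ?unitmx1 //.
  split=> // i j; rewrite /lower_rel -ltnNge mxE -(inj_eq val_inj) => ij.
  by rewrite ltn_eqF.
have inj_c : injective c.
  suff lt (a b : 'I_n) : (a < b)%N -> c a != c b.
    move=> a b cab; apply/val_inj; case: (ltngtP a b) => // /lt; by rewrite cab eqxx.
  move=> ab; apply/eqP => cab.
  have [t [e1 e2]] := filter_ex (filterI (Bc b (ltn_ord _)) (B0 _ _ (ltn_ord a) ab)).
  by move: e1; rewrite -cab e2 => /eqP; rewrite eq_sym oner_eq0.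
pose v := perm inj_c.
have uy : \forall t \near F, unipotent (B t *m perm_mx v^-1).
  have h (i j : 'I_n) : \forall t \near F, (j <= i)%N ->
      (B t *m perm_mx v^-1) i j = (i == j)%:R.
    have [ji|ij] := leqP j i; last by near=> t.
    have e t i' : (B t *m perm_mx v^-1) i' j = B t i' (c j).
      by rewrite -col_permE mxE permE.
    have [->|ij] := eqVneq i j; first by apply: filterS (Bc j (ltn_ord _)) => t h _; rewrite e h.
    apply: filterS (B0 j i (ltn_ord _) _) => [t h _|]; first by rewrite e h.
    by rewrite ltn_neqAle ji andbT eq_sym.
  have : \forall t \near F, forall i j : 'I_n, (j <= i)%N ->
      (B t *m perm_mx v^-1) i j = (i == j)%:R.
    by apply: filter_forall => i; apply: filter_forall => j; exact: h.
  by apply: filterS => t ht i j; exact: ht.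
exists v, (fun t => B t *m perm_mx v^-1), (M *m perm_mx v^-1).
have lim : mx_lim F (fun t => B t *m perm_mx v^-1) (M *m perm_mx v^-1).
  by apply: mx_limM => [i j|]; [exact: Blim | exact: mx_lim_cst].
split=> //.
  near=> t; split; first by near: t.
  by rewrite -mulmxA -perm_mxM mulVg perm_mx1 mulmx1; near: t.
move=> i j nij; have [ji|ij] := leqP j i.
  apply: cvg_inj (lim i j) _; apply: cvg_near_cst.
  by apply: filterS uy => t /(_ i j ji).
rewrite -col_permE mxE permE -/(c _) Mc ?(ltn_ord i) //.
  by rewrite -(inj_eq val_inj) ltn_eqF.
have := perm_neq v (a := i) (b := j); rewrite -(inj_eq val_inj) ltn_eqF // => /(_ isT).
by move: nij; rewrite /inversion ij /= !permE; lia.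
Unshelve. all: by end_near. Qed.

End LimitChart.

(** * Imposing one more osculating condition *)

Section CellScaling.
Variables (K : numFieldType) (n : nat).
Implicit Types (v w : 'S_n) (A H X u x y L Z : 'M[K]_n).

(** Conjugation by the torus element with entries [s ^+ v c]. Entries at inversions of [v] gain a
    positive power of [s], so for small [s] the cell contracts to its torus fixed point, whereas a
    transvection with [v a < v b] is expanded. *)
Definition cell_scale v (s : K) X : 'M[K]_n :=
  \matrix_(c, d) (s ^+ v c * X c d * s ^- v d).

Lemma rescale_cell_scale v s X :
  rescale s (fun c => s ^+ v c) (X *m perm_mx v) = cell_scale v s X *m perm_mx v.
Proof.
by apply/matrixP=> c d; rewrite -[d](permKV v) mul_permE [LHS]mxE [RHS]mxE mul_permE.
Qed.

Lemma cell_scale_transvection v s t (a b : 'I_n) X : s != 0 ->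
  cell_scale v s (transvection a b t *m X) =
  transvection a b (t * s ^+ v a / s ^+ v b) *m cell_scale v s X.
Proof.
move=> s0; apply/matrixP=> c d; rewrite [LHS]mxE !transvection_mulE ![cell_scale _ _ _ _ _]mxE.
have [->|_] := eqVneq c a; last by rewrite !mul0r !addr0.
have sb : s ^+ v b != 0 by rewrite expf_neq0.
have sd : s ^+ v d != 0 by rewrite expf_neq0.
by rewrite !mul1r; field; rewrite sb sd.
Qed.

Lemma cell_scale_add v s X Y : cell_scale v s (X + Y) = cell_scale v s X + cell_scale v s Y.
Proof. by apply/matrixP=> c d; rewrite !mxE; ring. Qed.

Lemma cell_scaleZ v s k X : cell_scale v s (k *: X) = k *: cell_scale v s X.
Proof. by apply/matrixP=> c d; rewrite !mxE; ring. Qed.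

Lemma cell_scale_delta v s (a b : 'I_n) X : s != 0 ->
  cell_scale v s (delta_mx a b *m X) =
  (s ^+ v a / s ^+ v b) *: (delta_mx a b *m cell_scale v s X).
Proof.
move=> s0; apply/matrixP=> c d; rewrite [LHS]mxE delta_mull [RHS]mxE delta_mull ![cell_scale _ _ _ _ _]mxE.
have [->|_] := eqVneq c a; last by rewrite !(mul0r, mulr0).
have sb : s ^+ v b != 0 by rewrite expf_neq0.
have sd : s ^+ v d != 0 by rewrite expf_neq0.
by rewrite !mul1r; field; rewrite sb sd.
Qed.

End CellScaling.

(** * Tangent vectors of a cell in the coordinates near a cell it covers *)

Section TangentTransport.
Variables (K : numFieldType) (n : nat).
Variables (v w : 'S_n) (a b : 'I_n).
Hypotheses (ab : (a < b)%N) (vab : (v a < v b)%N).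
Hypothesis cov : forall c : 'I_n, (a < c < b)%N -> ~~ (v a < v c < v b)%N.

Lemma cell_perm_supported (u : 'M[K]_n) : cell_mx v u ->
  supported (fun c d => (v d <= v c)%N) u.
Proof.
move=> cu c d; rewrite -ltnNge => h; rewrite cu /inversion; last by lia.
by case: eqP => // e; move: h; rewrite e ltnn.
Qed.

(** Translated to the identity by [x] and carried over by both permutations and [u], the tangent
    vector becomes an [X] as in [transvection_lie]; its lower triangular part does not affect the
    conditions. *)
Lemma tangent_chart (x u h L : 'M[K]_n) t : cell_mx w x -> cell_mx v u ->
  supported lower_rel L -> L \in unitmx ->
  x *m perm_mx w = L *m (transvection a b t *m u *m perm_mx v) ->
  supported (inversion w) h -> h != 0 ->
  exists (k : K) (du : 'M[K]_n), [/\ supported (inversion v) du, (k != 0) || (du != 0) &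
    forall del s, \det (incidence del s (x *m perm_mx w)) = 0 ->
    det_slope (incidence del s (x *m perm_mx w)) (incidence del s (x *m perm_mx w))
      (top K n del *m (h *m perm_mx w)) = 0 ->
    let A := transvection a b t *m u *m perm_mx v in
    det_slope (incidence del s A) (incidence del s A)
      (top K n del *m ((k *: (delta_mx a b *m u) + transvection a b t *m du) *m perm_mx v)) = 0].
Proof.
move=> cx cu lL uL e sh h0; set A := _ *m _ *m perm_mx v in e *.
have ux := unipotent_unit (cell_unipotent cx).
have uu := unipotent_unit (cell_unipotent cu).
have lVL : supported lower_rel (invmx L).
  exact: supported_inv (fun c => leqnn c) lower_trans uL lL.
have sx : supported (weak_inversion w) (invmx x).
  exact: supported_inv (weak_inversion_refl w) (@weak_inversion_trans _ w) ux (cell_supported cx).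
have vtr : transitive (fun c d => (v d <= v c)%N).
  by move=> c d f h1 h2; exact: leq_trans h2 h1.
pose Y := invmx x *m h.
have sY : supported (inversion w) Y.
  apply: supported_mulP sx sh => i k j; rewrite /weak_inversion /inversion.
  by case/orP => [/eqP->//|]; lia.
pose X0 := perm_mx v *m (perm_mx w^-1 *m Y *m perm_mx w) *m perm_mx v^-1.
(* Conjugation by [w] turns its inversions into pairs of decreasing values, which [v] reads as
   positions. *)
have sX0 : supported (fun c d => (v d <= v c)%N) X0.
  move=> c d; rewrite -ltnNge => vcd.
  have -> : X0 c d = Y ((w^-1)%g (v c)) ((w^-1)%g (v d)).
    rewrite /X0 -col_permE mxE -row_permE mxE -[v d](permKV w) mul_permE permK.
    by rewrite -row_permE mxE.
  by apply: sY; rewrite /inversion !permKV; lia.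
pose X := u *m X0 *m invmx u.
have sX (c d : 'I_n) : (v c < v d)%N -> X c d = 0.
  move=> vcd; suff : supported (fun c d => (v d <= v c)%N) X by apply; rewrite -ltnNge.
  apply: (supported_mul vtr (supported_mul vtr (cell_perm_supported cu) sX0)).
  by apply: (supported_inv _ vtr uu (cell_perm_supported cu)) => i; exact: leqnn.
have [X' [k [Z [sX' lZ eX]]]] := transvection_lie ab vab cov t sX.
have eA : A = invmx L *m (x *m perm_mx w) by rewrite e mulKmx.
have dir : invmx L *m (h *m perm_mx w) =
    (k *: (delta_mx a b *m u) + transvection a b t *m (X' *m u)) *m perm_mx v + Z *m A.
  have -> : invmx L *m (h *m perm_mx w) = transvection a b t *m X *m u *m perm_mx v.
    have -> : transvection a b t *m X *m u *m perm_mx v = A *m (perm_mx w^-1 *m Y *m perm_mx w).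
      rewrite /X /X0 /A -!mulmxA (mulKmx uu).
      by rewrite -(perm_mxM _ (v^-1)%g v) mulVg perm_mx1 mulmx1.
    rewrite eA /Y !mulmxA -(mulmxA _ (perm_mx w) (perm_mx w^-1)) -perm_mxM mulgV perm_mx1 mulmx1.
    by rewrite mulmxK.
  by rewrite eX !mulmxDl -!scalemxAl /A !mulmxA; congr (_ + _); rewrite addrC.
exists k, (X' *m u); split.
- apply: supported_mulP sX' (cell_supported cu) => i l j; rewrite /weak_inversion /inversion.
  by move=> h1 /orP[/eqP<-//|]; lia.
(* If both components vanished, [h *m invmx x] would be lower triangular, but it is supported on
   inversions, which are strictly above the diagonal. *)
- apply: contraR h0; rewrite negb_or !negbK => /andP[/eqP k0 /eqP du0].
  move: dir; rewrite k0 du0 scale0r mulmx0 addr0 mul0mx add0r eA => /(congr1 (mulmx L)).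
  rewrite mulKVmx // !mulmxA => /(congr1 (mulmxr (perm_mx w^-1))); rewrite /= -!mulmxA.
  rewrite -perm_mxM mulgV perm_mx1 !mulmx1 !mulmxA => eh.
  have Z0 : L *m Z *m invmx L = 0.
    apply/matrixP=> c d; rewrite [RHS]mxE; have [dc|cd] := leqP d c; last first.
      rewrite (supported_mul lower_trans (supported_mul lower_trans lL lZ) lVL) //.
      by rewrite /lower_rel -ltnNge.
    have -> : L *m Z *m invmx L = h *m invmx x by rewrite eh mulmxK.
    apply: (supported_mulP _ sh sx (P' := inversion w)) => [i l j|].
      by move=> h1 /orP[/eqP<-//|]; move: h1; rewrite /inversion; lia.
    by rewrite /inversion; lia.
  by rewrite eh Z0 mul0mx.
move=> del s d0 sl /=.
have low (M : 'M[K]_n) : supported lower_rel M ->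
    forall c d : 'I_n, (c < del)%N -> (del <= d)%N -> M c d = 0.
  by move=> lM c d cd dd; apply: lM; rewrite /lower_rel; lia.
have := incidence_slope_mull (low _ lVL) sl; rewrite -eA dir mulmxDr det_slope_add.
rewrite (incidence_slope_lower (low _ lZ)) ?addr0 //.
by rewrite eA; apply: incidence_mull_eq0 d0; exact: low.
Qed.

End TangentTransport.

Section Conditions.
Variables (K : numClosedFieldType) (n : nat).
Implicit Types (sigma : seq (nat * K)) (A H : 'M[K]_n).

Definition meets sigma A :=
  forall c, c \in sigma -> \det (incidence c.1 c.2 A) = 0.

Definition tangent sigma A H := forall c, c \in sigma ->
  det_slope (incidence c.1 c.2 A) (incidence c.1 c.2 A) (top K n c.1 *m H) = 0.

Definition conj_mx A := map_mx Num.conj_op A.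

(** All of ['S_n] is allowed because the cells met in a limit need not have their descents in
    [d]. *)
Definition good sigma := forall (w : 'S_n) x, cell_mx w x ->
  meets sigma (x *m perm_mx w) ->
  (size sigma <= perm_length w)%N /\
  (size sigma = perm_length w -> conj_mx x = x /\
     forall h, supported (inversion w) h ->
       tangent sigma (x *m perm_mx w) (h *m perm_mx w) -> h = 0).

End Conditions.

Section CellScaleLimits.
Variables (K : numClosedFieldType) (T : Type) (F : set_system T).
Context {FF : ProperFilter F}.
Variables (n : nat) (v : 'S_n) (s : T -> K).
Hypotheses (s_lim : s t @[t --> F] --> (0 : K)) (s_neq0 : \forall t \near F, s t != 0).

Let cell_scale_entry (u : T -> 'M[K]_n) (M : 'M[K]_n) c d : mx_lim F u M ->
  (v d < v c)%N -> cell_scale v (s t) (u t) c d @[t --> F] --> (0 : K).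
Proof.
move=> uM vdc; have : (s t ^+ (v c - v d) * u t c d) @[t --> F] --> 0 * M c d.
  apply: cvgM (uM c d); have := cvg_expn (m := (v c - v d)%N) s_lim.
  by rewrite expr0n subn_eq0 leqNgt vdc mulr0n; exact.
rewrite mul0r; apply: cvg_trans; apply: near_eq_cvg; near=> t.
have st : s t != 0 by near: t.
rewrite mxE -[in RHS](subnK (ltnW vdc)) exprD; have sd : s t ^+ v d != 0 by rewrite expf_neq0.
by field.
Unshelve. all: by end_near. Qed.

Lemma cell_scale_lim0 (u : T -> 'M[K]_n) (M : 'M[K]_n) : mx_lim F u M ->
  (\forall t \near F, supported (inversion v) (u t)) ->
  mx_lim F (fun t => cell_scale v (s t) (u t)) 0.
Proof.
move=> uM su c d; rewrite mxE; have [vdc|vcd] := ltnP (v d) (v c).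
  exact: cell_scale_entry uM vdc.
apply: cvg_near_cst; apply: filterS su => t su.
by rewrite mxE su ?mulr0 ?mul0r // /inversion; lia.
Qed.

Lemma cell_scale_lim (u : T -> 'M[K]_n) (M : 'M[K]_n) : mx_lim F u M ->
  (\forall t \near F, cell_mx v (u t)) ->
  mx_lim F (fun t => cell_scale v (s t) (u t)) 1%:M.
Proof.
move=> uM su c d; rewrite [1%:M c d]mxE; have [vdc|vcd] := ltnP (v d) (v c).
  have -> : (c == d) = false by apply/negbTE/eqP => e; rewrite e ltnn in vdc.
  exact: cell_scale_entry uM vdc.
apply: cvg_near_cst; near=> t; have su' : cell_mx v (u t) by near: t.
have st : s t != 0 by near: t.
rewrite mxE su'; last by rewrite /inversion; lia.
have [->|_] := eqVneq c d; last by rewrite mulr0 mul0r.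
by rewrite mulr1 divff // expf_neq0.
Unshelve. all: by end_near. Qed.

End CellScaleLimits.

(** * Increments near a cell of codimension one *)

Section Degeneration.
Variables (K : numClosedFieldType) (T : Type) (F : set_system T).
Context {UF : UltraFilter F}.
Hypothesis ultra_cvg : forall f : T -> K,
  (\forall t \near F, `|f t| <= 1) -> exists l : K, f t @[t --> F] --> l.
Variables (n : nat) (v : 'S_n) (a b : 'I_n) (del : nat) (s : T -> K).
Hypotheses (s_lim : s t @[t --> F] --> (0 : K)) (s_neq0 : \forall t \near F, s t != 0).
Hypotheses (ab : (a < b)%N) (vab : (v a < v b)%N) (delab : (a < del <= b)%N).
Let w := (tperm a b * v)%g.
Let e := (v b - v a)%N.
Let tv := @transvection K n a b.

Lemma scale_lim : (s t ^+ e) @[t --> F] --> (0 : K).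
Proof.
have h : (s t ^+ e) @[t --> F] --> (0 ^+ e : K) by exact: cvg_expn.
by move: h; rewrite expr0n /e subn_eq0 leqNgt vab mulr0n.
Qed.

Lemma transvection_lim (f : T -> K) (l : K) : f t @[t --> F] --> l ->
  mx_lim F (fun t => tv (f t)) (tv l).
Proof.
move=> fl; rewrite /tv /transvection; apply: mx_limD; first exact: mx_lim_cst.
by apply: mx_limZ => //; exact: mx_lim_cst.
Qed.

Lemma incidence_lim (de : nat) (z : K) (A : T -> 'M[K]_n) M : mx_lim F A M ->
  mx_lim F (fun t => incidence de z (A t)) (incidence de z M).
Proof.
move=> AM; rewrite /incidence; apply: mx_limD; last exact: mx_lim_cst.
by apply: mx_limM => //; exact: mx_lim_cst.
Qed.

(** The root of the affine function [t |-> \det (incidence del 1 (transvection a b t *m perm_mx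
    v))]. *)
Let tau_lim : K :=
  - \det (incidence del 1 (perm_mx v)) / \det (incidence del 1 (perm_mx w)).

(** The condition is affine in [tau]. The scaled cell coordinates contract to the identity, so its
    coefficients converge to those at the fixed point, where the coefficient of [tau] is nonzero. *)
Lemma transvection_parameter_lim (tau : T -> K) (u : T -> 'M[K]_n) M : mx_lim F u M ->
  (\forall t \near F, cell_mx v (u t)) ->
  (\forall t \near F,
     \det (incidence del 1 (tv (tau t) *m cell_scale v (s t) (u t) *m perm_mx v)) = 0) ->
  tau t @[t --> F] --> tau_lim.
Proof.
move=> uM cu d0.
pose X t := cell_scale v (s t) (u t) *m perm_mx v.
have XV : mx_lim F X (perm_mx v).
  rewrite -[Y in mx_lim _ _ Y]mul1mx; apply: mx_limM; last exact: mx_lim_cst.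
  exact (cell_scale_lim s_lim s_neq0 uM cu).
have CW : mx_lim F (fun t => copy_row a b (X t)) (copy_row a b (perm_mx v)).
  by move=> i j; rewrite mxE; under eq_fun do rewrite mxE; exact: XV.
have cW : \det (incidence del 1 (copy_row a b (X t))) @[t --> F] -->
    \det (incidence del 1 (perm_mx w)).
  by rewrite -(incidence_copy_row v ab delab); exact (cvg_det (incidence_lim CW)).
have w0 := incidence_perm_neq0 K del w.
have XV1 : \det (incidence del 1 (X t)) @[t --> F] --> \det (incidence del 1 (perm_mx v)).
  by exact (cvg_det (incidence_lim XV)).
have : (- \det (incidence del 1 (X t)) / \det (incidence del 1 (copy_row a b (X t))))
    @[t --> F] --> tau_lim.
  by apply: cvgM; [exact: cvgN | exact: cvgV].
apply: cvg_trans; apply: near_eq_cvg; near=> t.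
have : \det (incidence del 1 (copy_row a b (X t))) != 0.
  by near: t; exact: cvg_neq0 cW w0.
have : \det (incidence del 1 (tv (tau t) *m cell_scale v (s t) (u t) *m perm_mx v)) = 0.
  by near: t.
rewrite -mulmxA incidence_transvection // -/(X t) => /eqP; rewrite addr_eq0 => /eqP-> c0.
by rewrite /= opprK mulfK.
Unshelve. all: by end_near. Qed.

Variables (sigma : seq (nat * K)) (M : 'M[K]_n).
Hypothesis nondeg : forall h, supported (inversion v) h ->
  tangent sigma (M *m perm_mx v) (h *m perm_mx v) -> h = 0.

Variables (u1 u2 : T -> 'M[K]_n) (tau1 tau2 : T -> K).
Hypotheses (u1M : mx_lim F u1 M) (u2M : mx_lim F u2 M).
Hypotheses (cu1 : \forall t \near F, cell_mx v (u1 t))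
           (cu2 : \forall t \near F, cell_mx v (u2 t)).
Hypotheses (tau1l : tau1 t @[t --> F] --> tau_lim) (tau2l : tau2 t @[t --> F] --> tau_lim).
Variables (du : T -> 'M[K]_n) (dt : T -> K).
Hypothesis sdu : \forall t \near F, supported (inversion v) (du t).

(** Flags and directions in two scales: [chart] and [dir] in the original coordinates, with
    parameter [tau * s ^+ e], and [schart] and [sdir] after the torus element, with parameter [tau].
    A direction formed with [u1] and [tau2] is a difference of two points by [transvectionB], or a
    tangent vector when they coincide. *)
Let chart (u : T -> 'M[K]_n) (tau : T -> K) t := tv (tau t * s t ^+ e) *m u t *m perm_mx v.
Let dir (u : T -> 'M[K]_n) (tau : T -> K) t :=
  ((dt t * s t ^+ e) *: (delta_mx a b *m u t) + tv (tau t * s t ^+ e) *m du t) *m perm_mx v.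
Let schart (u : T -> 'M[K]_n) (tau : T -> K) t :=
  tv (tau t) *m cell_scale v (s t) (u t) *m perm_mx v.
Let sdir (u : T -> 'M[K]_n) (tau : T -> K) t :=
  (dt t *: (delta_mx a b *m cell_scale v (s t) (u t)) +
   tv (tau t) *m cell_scale v (s t) (du t)) *m perm_mx v.

Hypothesis slopes : forall c, c \in sigma -> \forall t \near F,
  det_slope (incidence c.1 c.2 (chart u1 tau1 t)) (incidence c.1 c.2 (chart u2 tau2 t))
    (top K n c.1 *m dir u1 tau2 t) = 0.
Hypothesis slope_del : \forall t \near F,
  det_slope (incidence del 1 (schart u1 tau1 t)) (incidence del 1 (schart u2 tau2 t))
    (top K n del *m sdir u1 tau2 t) = 0.

(* After normalisation (dt, du) converges to a nonzero vector (k, h); in the   *)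
(* limit the last condition gives k = 0 and the others give h = 0.             *)
Lemma increments_eq0 : \forall t \near F, dt t = 0 /\ du t = 0.
Proof.
have [//|nz] := in_ultra_setVsetC [set t | dt t = 0 /\ du t = 0] UF; exfalso.
(* The coordinates of the increment, [None] standing for [dt]; the largest one is used for
   normalisation. *)
pose N (o : option ('I_n * 'I_n)) t := if o is Some ij then du t ij.1 ij.2 else dt t.
have [o oP] : exists o, \forall t \near F, N o t != 0 /\ forall o', `|N o' t| <= `|N o t|.
  apply: ultra_exists; apply: filterS nz => t nz.
  have [o oP] := @finite_max K _ (fun o => `|N o t|) None (fun=> normr_ge0 _).
  exists o; split=> //; apply/eqP => No; apply: nz.
  have N0 o' : N o' t = 0 by apply/eqP; have := oP o'; rewrite No normr0 normr_le0.
  by split; [exact: (N0 None) | apply/matrixP=> i j; rewrite mxE; exact: (N0 (Some (i, j)))].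
have [g gP] : exists g : option ('I_n * 'I_n) -> K,
    forall o', (N o' t / N o t) @[t --> F] --> g o'.
  have /choice[g gP] : forall o', exists r : K, (N o' t / N o t) @[t --> F] --> r.
    move=> o'; apply: ultra_cvg; apply: filterS oP => t [No le].
    by rewrite normrM normfV ler_pdivrMr ?normr_gt0 // mul1r.
  by exists g.
have go : g o = 1.
  by apply: (cvg_inj (gP o)); apply: cvg_near_cst; apply: filterS oP => t [No _]; rewrite divff.
pose k := g None; pose h : 'M[K]_n := \matrix_(i, j) g (Some (i, j)).
have kl : ((N o t)^-1 * dt t) @[t --> F] --> k.
  by under eq_fun do rewrite mulrC; exact: gP None.
have hl : mx_lim F (fun t => (N o t)^-1 *: du t) h.
  by move=> i j; rewrite mxE; under eq_fun do rewrite mxE mulrC; exact: (gP (Some (i, j))).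
have sh : supported (inversion v) h.
  move=> i j nij; apply: cvg_eq0 (hl i j) _; apply: filterS sdu => t sd.
  by rewrite mxE sd // mulr0.
have taus tau : tau t @[t --> F] --> tau_lim -> (tau t * s t ^+ e) @[t --> F] --> (0 : K).
  by move=> tl; rewrite -[0](mulr0 tau_lim); exact: cvgM tl scale_lim.
have chartl u tau : mx_lim F u M -> tau t @[t --> F] --> tau_lim ->
    mx_lim F (chart u tau) (M *m perm_mx v).
  move=> uM tl; apply: mx_limM; last exact: mx_lim_cst.
  rewrite -[M]mul1mx -(transvection0 K a b); apply: mx_limM => //.
  by apply: transvection_lim; exact: taus.
(* In the original scale the parameter terms carry a factor [s ^+ e] and disappear in the limit. *)
have h0 : h = 0.
  apply: nondeg => // c cs; apply: cvg_eq0 (_ : (det_slope (incidence c.1 c.2 (chart u1 tau1 t))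
      (incidence c.1 c.2 (chart u2 tau2 t))
      (top K n c.1 *m ((N o t)^-1 *: dir u1 tau2 t))) @[t --> F] --> _) _; last first.
    by apply: filterS (slopes cs) => t sl; rewrite -scalemxAr det_slopeZ sl mulr0.
  apply: cvg_det_slope; [by apply: incidence_lim; exact: chartl|by apply: incidence_lim; exact: chartl|].
  apply: mx_limM; first exact: mx_lim_cst.
  under [X in mx_lim _ X]eq_fun do rewrite scalemxAl scalerDr.
  apply: mx_limM; last exact: mx_lim_cst.
  rewrite -[h]add0r; apply: mx_limD.
    rewrite -(scale0r (delta_mx a b *m M)).
    under [X in mx_lim _ X]eq_fun do rewrite scalerA mulrA.
    apply: mx_limZ; last by apply: mx_limM => //; exact: mx_lim_cst.
    by rewrite -[0](mulr0 k); exact: cvgM kl scale_lim.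
  rewrite -[h]mul1mx -(transvection0 K a b).
  under [X in mx_lim _ X]eq_fun do rewrite scalemxAr.
  by apply: mx_limM => //; apply: transvection_lim; exact: taus.
(* After the torus element the terms in [du] are contracted to 0, and [k] remains with a nonzero
   coefficient. *)
have k0 : k = 0.
  have scl u : mx_lim F u M -> (\forall t \near F, cell_mx v (u t)) ->
      mx_lim F (fun t => cell_scale v (s t) (u t)) 1%:M by exact: cell_scale_lim.
  have schartl u tau : mx_lim F u M -> (\forall t \near F, cell_mx v (u t)) ->
      tau t @[t --> F] --> tau_lim -> mx_lim F (schart u tau) (tv tau_lim *m perm_mx v).
    move=> uM cu tl; apply: mx_limM; last exact: mx_lim_cst.
    rewrite -[tv _]mulmx1; apply: mx_limM; last exact: scl uM cu.
    exact: transvection_lim.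
  have w0 := incidence_perm_neq0 K del w.
  suff : k * \det (incidence del 1 (perm_mx w)) = 0.
    by move/eqP; rewrite mulf_eq0 (negbTE w0) orbF => /eqP.
  rewrite -(incidence_slope_transvection v ab delab 1 tau_lim k).
  apply: cvg_eq0 (_ : (det_slope (incidence del 1 (schart u1 tau1 t))
      (incidence del 1 (schart u2 tau2 t))
      (top K n del *m ((N o t)^-1 *: sdir u1 tau2 t))) @[t --> F] --> _) _; last first.
    by apply: filterS slope_del => t sl; rewrite -scalemxAr det_slopeZ sl mulr0.
  apply: cvg_det_slope; [by apply: incidence_lim; exact: schartl|by apply: incidence_lim; exact: schartl|].
  apply: mx_limM; first exact: mx_lim_cst.
  under [X in mx_lim _ X]eq_fun do rewrite scalemxAl scalerDr.
  apply: mx_limM; last exact: mx_lim_cst.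
  rewrite -[k *: _]addr0; apply: mx_limD.
    under [X in mx_lim _ X]eq_fun do rewrite scalerA.
    apply: mx_limZ => //; rewrite -[Y in mx_lim _ _ Y]mulmx1.
    apply: mx_limM; [exact: mx_lim_cst | exact: scl u1M cu1].
  rewrite -[0](mulmx0 _ (tv tau_lim)).
  under [X in mx_lim _ X]eq_fun do rewrite scalemxAr -cell_scaleZ.
  apply: mx_limM; first exact: transvection_lim.
  apply: (cell_scale_lim0 s_lim s_neq0 hl).
  by apply: filterS sdu => t sd i j nij; rewrite mxE sd // mulr0.
have g0 o' : g o' = 0.
  by case: o' => [[i j]|]; [move/matrixP: h0 => /(_ i j); rewrite !mxE | exact: k0].
by move: go; rewrite g0 => /esym/eqP; rewrite oner_eq0.
Qed.

End Degeneration.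

Lemma transvectionB (K : fieldType) n (a b : 'I_n) (p q : K) (u1 u2 : 'M[K]_n) :
  transvection a b p *m u1 - transvection a b q *m u2 =
  (p - q) *: (delta_mx a b *m u1) + transvection a b q *m (u1 - u2).
Proof.
rewrite mulmxBr addrA; congr (_ - _); rewrite /transvection !mulmxDl scalemxAl scalerBl.
by rewrite mulmxBl -!scalemxAl; move: (_ *: _) (_ *: _) => X Y; apply/matrixP=> i j; rewrite !mxE; ring.
Qed.

Lemma incidenceB (K : numFieldType) n del (s : K) (A B : 'M[K]_n) :
  incidence del s A - incidence del s B = top K n del *m (A - B).
Proof. by rewrite /incidence opprD addrACA subrr addr0 mulmxBr. Qed.

Lemma incidence_slope_cell_scale (K : numFieldType) n del (v : 'S_n) (a b : 'I_n)
    (s t k : K) (U D A A' : 'M[K]_n) : s != 0 ->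
  A = transvection a b t *m U *m perm_mx v ->
  A' = transvection a b (t * s ^+ v a / s ^+ v b) *m cell_scale v s U *m perm_mx v ->
  det_slope (incidence del s A) (incidence del s A)
    (top K n del *m ((k *: (delta_mx a b *m U) + transvection a b t *m D) *m perm_mx v)) = 0 ->
  det_slope (incidence del 1 A') (incidence del 1 A')
    (top K n del *m (((k * s ^+ v a / s ^+ v b) *: (delta_mx a b *m cell_scale v s U) +
      transvection a b (t * s ^+ v a / s ^+ v b) *m cell_scale v s D) *m perm_mx v)) = 0.
Proof.
move=> s0 AE AE' /(incidence_slope_rescale (fun c => s ^+ v c) s0).
rewrite AE AE' !rescale_cell_scale cell_scale_transvection // cell_scale_add cell_scaleZ.
by rewrite cell_scale_delta // cell_scale_transvection // scalerA !mulrA.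
Qed.

(** * Complex conjugation of cells and conditions *)

Section Conjugation.
Variables (K : numClosedFieldType) (n : nat).
Implicit Types (v w : 'S_n) (A x y u L : 'M[K]_n) (s t : K).

Lemma conj_mxM A x : conj_mx (A *m x) = conj_mx A *m conj_mx x.
Proof. exact: map_mxM. Qed.

Lemma conj_perm_mx v : conj_mx (perm_mx v : 'M[K]_n) = perm_mx v.
Proof. exact: map_perm_mx. Qed.

Lemma conj_supported P A : supported P A -> supported P (conj_mx A).
Proof. by move=> sA i j nij; rewrite mxE sA // conjC0. Qed.

Lemma conj_unipotent u : unipotent u -> unipotent (conj_mx u).
Proof. by move=> uu c d dc; rewrite mxE uu // conjC_nat. Qed.

Lemma conj_cell v u : cell_mx v u -> cell_mx v (conj_mx u).
Proof. by move=> cu c d ncd; rewrite mxE cu // conjC_nat. Qed.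

Lemma conj_transvection (a b : 'I_n) t :
  conj_mx (transvection a b t) = transvection a b t^*.
Proof.
by apply/matrixP=> c d; rewrite !mxE rmorphD rmorphM /= !rmorph_nat.
Qed.

Lemma conj_incidence del s A : s^* = s ->
  conj_mx (incidence del s A) = incidence del s (conj_mx A).
Proof.
move=> rs; apply/matrixP=> i j; rewrite mxE !incidenceE !mxE.
by case: ltnP => // _; rewrite rmorphM rmorphXn /= rs rmorph_nat.
Qed.

Lemma det_conj_incidence del s A : s^* = s ->
  \det (incidence del s A) = 0 -> \det (incidence del s (conj_mx A)) = 0.
Proof. by move=> rs e; rewrite -conj_incidence // det_map_mx e rmorph0. Qed.

Lemma conj_cell_scale v s A : s^* = s ->
  conj_mx (cell_scale v s A) = cell_scale v s (conj_mx A).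
Proof.
by move=> rs; apply/matrixP=> i j; rewrite !mxE !rmorphM fmorphV !rmorphXn /= rs.
Qed.

(** [x] and its conjugate are unipotent coordinates, in one chart, of the same real flag, hence
    equal. *)
Lemma real_of_chart v w x y L : unipotent x -> supported lower_rel L -> L \in unitmx ->
  x *m perm_mx w = L *m (y *m perm_mx v) -> conj_mx y = y -> conj_mx x = x.
Proof.
move=> ux lL uL e ry.
have e' : conj_mx x *m perm_mx w = (conj_mx L *m invmx L) *m x *m perm_mx w.
  rewrite -[perm_mx w in LHS]conj_perm_mx -conj_mxM e !conj_mxM ry conj_perm_mx.
  by rewrite -!mulmxA e mulKmx.
have {}e' : conj_mx x = (conj_mx L *m invmx L) *m x.
  apply: (can_inj (mulmxK (unitmx_perm _ w))); exact: e'.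
suff lLL : supported lower_rel (conj_mx L *m invmx L).
  by rewrite e' (lower_unipotent_eq lLL (conj_unipotent ux) ux e') mul1mx.
apply: supported_mul lower_trans (conj_supported lL) _.
exact: supported_inv (fun c => leqnn c) lower_trans uL lL.
Qed.

End Conjugation.

(** * Induction on the number of conditions *)

Section Core.
Variables (K : numClosedFieldType) (n : nat).
Hypothesis ultra_cvg : forall (F : set_system K), UltraFilter F -> forall f : K -> K,
  (\forall t \near F, `|f t| <= 1) -> exists l : K, f t @[t --> F] --> l.

Lemma good_nil : @good K n [::].
Proof.
move=> w x cx _; split=> // /esym l0.
have ninv c d : ~~ inversion w c d.
  by apply/negP=> h; have := card0_eq l0 (c, d); rewrite !inE /= => /negP[].
split; first by apply/matrixP=> c d; rewrite mxE cx // conjC_nat.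
by move=> h sh _; apply/matrixP=> c d; rewrite sh // mxE.
Qed.

(** The torus contracts a convergent family inside one cell to the fixed point and moves the
    condition from [s] to 1, where the fixed point violates it. This excludes a limit in the same
    cell as well as a condition that does not see the transvection. *)
Lemma no_cell_limit (F : set_system K) (FF : ProperFilter F) (s : K -> K) (v : 'S_n)
    (u : K -> 'M[K]_n) M del :
  s t @[t --> F] --> (0 : K) -> (\forall t \near F, s t != 0) -> mx_lim F u M ->
  (\forall t \near F, cell_mx v (u t)) ->
  (\forall t \near F, \det (incidence del (s t) (u t *m perm_mx v)) = 0) -> False.
Proof.
move=> sl s0 uM cu d0; have /eqP := incidence_perm_neq0 K del v; apply.
have lim : mx_lim F (fun t => incidence del 1 (cell_scale v (s t) (u t) *m perm_mx v))
    (incidence del 1 (perm_mx v)).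
  apply: mx_limD; last exact: mx_lim_cst.
  apply: mx_limM; first exact: mx_lim_cst.
  rewrite -[Y in mx_lim _ _ Y]mul1mx; apply: mx_limM; last exact: mx_lim_cst.
  exact (cell_scale_lim sl s0 uM cu).
apply: cvg_eq0 (cvg_det lim) _; near=> t.
rewrite -rescale_cell_scale; apply: incidence_rescale_eq0; first by near: t.
by near: t.
Unshelve. all: by end_near. Qed.

Lemma good_step del (sigma : seq (nat * K)) : (forall c, c \in sigma -> c.2^* = c.2) ->
  @good K n sigma -> exists s : K, 0 < s /\ @good K n ((del, s) :: sigma).
Proof.
move=> rsigma gs; apply: contrapT => /forallNP nogood.
pose bad s (wx : 'S_n * 'M[K]_n) := [/\ cell_mx wx.1 wx.2,
  meets ((del, s) :: sigma) (wx.2 *m perm_mx wx.1) &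
  ~ ((size sigma < perm_length wx.1)%N /\
     ((size sigma).+1 = perm_length wx.1 -> conj_mx wx.2 = wx.2 /\
       forall h, supported (inversion wx.1) h ->
         tangent ((del, s) :: sigma) (wx.2 *m perm_mx wx.1) (h *m perm_mx wx.1) -> h = 0))].
have /choice[wx wxP] : forall s, exists wx, 0 < s -> bad s wx.
  move=> s; have [s0|ns0] := pselect (0 < s); last by exists (1%g, 0).
  apply: contrapT => nob; apply: (nogood s); split=> // w x cx mx.
  by apply: contrapT => nb; apply: nob; exists (w, x) => _; split.
(* Along the right neighbourhoods of 0 in [K] the parameter is positive, hence real. *)
have [F [UF FG]] := ultraFilterLemma (at_right_proper_filter (0 : K)).
have PF : ProperFilter F by exact: ultra_proper.
have spos : \forall s \near F, 0 < s by apply: FG; exact: nbhs_right_gt.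
have s_lim : s @[s --> F] --> (0 : K).
  move=> U U0; apply: FG; exact: cvg_at_right_filter (fun A => id) U U0.
have s0 : \forall s \near F, s != 0 by apply: filterS spos => s; exact: lt0r_neq0.
have [w wE] : exists w, \forall s \near F, (wx s).1 = w.
  by apply: ultra_exists; near=> s; exists (wx s).1.
pose x s := (wx s).2.
have badF : \forall s \near F, bad s (w, x s).
  near=> s; have <- : (wx s).1 = w by near: s.
  by rewrite /x -surjective_pairing; apply: wxP; near: s.
have cx : \forall s \near F, cell_mx w (x s) by apply: filterS badF => s [].
have mx : \forall s \near F, meets ((del, s) :: sigma) (x s *m perm_mx w).
  by apply: filterS badF => s [].
have [|v [y [y0 [yL ylim cy0]]]] := @limit_chart K K F UF (ultra_cvg UF) n (fun s => x s *m perm_mx w).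
  apply: filterS cx => s cs; rewrite unitmx_mul unitmx_perm andbT.
  exact: unipotent_unit (cell_unipotent cs).
have uy : \forall s \near F, unipotent (y s) by apply: filterS yL => s [].
have yLi : \forall s \near F, exists2 L, supported lower_rel L &
    y s *m perm_mx v = L *m (x s *m perm_mx w).
  apply: filterS yL => s [_ [L [lL uL] ->]]; exists (invmx L); last by rewrite mulKmx.
  exact: supported_inv (fun c => leqnn c) lower_trans uL lL.
have my c : \forall s \near F, c \in (del, s) :: sigma ->
    \det (incidence c.1 c.2 (y s *m perm_mx v)) = 0.
  near=> s => cs.
  have [L lL ->] : exists2 L, supported lower_rel L & y s *m perm_mx v = L *m (x s *m perm_mx w).
    by near: s.
  have ms : meets ((del, s) :: sigma) (x s *m perm_mx w) by near: s.
  apply: incidence_mull_eq0 (ms _ cs) => i j ic cj; apply: lL; rewrite /lower_rel; lia.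
have mydel : \forall s \near F, \det (incidence del s (y s *m perm_mx v)) = 0.
  near=> s.
  have [L lL ->] : exists2 L, supported lower_rel L & y s *m perm_mx v = L *m (x s *m perm_mx w).
    by near: s.
  have ms : meets ((del, s) :: sigma) (x s *m perm_mx w) by near: s.
  have := ms _ (mem_head _ _).
  apply: incidence_mull_eq0 => i j ic cj; apply: lL; rewrite /lower_rel; lia.
have mysig c : c \in sigma -> \forall s \near F, \det (incidence c.1 c.2 (y s *m perm_mx v)) = 0.
  by move=> cs; apply: filterS (my c) => s; apply; rewrite inE cs orbT.
have my0 : meets sigma (y0 *m perm_mx v).
  move=> c cs; apply: cvg_eq0 (mysig c cs); apply: cvg_det.
  apply: mx_limD; last exact: mx_lim_cst.
  apply: mx_limM; first exact: mx_lim_cst.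
  by apply: mx_limM => //; exact: mx_lim_cst.
have [szv gv] := gs _ _ cy0 my0.
have le i j : (corner v i j <= corner w i j)%N.
  have [s [[L lL e] [us cs]]] := filter_ex (filterI yLi (filterI uy cx)).
  apply: corner_le_of_cells cs us _ e => c d ci id; apply: lL; rewrite /lower_rel; lia.
have [lvw eqvw covvw] := bruhat_length le.
(* With [v = w], uniqueness of coordinates gives [y = x], and the family would converge inside its
   own cell. *)
have vw : v <> w.
  move=> vw; apply: (no_cell_limit PF s_lim s0 ylim _ mydel).
  near=> s; have cs : cell_mx w (x s) by near: s.
  have us : unipotent (y s) by near: s.
  have [L lL] : exists2 L, supported lower_rel L & y s *m perm_mx v = L *m (x s *m perm_mx w).
    by near: s.
  rewrite vw mulmxA => /(can_inj (mulmxK (unitmx_perm _ w))) e.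
  by rewrite e (lower_unipotent_eq lL us (cell_unipotent cs) e) mul1mx.
have ltvw : (perm_length v < perm_length w)%N.
  by rewrite ltn_neqAle lvw andbT; apply/eqP => /eqvw.
have [s1 [_ _ nb1]] := filter_ex badF.
(* In any other length the flag would not be bad: the inequality comes from the cell of [v] and the
   implication is vacuous. *)
have szw : (size sigma).+1 = perm_length w.
  apply: contrapT => ne; apply: nb1; split; first exact: leq_ltn_trans ltvw.
  by move=> e; case: ne.
have szve : size sigma = perm_length v by move: szw ltvw szv; lia.
have [ry0 ndy0] := gv szve.
have [|a [b [ab vab cov wE']]] := covvw; first by rewrite -szw szve.
pose tau0 s := y s a b; pose u s := transvection a b (- tau0 s) *m y s.
have yE s : y s = transvection a b (tau0 s) *m u s.
  by rewrite /u mulmxA transvectionM // subrr transvection0 mul1mx.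
have cu : \forall s \near F, cell_mx v (u s).
  near=> s; have us : unipotent (y s) by near: s.
  have cs : cell_mx w (x s) by near: s.
  have [L lL e] : exists2 L, supported lower_rel L & y s *m perm_mx v = L *m (x s *m perm_mx w).
    by near: s.
  by move: cs e; rewrite wE' => cs e; exact: cover_coordinates cs us lL e.
have tau0l : tau0 s @[s --> F] --> (0 : K).
  have := ylim a b; rewrite cy0; last by rewrite /inversion; lia.
  have -> : (a == b) = false by apply/negbTE; rewrite -(inj_eq val_inj) /= ltn_eqF.
  by [].
have ulim : mx_lim F u y0.
  rewrite -[y0]mul1mx -(transvection0 K a b); apply: mx_limM => //.
  rewrite -oppr0; exact: transvection_lim (cvgN tau0l).
(* Otherwise the condition does not depend on [tau0] and holds for [u], which stays in the cell of
   [v]. *)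
have delab : (a < del <= b)%N.
  apply: contrapT => /negP out; apply: (no_cell_limit (del := del) PF s_lim s0 ulim cu).
  by apply: filterS mydel => s; rewrite yE -mulmxA incidence_transvection_out.
(* The torus multiplies the transvection parameter by [s ^+ v a / s ^+ v b], which is the inverse of
   [s ^+ e]. *)
pose e := (v b - v a)%N; pose tau s := tau0 s / s ^+ e.
have tauE : \forall s \near F, tau0 s = tau s * s ^+ e.
  by apply: filterS s0 => s s0'; rewrite /tau divfK // expf_neq0.
have tauE' s : s != 0 -> tau0 s * s ^+ v a / s ^+ v b = tau s.
  move=> s0'; rewrite /tau /e -[in s ^+ v b](subnK (ltnW vab)) exprD.
  have h1 : s ^+ v a != 0 by rewrite expf_neq0.
  have h2 : s ^+ (v b - v a) != 0 by rewrite expf_neq0.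
  by field; rewrite h1 h2.
have sd : \forall s \near F,
    \det (incidence del 1 (transvection a b (tau s) *m cell_scale v s (u s) *m perm_mx v)) = 0.
  near=> s; have s0' : s != 0 by near: s.
  rewrite -tauE' // -cell_scale_transvection // -yE -rescale_cell_scale.
  by apply: incidence_rescale_eq0 => //; near: s.
pose tl : K := - \det (incidence del 1 (perm_mx v : 'M[K]_n)) /
  \det (incidence del 1 (perm_mx (tperm a b * v)%g : 'M[K]_n)).
have taul : tau t @[t --> F] --> tl.
  by exact (transvection_parameter_lim s_lim s0 ab delab ulim cu sd).
have chartE : \forall s \near F,
    transvection a b (tau s * s ^+ e) *m u s *m perm_mx v = y s *m perm_mx v.
  by apply: filterS tauE => s <-; rewrite -yE.
have real_s : \forall s \near F, s^* = s.
  by apply: filterS spos => s sp; apply: conj_Creal; exact: gtr0_real.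
(* The conjugate family has the same limits: [y0] is real, and [tl] does not depend on the
   family. *)
have real_x : \forall s \near F, conj_mx (x s) = x s.
  pose tau' s := (tau s)^*; pose u' s := conj_mx (u s).
  have ulim' : mx_lim F u' y0.
    by rewrite -ry0 => i j; rewrite mxE; under eq_fun do rewrite mxE; exact: cvg_conj.
  have cu' : \forall s \near F, cell_mx v (u' s).
    by apply: filterS cu => s; exact: conj_cell.
  have sd' : \forall s \near F,
      \det (incidence del 1 (transvection a b (tau' s) *m cell_scale v s (u' s) *m perm_mx v)) = 0.
    near=> s; have rs : s^* = s by near: s.
    rewrite /tau' /u' -conj_transvection -conj_cell_scale // -(conj_perm_mx K v) -!conj_mxM.
    by apply: det_conj_incidence; [exact: conjC1 | near: s].
  have taul' : tau' t @[t --> F] --> tl.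
    by exact (transvection_parameter_lim s_lim s0 ab delab ulim' cu' sd').
  (* Both flags satisfy every condition, so each slope is a difference of two vanishing
     determinants. *)
  have eq0 : \forall s \near F, tau s - tau' s = 0 /\ u s - u' s = 0.
    apply: (@increments_eq0 K K F UF (ultra_cvg UF) n v a b del id s_lim s0 ab vab delab
      sigma y0 ndy0 u u' tau tau' ulim ulim' cu cu' taul taul'
      (fun s => u s - u' s) (fun s => tau s - tau' s)).
    - near=> s; have cs : cell_mx v (u s) by near: s.
      have cs' : cell_mx v (u' s) by near: s.
      by move=> i j nij; rewrite mxE [X in _ + X]mxE cs // cs' // subrr.
    - move=> c cs; near=> s; rewrite mulrBl -transvectionB mulmxBl -(@incidenceB K n c.1 c.2) -detB_slope.
      have rs : s^* = s by near: s.
      have e1 : transvection a b (tau s * s ^+ e) *m u s *m perm_mx v = y s *m perm_mx v.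
        by near: s.
      have e2 : transvection a b (tau' s * s ^+ e) *m u' s *m perm_mx v =
          conj_mx (y s *m perm_mx v).
        by rewrite -e1 conj_mxM conj_mxM conj_transvection conj_perm_mx rmorphM rmorphXn /= rs.
      rewrite e1 e2.
      have d0 : \det (incidence c.1 c.2 (y s *m perm_mx v)) = 0 by near: s; exact: mysig.
      by rewrite d0 det_conj_incidence ?subrr //; exact: rsigma.
    - near=> s; rewrite (_ : cell_scale v s (u s - u' s) = cell_scale v s (u s) - cell_scale v s (u' s)).
        rewrite -transvectionB mulmxBl -(@incidenceB K n del 1) -detB_slope.
        have -> : \det (incidence del 1
          (transvection a b (tau s) *m cell_scale v s (u s) *m perm_mx v)) = 0 by near: s.
        have -> : \det (incidence del 1
          (transvection a b (tau' s) *m cell_scale v s (u' s) *m perm_mx v)) = 0 by near: s.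
        by rewrite subrr.
      by rewrite cell_scale_add -[- u' s]scaleN1r cell_scaleZ scaleN1r.
  near=> s; have [L [lL uL] e1] : exists2 L, supported lower_rel L /\ L \in unitmx &
      x s *m perm_mx w = L *m (y s *m perm_mx v).
    by have [_] : unipotent (y s) /\ exists2 L, supported lower_rel L /\ L \in unitmx &
      x s *m perm_mx w = L *m (y s *m perm_mx v) by near: s.
  have cs : cell_mx w (x s) by near: s.
  apply: (real_of_chart (cell_unipotent cs) lL uL e1).
  have [/subr0_eq tt' /subr0_eq uu'] : tau s - tau' s = 0 /\ u s - u' s = 0 by near: s.
  have rs : s^* = s by near: s.
  have t0E : tau0 s = tau s * s ^+ e by near: s.
  by rewrite yE conj_mxM conj_transvection -/(u' s) -uu' t0E rmorphM rmorphXn /= rs -/(tau' s) -tt'.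
pose nd s := forall h, supported (inversion w) h ->
  tangent ((del, s) :: sigma) (x s *m perm_mx w) (h *m perm_mx w) -> h = 0.
have nds : \forall s \near F, nd s.
  have [//|nnd] := in_ultra_setVsetC [set s | nd s] UF; exfalso.
  pose A s := transvection a b (tau0 s) *m u s *m perm_mx v.
  pose P s (kd : K * 'M[K]_n) := [/\ supported (inversion v) kd.2, (kd.1 != 0) || (kd.2 != 0) &
    forall c, c \in (del, s) :: sigma -> det_slope (incidence c.1 c.2 (A s)) (incidence c.1 c.2 (A s))
      (top K n c.1 *m ((kd.1 *: (delta_mx a b *m u s) + transvection a b (tau0 s) *m kd.2) *m perm_mx v)) = 0].
  have exP : \forall s \near F, exists kd, P s kd.
    near=> s; have nds : ~ nd s by near: s.
    have cs : cell_mx w (x s) by near: s.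
    have cus : cell_mx v (u s) by near: s.
    have ms : meets ((del, s) :: sigma) (x s *m perm_mx w) by near: s.
    have [L [lL uL] e1] : exists2 L, supported lower_rel L /\ L \in unitmx &
        x s *m perm_mx w = L *m (y s *m perm_mx v).
      by have [_] : unipotent (y s) /\ exists2 L, supported lower_rel L /\ L \in unitmx &
        x s *m perm_mx w = L *m (y s *m perm_mx v) by near: s.
    apply: contrapT => noP; apply: nds => h sh th; apply/eqP; apply: contrapT => /negP h0.
    rewrite yE in e1.
    have [k [du [sdu kdu sl]]] := tangent_chart ab vab cov cs cus lL uL e1 sh h0.
    by apply: noP; exists (k, du); split=> // c cc; apply: sl; [exact: ms | exact: th].
  (* The default [(0, 0)] is taken where no such direction exists. *)
  have /choice[kd kdP] : forall s, exists kd, (exists kd, P s kd) -> P s kd.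
    move=> s; have [[kd h]|no] := pselect (exists kd, P s kd); first by exists kd.
    by exists (0, 0).
  have {}kdP : \forall s \near F, P s (kd s) by apply: filterS exP => s; exact: kdP.
  (* The two points coincide here, so the slopes are differentials; division by [s ^+ e] expresses
     the parameter component in the torus scale. *)
  have eq0 : \forall s \near F, (kd s).1 / s ^+ e = 0 /\ (kd s).2 = 0.
    have dtE : \forall s \near F, (kd s).1 / s ^+ e * s ^+ e = (kd s).1.
      by apply: filterS s0 => s s0'; rewrite divfK // expf_neq0.
    apply: (@increments_eq0 K K F UF (ultra_cvg UF) n v a b del id s_lim s0 ab vab delab
      sigma y0 ndy0 u u tau tau ulim ulim cu cu taul taul
      (fun s => (kd s).2) (fun s => (kd s).1 / s ^+ e)).
    - by apply: filterS kdP => s [].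
    - move=> c cs; near=> s; have [_ _ sl] : P s (kd s) by near: s.
      have t0E : tau0 s = tau s * s ^+ e by near: s.
      have -> : (kd s).1 / s ^+ e * s ^+ e = (kd s).1 by near: s.
      by rewrite -t0E; apply: sl; rewrite inE cs orbT.
    - near=> s; have [_ _ sl] : P s (kd s) by near: s.
      have s0' : s != 0 by near: s.
      have := incidence_slope_cell_scale s0' erefl erefl (sl _ (mem_head _ _)).
      rewrite !tauE' // (_ : (kd s).1 * _ / _ = (kd s).1 / s ^+ e) //.
      rewrite /e -[in s ^+ v b](subnK (ltnW vab)) exprD.
      have h1 : s ^+ v a != 0 by rewrite expf_neq0.
      have h2 : s ^+ (v b - v a) != 0 by rewrite expf_neq0.
      by field; rewrite h1 h2.
  have [s [[_ kdn _] [[k0 d0] s0']]] := filter_ex (filterI kdP (filterI eq0 s0)).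
  move: kdn k0; rewrite d0 eqxx orbF => kn /eqP.
  by rewrite mulf_eq0 (negbTE kn) invr_eq0 expf_eq0 (negbTE s0') andbF.
have [s [[_ _ nb] [rx nds']]] := filter_ex (filterI badF (filterI real_x nds)).
by apply: nb; split; [rewrite -szw | move=> _; split].
Unshelve. all: by end_near. Qed.

Lemma exists_good (dels : seq nat) : exists ss : seq K,
  [/\ size ss = size dels, all (fun s => 0 < s) ss & @good K n (zip dels ss)].
Proof.
elim: dels => [|del dels [ss [sz pos gs]]]; first by exists [::]; split=> //; exact: good_nil.
have [c cin|s [s0 gs']] := good_step del _ gs; last by exists (s :: ss); rewrite /= sz s0.
apply: conj_Creal; apply: gtr0_real; move/allP: pos; apply.
have -> : ss = unzip2 (zip dels ss) by rewrite unzip2_zip ?sz.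
exact: map_f.
Qed.

End Core.

(** * Flags and adapted bases *)

Section RowSpaces.
Variables (K : numFieldType) (n : nat).
Implicit Types (V : {vspace 'rV[K]_n}) (A B g L : 'M[K]_n).

Lemma rank_mask (S : pred 'I_n) : \rank (mask K S) = #|S|.
Proof.
apply/eqP; rewrite eqn_leq rank_mask_le /=.
have := mxrank_add (mask K S) (mask K (predC S)); rewrite -maskC mxrank1.
have := rank_mask_le K (predC S); have : (#|S| + #|predC S| = n)%N by rewrite cardC card_ord.
move=> e le1 le2; rewrite -(leq_add2r #|predC S|) e.
by apply: leq_trans le2 _; rewrite leq_add2l.
Qed.

Lemma dim_vspace_mx m (B : 'M[K]_(m, n)) V :
  (forall u, (u \in V) = (u <= B)%MS) -> \dim V = \rank B.
Proof.
move=> VB; pose M : 'M[K]_(\dim V, n) := \matrix_i (vbasis V)`_i.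
have rowM i : row i M = (vbasis V)`_i by rewrite rowK.
have comb (c : 'rV[K]_(\dim V)) : c *m M = \sum_i c 0 i *: (vbasis V)`_i.
  by rewrite mulmx_sum_row; apply: eq_bigr => i _; rewrite rowM.
have freeM : row_free M.
  apply/inj_row_free => c c0; apply/rowP => i; rewrite mxE.
  have /freeP/(_ (fun i => c 0 i)) := basis_free (vbasisP V).
  by rewrite -comb => /(_ c0).
rewrite -(eqP freeM); apply/eqP; rewrite eqn_leq; apply/andP; split; apply: mxrankS.
  apply/row_subP => i; rewrite rowM -VB; apply: vbasis_mem; apply: mem_nth.
  by rewrite size_tuple.
apply/row_subP => i; have : row i B \in V by rewrite VB row_sub.
move/coord_vbasis => ->; apply/submxP; exists (\row_j coord (vbasis V) j (row i B)).
by rewrite comb; apply: eq_bigr => j _; rewrite mxE.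
Qed.

Definition rowspan g (k : nat) : {vspace 'rV[K]_n} :=
  (\sum_(a < n | (a < k)%N) <[row a g]>)%VS.

Lemma row_top g k (a : 'I_n) :
  row a (top K n k *m g) = if (a < k)%N then row a g else 0.
Proof.
apply/rowP => j; rewrite mxE maskl; case: ltnP => _; rewrite ?mul1r ?mul0r !mxE //.
Qed.

Lemma mem_rowspan g k u : (u \in rowspan g k) = (u <= top K n k *m g)%MS.
Proof.
apply/idP/submxP => [/memv_sumP[v vP ->]|[c ->]].
  apply/submxP; apply: summx_sub => a ak; have /vlineP[l ->] := vP a ak.
  by apply: scalemx_sub; have := row_sub a (top K n k *m g); rewrite row_top ak.
rewrite mulmx_sum_row; apply: rpred_sum => a _; apply: rpredZ; rewrite row_top.
case: ifP => ak; last exact: mem0v.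
by rewrite memvE; apply: (sumv_sup a).
Qed.

Lemma dim_rowspan g k : g \in unitmx -> (k <= n)%N -> \dim (rowspan g k) = k.
Proof.
move=> ug kn; rewrite (dim_vspace_mx (mem_rowspan g k)) mxrankMfree ?row_free_unit //.
rewrite rank_mask -[RHS](card_ord k) -!sum1_card.
by rewrite -(big_ord_widen_cond n xpredT (fun=> 1%N)).
Qed.

Lemma rowspan_mono g k l : (k <= l)%N -> (rowspan g k <= rowspan g l)%VS.
Proof.
move=> kl; apply/subv_sumP => a ak; apply: (sumv_sup a) => //; exact: leq_trans kl.
Qed.

Lemma row_rowspan g h k : g \in unitmx ->
  (forall c d : 'I_n, (c < k)%N -> (k <= d)%N -> (h *m invmx g) c d = 0) ->
  (rowspan h k <= rowspan g k)%VS.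
Proof.
move=> ug h0; apply/subvP => u; rewrite !mem_rowspan => /submx_trans; apply.
apply/submxP; exists (top K n k *m (h *m invmx g)); rewrite !mulmxA.
rewrite (_ : top K n k *m h *m invmx g *m top K n k = top K n k *m h *m invmx g).
  by rewrite mulmxKV.
apply/matrixP => c d; rewrite maskr -mulmxA maskl.
case: (ltnP c k) => ck; last by rewrite !mul0r.
by case: (ltnP d k) => dk; rewrite ?mulr1 // h0 // !mulr0.
Qed.

Lemma eq_rowspan L g k : g \in unitmx -> L \in unitmx -> (k <= n)%N ->
  (forall c d : 'I_n, (c < k)%N -> (k <= d)%N -> L c d = 0) ->
  rowspan (L *m g) k = rowspan g k.
Proof.
move=> ug uL kn L0; apply/eqP; rewrite eqEdim row_rowspan //; last by rewrite mulmxK.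
by rewrite !dim_rowspan ?unitmx_mul ?uL ?ug ?leqnn.
Qed.

Lemma rowspan_change g h k : g \in unitmx -> rowspan h k = rowspan g k ->
  forall c d : 'I_n, (c < k)%N -> (k <= d)%N -> (h *m invmx g) c d = 0.
Proof.
move=> ug e c d ck kd; have : row c h \in rowspan g k.
  by rewrite -e memvE; apply: (sumv_sup c).
rewrite mem_rowspan => /submxP[D eD].
have -> : (h *m invmx g) c d = (row c h *m invmx g) 0 d by rewrite -row_mul [RHS]mxE.
by rewrite eD mulmxA mulmxK // maskr ltnNge kd mulr0.
Qed.

(** Rank-nullity for the projection along [rowspan g j]: in the basis [g] it keeps the columns from
    [j] on, so its rank on the first [i] rows is [corner_rank]. *)
Lemma dim_cap_rowspan A g i j : A \in unitmx -> g \in unitmx -> (i <= n)%N ->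
  (\dim (rowspan (A *m g) i :&: rowspan g j) + corner_rank A i j = i)%N.
Proof.
move=> uA ug iN; set J := mask K (fun l : 'I_n => (j <= l)%N).
have capP u : (u \in (rowspan (A *m g) i :&: rowspan g j)%VS) =
    (u <= top K n i *m (A *m g) :&: kermx (invmx g *m J))%MS.
  rewrite memv_cap sub_capmx !mem_rowspan; congr (_ && _).
  apply/submxP/sub_kermxP => [[c ->]|].
    rewrite !mulmxA mulmxK // -mulmxA maskM (_ : mask _ _ = 0) ?mulmx0 //.
    by apply/matrixP => a b; rewrite !mxE ltnNge andNb mul0rn.
  rewrite mulmxA => e; exists (u *m invmx g); rewrite mulmxA -[LHS](mulmxKV ug).
  congr (_ *m _); rewrite -[LHS]mulmx1 (maskC K (fun l : 'I_n => (l < j)%N)) mulmxDr.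
  rewrite [mask K (predC _)](_ : _ = J); last by apply: eq_mask => l; exact/esym/leqNgt.
  by rewrite -mulmxA e addr0.
rewrite (dim_vspace_mx capP).
have := mxrank_mul_ker (top K n i *m (A *m g)) (invmx g *m J).
have -> : top K n i *m (A *m g) *m (invmx g *m J) = top K n i *m A *m J.
  by rewrite !mulmxA mulmxK.
rewrite -/(corner_rank A i j).
rewrite addnC => ->; rewrite -(dim_vspace_mx (mem_rowspan (A *m g) i)) dim_rowspan //.
by rewrite unitmx_mul uA.
Qed.

End RowSpaces.

(** * Incidence with osculating spaces as a determinant *)

Section OsculatingRows.
Variables (K : numFieldType) (n : nat).
Implicit Types (A g : 'M[K]_n) (s : K).

Lemma osc_mx_unit s : osc_mx n 0 s \in unitmx.
Proof.
rewrite -unitmx_tr unitmxE det_trig.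
  rewrite unitfE; apply/prodf_neq0 => i _.
  by rewrite !mxE subn0 ffactnn subnn expr0 mulr1 pnatr_eq0 -lt0n fact_gt0.
by apply/is_trig_mxP => i j ij; rewrite !mxE subn0 ffact_small // mul0r.
Qed.

(** Multiplication by this matrix moves row [k] to row [del + k], relating the lower rows of an
    incidence matrix to the osculating flag [osc_mx n 0 s]. *)
Let shift del : 'M[K]_n := \matrix_(i, k) (i == (del + k)%N :> nat)%:R.

Let osc_shift del s : osc_mx n del s = shift del *m osc_mx n 0 s.
Proof.
apply/matrixP => i j; rewrite !mxE; case: ltnP => di.
  rewrite big1 // => k _; rewrite mxE (_ : (i == _ :> nat) = false) ?mul0r //.
  by apply/negbTE; lia.
have lt : (i - del < n)%N by have := ltn_ord i; lia.
rewrite (bigD1 (Ordinal lt)) //= big1 => [|k kk]; rewrite !mxE.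
  by rewrite subnKC // eqxx mul1r addr0 subn0.
rewrite (_ : (i == _ :> nat) = false) ?mul0r //; apply: contraNF kk => /eqP e.
by apply/eqP/val_inj; rewrite /= e addKn.
Qed.

Let shift_trl del : (shift del)^T *m shift del = top K n (n - del).
Proof.
apply/matrixP => k l; rewrite !mxE; have [kd|dk] := ltnP k (n - del).
  have lt : (del + k < n)%N by lia.
  rewrite (bigD1 (Ordinal lt)) //= big1 => [|i ii]; rewrite !mxE /=.
    by rewrite eqxx mul1r addr0 eqn_add2l (inj_eq val_inj) ; case: eqP.
  rewrite (_ : (i == _ :> nat) = false) ?mul0r //; apply: contraNF ii => /eqP e.
  by apply/eqP/val_inj.
rewrite mul0rn big1 // => i _; rewrite !mxE (_ : (i == (del + k)%N :> nat) = false) ?mul0r //.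
by apply/negbTE; have := ltn_ord i; lia.
Qed.

Let shift_trr del : shift del *m (shift del)^T = mask K (predC (fun l : 'I_n => (l < del)%N)).
Proof.
apply/matrixP => k l; rewrite !mxE /=; have [kd|dk] := ltnP k del.
  rewrite mul0rn big1 // => i _; rewrite !mxE (_ : (k == (del + i)%N :> nat) = false) ?mul0r //.
  by apply/negbTE; lia.
have lt : (k - del < n)%N by have := ltn_ord k; lia.
rewrite (bigD1 (Ordinal lt)) //= big1 => [|i ii]; rewrite !mxE /=.
  by rewrite subnKC // eqxx mul1r addr0 eq_sym (inj_eq val_inj); case: eqP.
rewrite (_ : (k == _ :> nat) = false) ?mul0r //; apply: contraNF ii => /eqP e.
by apply/eqP/val_inj; rewrite /= e addKn.
Qed.

Let top_shift del : (shift del)^T *m top K n del = 0.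
Proof.
apply/matrixP => k l; rewrite maskr !mxE; case: ltnP => ld; rewrite ?mulr0 // mulr1.
by rewrite (_ : (_ == _ :> nat) = false) //; apply/negbTE; lia.
Qed.

Let shift_top del : top K n del *m shift del = 0.
Proof.
apply/matrixP => k l; rewrite maskl !mxE; case: ltnP => kd; rewrite ?mul0r // mul1r.
by rewrite (_ : (_ == _ :> nat) = false) //; apply/negbTE; lia.
Qed.

Let topM del : top K n del *m top K n del = top K n del.
Proof. by rewrite maskM; apply: eq_mask => l; rewrite andbb. Qed.

(** A common vector is a combination of the first [del] rows of [A] and also one of osculating rows;
    their difference is a row dependency of the incidence matrix, and conversely. *)
Lemma rowspan_osc_cap A g del s : A \in unitmx -> g \in unitmx ->
  ((rowspan (A *m g) del :&: rowspan (osc_mx n 0 s *m g) (n - del))%VS != 0%VS) =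
  (\det (incidence del s A) == 0).
Proof.
move=> uA ug; have uT := osc_mx_unit s; set T := osc_mx n 0 s in uT *.
have incE (c : 'rV_n) : c *m incidence del s A = c *m top K n del *m A + c *m shift del *m T.
  by rewrite mulmxDr osc_shift !mulmxA.
apply/idP/det0P => [|[c c0]].
  rewrite -dimv_eq0 -lt0n => dim0; set V := (_ :&: _)%VS in dim0.
  have : vpick V != 0 by rewrite vpick0 -dimv_eq0 -lt0n.
  have : vpick V \in V by exact: memv_pick.
  set u := vpick V; rewrite memv_cap !mem_rowspan => /andP[/submxP[c ec] /submxP[c' ec']] u0.
  exists (c *m top K n del - c' *m (shift del)^T).
    apply: contra_neq u0 => /(congr1 (mulmx^~ (top K n del))).
    rewrite mul0mx mulmxBl -!mulmxA top_shift mulmx0 subr0 topM => e0.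
    by rewrite ec (mulmxA c) e0 mul0mx.
  rewrite incE !mulmxBl -(mulmxA c (top K n del) (top K n del)) topM.
  rewrite -(mulmxA c' _ (top K n del)) top_shift mulmx0 mul0mx subr0.
  rewrite -(mulmxA c (top K n del) (shift del)) shift_top mulmx0 mul0mx sub0r.
  rewrite -(mulmxA c' _ (shift del)) shift_trl.
  apply: (can_inj (mulmxK ug)); rewrite mul0mx mulmxDl mulNmx -!mulmxA.
  by rewrite -ec -ec' subrr.
rewrite incE => /eqP; rewrite addr_eq0 => /eqP e.
apply: contra_neq c0 => V0.
pose u := c *m top K n del *m A *m g.
have : u \in (rowspan (A *m g) del :&: rowspan (T *m g) (n - del))%VS.
  rewrite memv_cap !mem_rowspan; apply/andP; split; apply/submxP.
    by exists c; rewrite /u !mulmxA.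
  exists (- (c *m shift del)); rewrite /u e -shift_trl !mulmxA !mulNmx.
  congr (- (_ *m _ *m _)); rewrite -!mulmxA (mulmxA (shift del)) shift_trr.
  congr (_ *m _); apply/matrixP => i j; rewrite maskl /= mxE.
  by case: ltnP => di; rewrite ?mul1r // mul0r (_ : (_ == _ :> nat) = false) //; apply/negbTE; lia.
rewrite V0 memv0 => /eqP u0.
have ctop : c *m top K n del = 0.
  by apply: (can_inj (mulmxK uA)); apply: (can_inj (mulmxK ug)); rewrite !mul0mx.
have cS : c *m shift del = 0.
  apply: (can_inj (mulmxK uT)); rewrite mul0mx; apply/eqP.
  by rewrite -oppr_eq0 -e ctop mul0mx.
rewrite -[c]mulmx1 (maskC K (fun l : 'I_n => (l < del)%N)) mulmxDr -/(top K n del) ctop.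
by rewrite -shift_trr mulmxA cS mul0mx addr0.
Qed.

End OsculatingRows.

Section AdaptedBases.
Variables (K : numFieldType) (n m : nat) (d : 'I_m -> nat).
Hypothesis d_range : forall i, (0 < d i < n)%N.
Hypothesis d_incr : forall i j : 'I_m, (i < j)%N -> (d i < d j)%N.
Implicit Types (E : flag K n d) (g h L A : 'M[K]_n).

Lemma adaptedP g E : reflect (g \in unitmx /\ forall i, E i = rowspan g (d i)) (adapted g E).
Proof.
apply: (iffP andP) => -[ug]; first by move=> /forallP h; split=> // i; exact/eqP.
by move=> h; split=> //; apply/forallP => i; apply/eqP; exact: h.
Qed.

Let d_le i : (d i <= n)%N.
Proof. by have /andP[_ /ltnW] := d_range i. Qed.

Let d_mono (i j : 'I_m) : (i <= j)%N -> (d i <= d j)%N.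
Proof. by rewrite leq_eqVlt => /orP[/eqP/val_inj->//|/d_incr/ltnW]. Qed.

Lemma exists_flag g : g \in unitmx -> exists E, adapted g E.
Proof.
move=> ug; pose V : {ffun 'I_m -> {vspace 'rV[K]_n}} := [ffun i => rowspan g (d i)].
have fV : is_flag d V.
  apply/andP; split; apply/forallP => i; first by rewrite ffunE dim_rowspan.
  by apply/forallP => j; apply/implyP => ij; rewrite !ffunE rowspan_mono // d_mono.
by exists (Flag fV); apply/adaptedP; split=> // i; rewrite /= ffunE.
Qed.

(** Bases of the successive subspaces are obtained by extension, so that each [E i] is spanned by an
    initial segment of one list. *)
Lemma exists_adapted E : exists g, adapted g E.
Proof.
have /andP[/forallP dimE /forallP monoE] : is_flag d E by case: E.
have dimE' i : \dim (E i) = d i by exact/eqP.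
have extend (X : seq 'rV[K]_n) V : free X -> (<<X>> <= V)%VS ->
    exists Y, [/\ free (X ++ Y), <<X ++ Y>>%VS = V & size (X ++ Y) = \dim V].
  move=> fX XV; exists (vbasis (V :\: <<X>>)%VS).
  have fXY : free (X ++ vbasis (V :\: <<X>>)%VS).
    rewrite cat_free fX (basis_free (vbasisP _)) /=; apply/directv_addP.
    by rewrite (span_basis (vbasisP _)) capvC capv_diff.
  have sXY : <<X ++ vbasis (V :\: <<X>>)%VS>>%VS = V.
    rewrite span_cat (span_basis (vbasisP _)) addvC addv_diff.
    exact/addv_idPl.
  by split=> //; move: (fXY) => /eqP; rewrite sXY => <-.
have [X [fX EX _]] : exists X : seq 'rV[K]_n, [/\ free X,
    (forall i : 'I_m, (i < m)%N -> (d i <= size X)%N /\ E i = <<take (d i) X>>%VS) &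
    (forall i : 'I_m, (m <= i)%N -> <<X>> <= E i)%VS].
  suff : forall k, (k <= m)%N -> exists X : seq 'rV[K]_n, [/\ free X,
    (forall i : 'I_m, (i < k)%N -> (d i <= size X)%N /\ E i = <<take (d i) X>>%VS) &
    (forall i : 'I_m, (k <= i)%N -> <<X>> <= E i)%VS] by apply.
  elim=> [|k IHk] km.
    by exists [::]; split=> // [|i _]; rewrite ?nil_free // span_nil sub0v.
  have [X [fX EX XE]] := IHk (ltnW km); pose k' := Ordinal km.
  have [Y [fXY sXY szXY]] := extend X (E k') fX (XE k' (leqnn _)).
  exists (X ++ Y); split=> // i.
    rewrite ltnS leq_eqVlt => /orP[/eqP e|ik].
      have -> : i = k' by exact: val_inj.
      by rewrite szXY dimE' leqnn take_oversize ?szXY ?dimE'.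
    have [le ->] := EX _ ik; rewrite size_cat takel_cat //.
    by split=> //; apply: leq_trans le _; rewrite leq_addr.
  by move=> ki; rewrite sXY; have /forallP/(_ i)/implyP := monoE k'; apply; exact: ltnW.
have [Y [fXY _ szXY]] := extend X fullv fX (subvf _).
have {szXY} szn : size (X ++ Y) = n by rewrite szXY dimvf /dim /= mul1n.
pose g : 'M[K]_n := \matrix_(i < n) (X ++ Y)`_i.
have rowg (a : 'I_n) : row a g = (X ++ Y)`_a by rewrite rowK.
exists g; apply/adaptedP; split.
  rewrite -row_free_unit; apply/inj_row_free => c c0; apply/rowP => i; rewrite mxE.
  have : free (tcast szn (in_tuple (X ++ Y))) by rewrite val_tcast.
  move/freeP/(_ (fun a => c 0 a)); apply; rewrite -[RHS]c0 mulmx_sum_row.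
  by apply: eq_bigr => a _; rewrite rowg val_tcast.
move=> i; have [le ->] := EX i (ltn_ord i).
rewrite -(takel_cat Y le) span_def (big_nth 0) size_takel; last by rewrite szn.
rewrite big_mkord; transitivity (\sum_(a < d i) <[(X ++ Y)`_a]>)%VS.
  by apply: eq_bigr => a _; rewrite nth_take.
rewrite (big_ord_widen n (fun a => <[(X ++ Y)`_a]>%VS) (d_le i)).
by apply: eq_bigr => a _; rewrite rowg.
Qed.

(** The invertible matrices of this form are the parabolic subgroup by which two adapted bases of
    one flag differ. *)
Definition block_lower L := forall i (a b : 'I_n), (a < d i)%N -> (d i <= b)%N -> L a b = 0.

Lemma adapted_mull g E L : adapted g E -> L \in unitmx -> block_lower L -> adapted (L *m g) E.
Proof.
move=> /adaptedP[ug Eg] uL bL; apply/adaptedP; split; first by rewrite unitmx_mul uL.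
by move=> i; rewrite Eg eq_rowspan // => a b; exact: bL.
Qed.

Lemma adapted_change g h E : adapted g E -> adapted h E -> block_lower (h *m invmx g).
Proof.
move=> /adaptedP[ug Eg] /adaptedP[uh Eh] i a b ai ib.
by apply: (@rowspan_change _ _ _ _ (d i)) => //; rewrite -Eg -Eh.
Qed.

Lemma flag_posP (a b : 'I_n) : reflect (exists i, (a < d i <= b)%N) ((a, b) \in flag_pos n d).
Proof. by rewrite inE; exact: existsP. Qed.

Lemma block_lowerE L : block_lower L <-> supported (fun a b => (a, b) \notin flag_pos n d) L.
Proof.
split=> [bL a b|sL i a b ai ib].
  by rewrite negbK => /flag_posP[i /andP[ai ib]]; exact: bL ai ib.
by apply: sL; rewrite negbK; apply/flag_posP; exists i; rewrite ai.
Qed.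

Lemma lower_block L : supported lower_rel L -> block_lower L.
Proof. by move=> lL i a b ai ib; apply: lL; rewrite /lower_rel; lia. Qed.

Lemma not_flag_pos_trans : transitive (fun a b => (a, b) \notin flag_pos n d).
Proof.
move=> b a c /flag_posP ab /flag_posP bc; apply/flag_posP => -[i /andP[ai ic]].
have [bi|ib] := ltnP b (d i); first by apply: bc; exists i; rewrite bi.
by apply: ab; exists i; rewrite ai.
Qed.

Lemma not_flag_pos_refl : reflexive (fun a b => (a, b) \notin flag_pos n d).
Proof. by move=> a; apply/flag_posP => -[i]; lia. Qed.

Lemma block_lower_mul L M : block_lower L -> block_lower M -> block_lower (L *m M).
Proof.
rewrite !block_lowerE; exact: supported_mul not_flag_pos_trans.
Qed.

Lemma block_lower_inv L : L \in unitmx -> block_lower L -> block_lower (invmx L).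
Proof.
rewrite !block_lowerE; exact: supported_inv not_flag_pos_refl not_flag_pos_trans.
Qed.

(** The parabolic subgroup meets the opposite unipotent radical trivially, so the chart coordinates
    of a partial flag are unique. *)
Lemma block_lower_unipotent_eq L (u u' : 'M[K]_n) : block_lower L ->
  (forall a b, (a, b) \notin flag_pos n d -> u a b = (a == b)%:R) ->
  (forall a b, (a, b) \notin flag_pos n d -> u' a b = (a == b)%:R) ->
  u = L *m u' -> u = u'.
Proof.
move=> /block_lowerE bL hu hu' e.
pose P := fun a b : 'I_n => (a == b) || ((a, b) \in flag_pos n d).
have posltn (a b : 'I_n) : (a, b) \in flag_pos n d -> (a < b)%N.
  by move/flag_posP => [i]; lia.
have unip (x : 'M[K]_n) : (forall a b, (a, b) \notin flag_pos n d -> x a b = (a == b)%:R) -> unipotent x.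
  by move=> hx a b ba; apply: hx; apply: contraL ba => /posltn; rewrite -ltnNge.
have sP (x : 'M[K]_n) : (forall a b, (a, b) \notin flag_pos n d -> x a b = (a == b)%:R) -> supported P x.
  by move=> hx a b; rewrite negb_or => /andP[/negbTE ab /hx->]; rewrite ab.
have Pt : transitive P.
  move=> b a c; rewrite /P; case: eqP => [->//|_] /=; case: eqP => [->->|_ /=]; first by rewrite orbT.
  move=> /flag_posP[i /andP[ai ib]] /posltn bc; apply/orP; right; apply/flag_posP; exists i; lia.
have Pr : reflexive P by move=> a; rewrite /P eqxx.
have uu' := unipotent_unit (unip _ hu').
have sL : supported P L.
  rewrite -[L](mulmxK uu') -e; apply: (supported_mul Pt (sP _ hu)).
  exact: supported_inv Pr Pt uu' (sP _ hu').
have lL : supported lower_rel L.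
  move=> a b; rewrite /lower_rel -ltnNge => ab.
  have [pos|npos] := boolP ((a, b) \in flag_pos n d); first by apply: bL; rewrite negbK.
  by apply: sL; rewrite /P (negbTE npos) orbF -(inj_eq val_inj) ltn_eqF.
by rewrite e (lower_unipotent_eq lL (unip _ hu) (unip _ hu') e) mul1mx.
Qed.

End AdaptedBases.

(** * Schubert varieties *)

(** For a constant family along a principal ultrafilter, [limit_chart] is plain Gaussian
    elimination. *)
Lemma bruhat_decomposition (K : numClosedFieldType) n (A : 'M[K]_n) : A \in unitmx ->
  exists (w : 'S_n) x L, [/\ cell_mx w x, supported lower_rel L, L \in unitmx &
    A = L *m (x *m perm_mx w)].
Proof.
move=> uA; have UF := principal_filter_ultra tt.
have cvg_tt (f : unit -> K) : f t @[t --> principal_filter tt] --> f tt.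
  by apply: cvg_near_cst; apply/principal_filterP.
have [f _||v [y [y0 [/principal_filterP[_ [L [lL uL] e]] ylim cy0]]]] :=
    @limit_chart K unit (principal_filter tt) UF _ n (fun=> A).
- by exists (f tt); exact: cvg_tt.
- exact/principal_filterP.
exists v, y0, L; split=> //; rewrite e (_ : y tt = y0) //; apply/matrixP => i j.
exact: cvg_inj (cvg_tt (fun t => y t i j)) (ylim i j).
Qed.

Section Lifts.
Variables (K : numClosedFieldType) (n m : nat) (d : 'I_m -> nat).
Hypothesis d_range : forall i, (0 < d i < n)%N.
Hypothesis d_incr : forall i j : 'I_m, (i < j)%N -> (d i < d j)%N.
Implicit Types (E : flag K n d) (g h L A x y : 'M[K]_n) (v w : 'S_n).
Let d_le i : (d i <= n)%N.
Proof. by have /andP[_ /ltnW] := d_range i. Qed.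

Lemma in_Id_lt w (a b : 'I_n) : in_Id d w -> (a < b)%N -> (a, b) \notin flag_pos n d ->
  (w a < w b)%N.
Proof.
move=> wI ab; have [k ek] : exists k, b = (a + k.+1)%N :> nat by exists (b - a.+1)%N; lia.
elim: k b ek {ab} => [|k IHk] b eb npos.
  have := perm_neq w (a := a) (b := b); rewrite -(inj_eq val_inj) /= eb ltn_eqF; last by lia.
  move=> /(_ isT); rewrite neq_ltn => /orP[//|lt].
  have [|i ei] := wI a b _ lt; first by lia.
  by move/flag_posP: npos; case; exists i; lia.
have lt : (a + k.+1 < n)%N by have := ltn_ord b; lia.
pose c := Ordinal lt.
have ltac : (w a < w c)%N.
  apply: IHk => //; apply: contra npos => /flag_posP[i ei]; apply/flag_posP.
  by exists i; rewrite /= in ei *; lia.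
apply: leq_trans ltac _; apply/ltnW.
have := perm_neq w (a := c) (b := b); rewrite -(inj_eq val_inj) /= eb ltn_eqF; last by lia.
move=> /(_ isT); rewrite neq_ltn => /orP[//|ltbc].
have [|i ei] := wI c b _ ltbc; first by rewrite /=; lia.
by move/flag_posP: npos; case; exists i; lia.
Qed.

Lemma in_Id_inversion w (a b : 'I_n) : in_Id d w -> inversion w a b -> (a, b) \in flag_pos n d.
Proof.
move=> wI /andP[ab wba]; apply/negPn/negP => /(in_Id_lt wI ab); lia.
Qed.

Lemma cell_flag_pos w x : in_Id d w -> cell_mx w x ->
  forall a b, (a, b) \notin flag_pos n d -> x a b = (a == b)%:R.
Proof. by move=> wI cx a b npos; apply: cx; apply: contra npos; exact: in_Id_inversion. Qed.

(** The entry [x a b] is the only one that the exchange of [a] and [b] would move below the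
    diagonal; once it is cleared, the conjugate lies in the cell of the shorter permutation. *)
Lemma cell_adjacent_swap w x (a b : 'I_n) : b = a.+1 :> nat -> (w b < w a)%N -> cell_mx w x ->
  cell_mx (tperm a b * w)
    (perm_mx (tperm a b) *m (transvection a b (- x a b) *m x) *m perm_mx (tperm a b)).
Proof.
move=> eb wba cx c e; set t := tperm a b.
have tK : (t^-1)%g = t by rewrite tpermV.
rewrite -[t in _ *m perm_mx t]tK -col_permE mxE -row_permE mxE.
rewrite /inversion !permM => ninv.
have ux := cell_unipotent cx.
have ab : a != b by rewrite -(inj_eq val_inj) /= eb ltn_eqF.
rewrite -(inj_eq (@perm_inj _ t)) transvection_mulE.
have [tca|tca] := eqVneq (t c) a; last first.
  rewrite mul0r addr0; have [tcb|tcb] := eqVneq (t c) b.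
    have -> : x (t c) (t e) = x b (t e) by rewrite tcb.
    have ca : c = a by rewrite -[c](tpermK a b) -/t tcb tpermR.
    have [te|te] := leqP (t e) b; first by rewrite ux // tcb.
    have eE : t e = e by rewrite /t tpermD //; apply: contraTneq te => <-; rewrite /t ?tpermL ?tpermR; lia.
    rewrite tcb cx //; apply: contra ninv; rewrite /inversion -/t ca eE => /andP[be wbe].
    by rewrite /t tpermL wbe andbT -/t; lia.
  have cE : t c = c.
    by rewrite /t tpermD //; [apply: contra_neq tcb | apply: contra_neq tca] => <-; rewrite /t ?tpermL ?tpermR.
  rewrite cE cx //; apply: contra ninv; rewrite /inversion -/t cE => /andP[ce wce].
  rewrite wce andbT; move: ce; rewrite /t; case: tpermP => [->|->|//]; last by lia.
  have : c != a by rewrite -cE.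
  by rewrite -(inj_eq val_inj) /=; lia.
rewrite mul1r mulNr tca.
have cb : c = b by rewrite -[c](tpermK a b) -/t tca tpermL.
have [->|teb] := eqVneq (t e) b; first by rewrite [x b b]ux // eqxx mulr1 subrr (negbTE ab).
have [te|te] := leqP (t e) a.
  rewrite ux // [x b (t e)]ux; last by lia.
  have -> : (b == t e) = false by rewrite eq_sym (negbTE teb).
  by rewrite mulr0 subr0.
have lbe : (b < t e)%N by rewrite ltn_neqAle eq_sym (inj_eq val_inj) teb; lia.
have eE : t e = e.
  by rewrite /t tpermD //; apply: contraTneq lbe => <-; rewrite /t ?tpermL ?tpermR; lia.
have tb : t b = a by rewrite /t tpermR.
have nbe : ~~ inversion w b e.
  apply: contra ninv; rewrite /inversion -/t cb eE tb => /andP[h1 h2].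
  by rewrite h1 /=; lia.
have nae : ~~ inversion w a e.
  apply: contra ninv; rewrite /inversion -/t cb eE tb => /andP[h1 h2].
  by rewrite h2 andbT -eE.
rewrite eE [x b e]cx // cx //; have -> : (b == e) = false by rewrite -eE eq_sym (negbTE teb).
by rewrite mulr0 subr0.
Qed.

Variable g0 : 'M[K]_n.
Hypothesis ug0 : g0 \in unitmx.

(** Among the permutations that represent the flag one of least length is taken. A descent outside
    [d] would lie within a block, and swapping its two rows would keep the flag and shorten [w]. *)
Lemma flag_lift E : exists w x, [/\ in_Id d w, cell_mx w x & adapted (x *m perm_mx w *m g0) E].
Proof.
pose P w := `[< exists x, cell_mx w x /\ adapted (x *m perm_mx w *m g0) E >].
have [w0 Pw0] : exists w, P w.
  have [g gE] := exists_adapted d_range E; have /adaptedP[ug _] := gE.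
  have [|w [x [L [cx lL uL e]]]] := @bruhat_decomposition K n (g *m invmx g0).
    by rewrite unitmx_mul ug unitmx_inv.
  exists w; apply/asboolP; exists x; split; first exact: cx.
  have -> : x *m perm_mx w *m g0 = invmx L *m g.
    by rewrite -[g](mulmxKV ug0) e !mulmxA mulVmx // mul1mx.
  apply: adapted_mull => //; first by rewrite unitmx_inv.
  by apply: block_lower_inv => //; exact: lower_block.
case: (@arg_minnP _ w0 P (fun w : 'S_n => perm_length w) Pw0) => w /asboolP[x [cx xE]] wmin.
exists w, x; split=> // a b eb wba; apply: contrapT => nd.
have ninD i : d i <> b by move=> di; apply: nd; exists i.
have ltab : (a < b)%N by rewrite eb.
pose t := tperm a b; pose z := perm_mx t *m (transvection a b (- x a b) *m x) *m perm_mx t.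
have Pt : P (t * w)%g.
  apply/asboolP; exists z; split; first exact: cell_adjacent_swap.
  have -> : z *m perm_mx (t * w) *m g0 =
      (perm_mx t *m transvection a b (- x a b)) *m (x *m perm_mx w *m g0).
    rewrite /z perm_mxM !mulmxA -(mulmxA _ (perm_mx t) (perm_mx t)) -perm_mxM.
    by rewrite /t tperm2 perm_mx1 mulmx1.
  apply: adapted_mull => //.
    by rewrite unitmx_mul unitmx_perm /= unipotent_unit //; exact: transvection_unipotent.
  apply: block_lower_mul => i c e ci ie; rewrite !mxE.
    rewrite /t; case: tpermP => [ca|cb|/eqP ca /eqP cb].
    - have -> : (b == e) = false by apply/eqP => be; apply: (ninD i); move: ci ie; rewrite ca -be; lia.
      by [].
    - by rewrite (_ : (a == e) = false) //; apply/negbTE; rewrite -(inj_eq val_inj) /=; move: ci ie; rewrite cb; lia.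
    - by rewrite (_ : (c == e) = false) //; apply/negbTE; rewrite -(inj_eq val_inj) /=; lia.
  rewrite (_ : (c == e) = false) ?add0r; last by apply/negbTE; rewrite -(inj_eq val_inj) /=; lia.
  case: andP => [[/eqP ca /eqP eb']|_]; last by rewrite mulr0.
  by case: (ninD i); move: ci ie; rewrite ca eb'; lia.
have := wmin _ Pt; rewrite leqNgt => /negP; apply.
have {2}-> : w = (tperm a b * (t * w))%g by rewrite mulgA /t tperm2 mul1g.
by apply: length_tperm => //; rewrite !permM /t tpermL tpermR.
Qed.

Lemma corner_compl w i j : (i <= n)%N ->
  (#|[pred l : 'I_n | (l < i)%N && (w l < j)%N]| + corner w i j = i)%N.
Proof.
move=> lein; rewrite cornerE -sum1_card big_mkcond /= -big_split /=.
rewrite -[RHS]card_ord -sum1_card (big_ord_widen n (fun=> 1%N) lein) [RHS]big_mkcond /=.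
by apply: eq_bigr => l _; rewrite inE; case: (ltnP l i) => _ //=; case: (ltnP (w l) j).
Qed.

Lemma schubert_cellP w E A : adapted (A *m g0) E -> A \in unitmx ->
  schubert_cell w (rowspan g0) E <->
  forall i j, (j <= n)%N -> corner_rank A (d i) j = corner w (d i) j.
Proof.
move=> /adaptedP[_ EA] uA; split=> h i j jn.
  have := dim_cap_rowspan j uA ug0 (d_le i); rewrite -EA (h i j jn) => e1.
  by apply: (@addnI #|[pred l : 'I_n | (l < d i)%N && (w l < j)%N]|); rewrite e1 corner_compl.
have := dim_cap_rowspan j uA ug0 (d_le i); rewrite -EA (h i j jn) => e1.
by apply: (@addIn (corner w (d i) j)); rewrite e1 corner_compl.
Qed.

End Lifts.

(** * Leading minors and semicontinuity of rank *)

Section CornerMull.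
Variables (K : numFieldType) (n del : nat).
Implicit Types (L M : 'M[K]_n).

Lemma corner_mullE M (i j : 'I_n) : corner_mull del M i j =
  if (i < del)%N && (j < del)%N then M i j else ((del <= i)%N && (i == j))%:R.
Proof.
rewrite mxE maskr maskl !mxE /=; case: (ltnP i del) => hi; case: (ltnP j del) => hj /=;
  rewrite ?mul0rn ?mul1r ?mulr1 ?addr0 ?mul0r ?mulr0 ?add0r //.
all: by case: eqP.
Qed.

Lemma corner_mull1 : corner_mull del 1%:M = 1%:M :> 'M[K]_n.
Proof.
apply/matrixP => i j; rewrite corner_mullE !mxE.
by case: (ltnP i del) => hi; case: (ltnP j del) => hj //=; case: eqP => // e; move: hj; rewrite -e leqNgt hi.
Qed.

Lemma corner_mullM L M : (forall a b : 'I_n, (a < del)%N -> (del <= b)%N -> L a b = 0) ->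
  corner_mull del (L *m M) = corner_mull del L *m corner_mull del M.
Proof.
move=> L0; apply/matrixP => i j; rewrite corner_mullE [RHS]mxE.
have [hi|hi] := ltnP i del; rewrite /=.
  have [hj|hj] := ltnP j del.
    rewrite mxE; apply: eq_bigr => k _; rewrite !corner_mullE hi hj.
    by have [hk|hk] := ltnP k del; rewrite /= ?andbT // L0 // leqNgt hi !mul0r.
  rewrite big1 // => k _; rewrite !corner_mullE hi.
  have [hk|hk] := ltnP k del; last by rewrite /= leqNgt hi mul0r.
  by rewrite ltnNge hj /= mulr0.
rewrite (bigD1 i) //= big1 => [|k ki]; rewrite !corner_mullE ltnNge hi /=.
  by rewrite eqxx mul1r addr0.
by rewrite eq_sym (negbTE ki) mul0r.
Qed.

Lemma det_corner_mull_neq0 L : L \in unitmx ->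
  (forall a b : 'I_n, (a < del)%N -> (del <= b)%N -> L a b = 0) ->
  \det (corner_mull del L) != 0.
Proof.
move=> uL L0; apply/eqP => d0.
have := congr1 (fun M => \det M) (corner_mullM (invmx L) L0).
rewrite mulmxV // corner_mull1 det1 det_mulmx d0 mul0r => /eqP; rewrite oner_eq0 //.
Qed.

Lemma unipotentM (u u' : 'M[K]_n) : unipotent u -> unipotent u' -> unipotent (u *m u').
Proof.
move=> hu hu' c e ec; rewrite mxE.
have [->|ce] := eqVneq c e.
  rewrite (bigD1 e) //= hu // hu' // eqxx mul1r big1 ?addr0 // => k ke.
  have [ke'|ek] := ltnP k e; first by rewrite hu ?(ltnW ke') // eq_sym (negbTE ke) mul0r.
  by rewrite hu' // (negbTE ke) mulr0.
have lt : (e < c)%N by rewrite ltn_neqAle ec andbT eq_sym (inj_eq val_inj).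
rewrite big1 // => k _; have [kc|ck] := ltnP k c.
  rewrite hu ?(ltnW kc) // (_ : (c == k) = false) ?mul0r //.
  by apply/negbTE; rewrite -(inj_eq val_inj) /= gtn_eqF.
have ek : (e < k)%N by apply: leq_trans ck.
rewrite hu' ?(ltnW ek) // (_ : (k == e) = false) ?mulr0 //.
by apply/negbTE; rewrite -(inj_eq val_inj) /= gtn_eqF.
Qed.

(** If the leading minor of [M] is nonzero, an invertible factor makes its first [del] rows
    unipotent, and the lower bound from the chart of [v] applies. *)
Lemma corner_rank_minor v x M j : unipotent x -> \det (corner_mull del M) != 0 ->
  (corner v del j <= corner_rank (M *m (x *m perm_mx v)) del j)%N.
Proof.
move=> ux C0; set C := corner_mull del M in C0.
have uC : C \in unitmx by rewrite unitmxE unitfE.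
have topC : top K n del *m C = C *m top K n del.
  apply/matrixP => i k; rewrite maskl maskr !corner_mullE.
  case: (ltnP i del) => hi; case: (ltnP k del) => hk; rewrite /= ?mul1r ?mul0r ?mulr1 ?mulr0 //.
  by case: (i =P k) => // e; move: hi hk; rewrite e; lia.
have topCi : top K n del *m invmx C = invmx C *m top K n del.
  by rewrite -[LHS](mulKmx uC) (mulmxA C) -topC -mulmxA mulmxV // mulmx1.
pose Y := invmx C *m (top K n del *m M).
have topY : top K n del *m Y = Y.
  by rewrite /Y mulmxA topCi -!mulmxA (mulmxA (top K n del) (top K n del)) maskM;
    congr (_ *m (_ *m _)); apply: eq_mask => l; rewrite andbb.
have Ytop : Y *m top K n del = top K n del.
  have topMtop : top K n del *m M *m top K n del = top K n del *m C.
    apply/matrixP => i k; rewrite maskr maskl [RHS]maskl corner_mullE.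
    by case: (ltnP i del); case: (ltnP k del); rewrite /= ?mul1r ?mul0r ?mulr1 ?mulr0.
  by rewrite /Y -mulmxA topMtop topC mulKmx.
have uy : unipotent (Y + mask K (predC (fun l : 'I_n => (l < del)%N))).
  move=> c e ec; rewrite [LHS]mxE [X in _ + X]mxE [in X in _ + X]mxE /=.
  have [cd|dc] := ltnP c del.
    have ed : (e < del)%N by apply: leq_ltn_trans ec cd.
    rewrite mul0rn addr0; have := congr1 (fun X : 'M_n => X c e) Ytop.
    by rewrite maskr ed mulr1 => ->; rewrite !mxE cd; case: eqP.
  have -> : Y c e = 0 by rewrite -topY maskl ltnNge dc mul0r.
  by rewrite add0r; case: eqP.
apply: leq_trans (corner_rank_unipotent v del j (unipotentM uy ux)) _.
rewrite /corner_rank -/(top K n del).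
have topZ : top K n del *m (Y + mask K (predC (fun l : 'I_n => (l < del)%N))) = Y.
  rewrite mulmxDr topY maskM (_ : mask _ _ = 0) ?addr0 //.
  by apply/matrixP => c e; rewrite !mxE /= andbN mul0rn.
rewrite -(mulmxA _ x (perm_mx v)) (mulmxA (top K n del)) topZ.
have -> : Y *m (x *m perm_mx v) = invmx C *m (top K n del *m (M *m (x *m perm_mx v))).
  by rewrite /Y -!mulmxA.
by rewrite -(mulmxA (invmx C)) mxrankM_maxr.
Qed.

End CornerMull.

Section SchubertVarieties.
Variables (K : numClosedFieldType) (n m : nat) (d : 'I_m -> nat).
Hypothesis d_range : forall i, (0 < d i < n)%N.
Hypothesis d_incr : forall i j : 'I_m, (i < j)%N -> (d i < d j)%N.
Implicit Types (E : flag K n d) (g h L A x y u : 'M[K]_n) (v w : 'S_n).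
Variable g0 : 'M[K]_n.
Hypothesis ug0 : g0 \in unitmx.

Let unit_xw w x : cell_mx w x -> x *m perm_mx w \in unitmx.
Proof. by move=> cx; rewrite unitmx_mul unitmx_perm andbT unipotent_unit //; exact: cell_unipotent cx. Qed.

Lemma mx_lim_id g : mx_lim (nbhs g) id g.
Proof. by move=> i j; exact: (@coord_continuous K n n i j g). Qed.

(** Adapted bases of one flag differ by a block lower factor with nonzero leading minor, so the
    condition depends on the flag only; it is open because determinants are continuous. *)
Lemma minor_open (B : 'M[K]_n) i :
  open [set E : flag K n d | forall h, adapted h E -> \det (corner_mull (d i) (h *m B)) != 0].
Proof.
suff : flag_open [set E : flag K n d | forall h, adapted h E ->
  \det (corner_mull (d i) (h *m B)) != 0] by [].
move=> g E gE /(_ g gE) Ng.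
have lim : mx_lim (nbhs g) (fun h => corner_mull (d i) (h *m B)) (corner_mull (d i) (g *m B)).
  apply: mx_limD; last exact: mx_lim_cst.
  apply: mx_limM; last exact: mx_lim_cst.
  apply: mx_limM; first exact: mx_lim_cst.
  by apply: mx_limM; [exact: mx_lim_id | exact: mx_lim_cst].
apply: filterS (cvg_neq0 (cvg_det lim) Ng) => h Nh E' hE' h' h'E'.
have bL := adapted_change hE' h'E'.
have /adaptedP[uh _] := hE'; have /adaptedP[uh' _] := h'E'.
have -> : h' *m B = (h' *m invmx h) *m (h *m B) by rewrite !mulmxA mulmxKV.
rewrite corner_mullM ?det_mulmx ?mulf_neq0 //; last by move=> a b; exact: bL.
by apply: det_corner_mull_neq0; [rewrite unitmx_mul uh' unitmx_inv | move=> a b; exact: bL].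
Qed.

(** The neighbourhood of [E] where a leading minor relative to its basis is nonzero contains a flag
    of the open cell, to which semicontinuity applies. *)
Lemma schubert_variety_corner w0 w x E : schubert_variety w0 (rowspan g0) E ->
  cell_mx w x -> adapted (x *m perm_mx w *m g0) E ->
  forall i j, (j <= n)%N -> (corner w (d i) j <= corner w0 (d i) j)%N.
Proof.
move=> clE cx xE i j jn; set A := x *m perm_mx w in xE *.
have uA : A \in unitmx by exact: unit_xw.
have uAg : A *m g0 \in unitmx by rewrite unitmx_mul uA.
pose U := [set E : flag K n d | forall h, adapted h E ->
  \det (corner_mull (d i) (h *m invmx (A *m g0))) != 0].
have UE : nbhs E U.
  apply: open_nbhs_nbhs; split; first exact: minor_open.
  move=> h hE; have bL := adapted_change xE hE.
  apply: det_corner_mull_neq0 => [|a b]; last exact: bL.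
  by have /adaptedP[uh _] := hE; rewrite unitmx_mul uh unitmx_inv.
have [E' [cE' UE']] := clE U UE.
have [h hE'] := exists_adapted d_range E'.
have /adaptedP[uh _] := hE'; have Nh := UE' h hE'.
have uM : h *m invmx g0 \in unitmx by rewrite unitmx_mul uh unitmx_inv.
have hE'' : adapted (h *m invmx g0 *m g0) E' by rewrite mulmxKV.
have := (schubert_cellP d_range ug0 w0 hE'' uM).1 cE' i j jn => <-.
have -> : h *m invmx g0 = (h *m invmx (A *m g0)) *m (x *m perm_mx w).
  rewrite -/A; apply: (can_inj (mulmxK ug0)).
  by rewrite mulmxKV // -(mulmxA _ A g0) mulmxKV.
exact: corner_rank_minor (cell_unipotent cx) Nh.
Qed.

Let corner_big w i j : (n <= i)%N -> corner w i j = corner w n j.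
Proof.
move=> ni; rewrite !cornerE; apply: eq_bigr => l _.
by rewrite (ltn_ord l) (leq_trans (ltn_ord l) ni).
Qed.

Let corner_big0 w i j : (n <= j)%N -> corner w i j = 0%N.
Proof.
move=> nj; rewrite cornerE big1 // => l _.
by rewrite [(j <= _)%N]leqNgt (leq_trans (ltn_ord _) nj) andbF.
Qed.

Lemma corner_le_in_Id v w : in_Id d v ->
  (forall i j, (j <= n)%N -> (corner v (d i) j <= corner w (d i) j)%N) ->
  forall i j, (corner v i j <= corner w i j)%N.
Proof.
move=> vI le i j; wlog lein : i / (i <= n)%N.
  move=> h; have [|ni] := leqP i n; first exact: h.
  by rewrite !(corner_big _ _ (ltnW ni)) h.
apply: (@corner_le_blocks n [pred k | [exists i, d i == k]]) => //.
  move=> a b eb nD; apply: (in_Id_lt vI); first by rewrite eb.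
  apply/flag_posP => -[k hk]; case/negP: nD; apply/existsP; exists k.
  by apply/eqP; lia.
move=> k l /existsP[k' /eqP <-]; have [ln|nl] := leqP l n; first exact: le.
by rewrite !corner_big0 // ltnW.
Qed.

Lemma cell_in_schubert_cell w x E : cell_mx w x -> adapted (x *m perm_mx w *m g0) E ->
  schubert_cell w (rowspan g0) E.
Proof.
move=> cx xE; apply/(schubert_cellP d_range ug0 w xE (unit_xw cx)) => i j _.
apply/eqP; rewrite eqn_leq corner_rank_cell //=; exact: corner_rank_unipotent (cell_unipotent cx).
Qed.

Lemma schubert_variety_length w0 w x E : in_Id d w -> cell_mx w x ->
  adapted (x *m perm_mx w *m g0) E -> schubert_variety w0 (rowspan g0) E ->
  (perm_length w <= perm_length w0)%N /\ (perm_length w = perm_length w0 -> w = w0).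
Proof.
move=> wI cx xE clE; have le := corner_le_in_Id wI (schubert_variety_corner clE cx xE).
by have [h1 h2 _] := bruhat_length le; split.
Qed.

(** In a chart centred in the cell, the closure meets no other cell: being in the closure bounds the
    counts by those of [w0] from above, and being in the chart bounds them from below. *)
Lemma schubert_variety_trace w0 x u : in_Id d w0 -> cell_mx w0 x ->
  (forall a b, (a, b) \notin flag_pos n d -> u a b = (a == b)%:R) ->
  (exists2 E : flag K n d, schubert_variety w0 (rowspan g0) E & adapted (u *m (x *m perm_mx w0 *m g0)) E) <->
  cell_mx w0 (u *m x).
Proof.
move=> wI cx hu.
have posltn (a b : 'I_n) : (a, b) \in flag_pos n d -> (a < b)%N.
  by move/flag_posP => [i]; lia.
have uu : unipotent u.
  by move=> a b ba; apply: hu; apply: contraL ba => /posltn; rewrite -ltnNge.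
have uux := unipotentM uu (cell_unipotent cx).
split=> [[E clE uE]|cux]; last first.
  have [|E uE] := exists_flag d_range d_incr (g := u *m (x *m perm_mx w0 *m g0)).
    by rewrite unitmx_mul (unipotent_unit uu) unitmx_mul unit_xw.
  exists E => //; apply: subset_closure; apply: (cell_in_schubert_cell cux).
  by move: uE; rewrite !mulmxA.
have [w [x' [wI' cx' xE']]] := flag_lift d_range ug0 E.
have uE' : adapted (u *m x *m perm_mx w0 *m g0) E by move: uE; rewrite !mulmxA.
have le1 := corner_le_in_Id wI' (schubert_variety_corner clE cx' xE').
pose L := u *m x *m perm_mx w0 *m g0 *m invmx (x' *m perm_mx w *m g0).
have bL : block_lower d L by exact: adapted_change xE' uE'.
have ux' : x' *m perm_mx w *m g0 \in unitmx by rewrite unitmx_mul unit_xw.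
have eL : u *m x *m perm_mx w0 = L *m (x' *m perm_mx w).
  by apply: (can_inj (mulmxK ug0)); rewrite -(mulmxA L) mulmxKV.
have le2 : forall i j, (corner w0 i j <= corner w i j)%N.
  apply: (corner_le_in_Id wI) => i j _.
  by apply: (@corner_le_of_cells K n w0 w x' (u *m x) L (d i) j cx' uux _ eL) => a b; exact: bL.
have ww : w = w0 by apply: corner_inj => i j; apply/eqP; rewrite eqn_leq le1 le2.
subst w; move: eL; rewrite mulmxA => /(can_inj (mulmxK (unitmx_perm _ w0))) eL.
rewrite (block_lower_unipotent_eq bL _ (cell_flag_pos wI cx') eL) // => a b npos.
have [->|ab] := eqVneq a b; first by rewrite uux // eqxx.
pose P := fun a b : 'I_n => (a == b) || ((a, b) \in flag_pos n d).
have sP (y : 'M[K]_n) : (forall a b, (a, b) \notin flag_pos n d -> y a b = (a == b)%:R) ->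
    supported P y.
  by move=> hy i j; rewrite negb_or => /andP[/negbTE ij /hy->]; rewrite ij.
have Pt : transitive P.
  move=> j i k; rewrite /P; case: eqP => [->//|_] /=.
  case: eqP => [->->|_ /=]; first by rewrite orbT.
  move=> /flag_posP[l /andP[il lj]] /posltn jk; apply/orP; right; apply/flag_posP; exists l; lia.
apply: (supported_mul Pt (sP _ hu) (sP _ (cell_flag_pos wI cx))).
by rewrite /P (negbTE ab) (negbTE npos).
Qed.

End SchubertVarieties.

(** * Transversality *)

Section Smoothness.
Variables (K : numClosedFieldType) (N : nat).
Implicit Types (X : set 'rV[K]_N) (T : {vspace 'rV[K]_N}).

Lemma differentiable_coord_form (k : 'I_N) (u : 'rV[K]_N) :
  differentiable (fun v : 'rV[K]_N => v 0 k : K^o) u.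
Proof. exact: differentiable_coord. Qed.

Lemma diff_coord_form (k : 'I_N) (u h : 'rV[K]_N) :
  'd (fun v : 'rV[K]_N => v 0 k : K^o) u h = h 0 k.
Proof.
pose f : 'rV[K]_N -> K^o := fun v => v 0 k.
have lf : linear f by move=> a x y; rewrite /f !mxE.
pose f' := GRing.isLinear.Build _ _ _ _ f lf.
pose g : {linear 'rV[K]_N -> K^o} := HB.pack f f'.
rewrite (_ : (fun v => _) = g) // diff_lin //.
exact: coord_continuous.
Qed.

Lemma smooth_at_coords X T (S : pred 'I_N) :
  (forall v, X v <-> forall k, ~~ S k -> v 0 k = 0) ->
  (forall h, h \in T <-> forall k, ~~ S k -> h 0 k = 0) ->
  smooth_at X 0 T.
Proof.
move=> XE TE; pose c := #|[pred k | ~~ S k]|.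
pose e (j : 'I_c) : 'I_N := enum_val j.
have eS j : ~~ S (e j) by have := enum_valP j; rewrite inE.
have eP (P : 'I_N -> Prop) : (forall j, P (e j)) <-> (forall k, ~~ S k -> P k).
  split=> [h k Sk|h j]; last exact: h.
  by have kin : k \in [pred k | ~~ S k] by []; rewrite -(enum_rankK_in kin kin); exact: h.
exists c, (fun j v => v 0 (e j)); split.
- by move=> j; apply: (@filterE _ (nbhs (0 : 'rV[K]_N))) => u; exact: differentiable_coord_form.
- by apply: (@filterE _ (nbhs (0 : 'rV[K]_N))) => u; rewrite XE (eP (fun k => u 0 k = 0)).
- move=> a h j; have := h (delta_mx 0 (e j)); rewrite (bigD1 j) //= big1 => [|i ij].
    by rewrite diff_coord_form mxE !eqxx mulr1 addr0.
  by rewrite diff_coord_form mxE (inj_eq enum_val_inj) (negbTE ij) andbF mulr0.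
- move=> h; rewrite TE -(eP (fun k => h 0 k = 0)).
  by split=> hk j; have := hk j; rewrite diff_coord_form.
Qed.

Section DetAffine.
Variables (n : nat) (M : 'M[K]_n) (L : {linear 'rV[K]_N -> 'M[K]_n}).
Let f (v : 'rV[K]_N) : K^o := \det (M + L v).

Lemma det_affine_differentiable u : differentiable f u.
Proof.
have entry i j : differentiable (fun v => (M + L v) i j : K^o) u.
  rewrite (_ : (fun v => _) = cst (M i j : K^o) +
      \sum_(k < N) (fun v : 'rV[K]_N => v 0 k *: (L (delta_mx 0 k) i j : K^o))); last first.
    apply/funext => v; rewrite mxE {1}[v]row_sum_delta linear_sum summxE fct_sumE /=.
    by congr (_ + _); apply: eq_bigr => k _; rewrite linearZ mxE.
  apply: differentiableD => //; apply: differentiable_sum => k.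
  by apply: differentiableZl; exact: differentiable_coord_form.
have prod (s : 'S_n) : differentiable (fun v => \prod_i (M + L v) i (s i) : K^o) u.
  rewrite (_ : (fun v => _) = \prod_i (fun v => (M + L v) i (s i) : K^o)); last first.
    by apply/funext => v; rewrite fct_prodE.
  elim/big_ind: _ => // a b da db.
  exact: differentiableM.
rewrite (_ : f = \sum_(s : 'S_n) (fun v => (-1) ^+ s * \prod_i (M + L v) i (s i) : K^o)); last first.
  by apply/funext => v; rewrite fct_sumE.
elim/big_ind: _ => // [x y dx dy|s _]; first exact: differentiableD.
exact: (differentiableM (@differentiable_cst _ _ _ ((-1) ^+ s : K^o) u) (prod s)).
Qed.

(** By [detB_slope] the difference quotient is exactly [det_slope (M + t *: L h) M (L h)], whose
    limit is immediate. *)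
Lemma det_affine_diff h : 'd f 0 h = det_slope M M (L h).
Proof.
rewrite -deriveE; last exact: det_affine_differentiable.
apply: (@cvg_lim K^o) => //.
have lim : mx_lim (0 : K)^' (fun t => M + t *: L h) M.
  rewrite -[X in mx_lim _ _ X]addr0 -(scale0r (L h)); apply: mx_limD; first exact: mx_lim_cst.
  by apply: mx_limZ; [exact: nbhs_dnbhs | exact: mx_lim_cst].
have : det_slope (M + t *: L h) M (L h) @[t --> (0 : K)^'] --> det_slope M M (L h).
  by apply: cvg_det_slope => //; exact: mx_lim_cst.
apply: cvg_trans; apply: near_eq_cvg; near=> t.
have t0 : t != 0 by near: t; exact: nbhs_dnbhs_neq.
rewrite /= addr0 /f linear0 addr0 linearZ /= detB_slope addrAC subrr add0r det_slopeZ.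
by rewrite /GRing.scale /= mulKf.
Unshelve. all: by end_near. Qed.

Lemma smooth_at_det X T : (forall v, X v <-> \det (M + L v) = 0) ->
  (exists h, det_slope M M (L h) != 0) ->
  (forall h, h \in T <-> det_slope M M (L h) = 0) -> smooth_at X 0 T.
Proof.
move=> XE [h0 nz] TE; exists 1%N, (fun _ => f); split.
- by move=> _; apply: (@filterE _ (nbhs (0 : 'rV[K]_N))) => u; exact: det_affine_differentiable.
- by apply: (@filterE _ (nbhs (0 : 'rV[K]_N))) => u; rewrite XE; split=> [e _ //|/(_ ord0)].
- move=> a /(_ h0); rewrite big_ord1 det_affine_diff => /eqP.
  by rewrite mulf_eq0 (negbTE nz) orbF => /eqP e k; rewrite (ord1 k).
- by move=> h; rewrite TE det_affine_diff; split=> [e _ //|/(_ ord0)].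
Qed.

End DetAffine.
End Smoothness.

Section Codimension.
Variables (K : numFieldType) (V : vectType K).

Lemma codim_bigcap_le (I : finType) (T : I -> {vspace V}) (P : pred I) :
  (\dim {:V} - \dim (\bigcap_(a | P a) T a)%VS <= \sum_(a | P a) (\dim {:V} - \dim (T a)))%N.
Proof.
elim/big_rec2: _ => [|a k U _ le]; first by rewrite subnn.
have := dimv_sum_cap (T a) U; have := dimvS (subvf (T a + U)).
have := dimvS (subvf (T a)); have := dimvS (subvf U).
by lia.
Qed.

Lemma codim_lker_le1 (f : 'Hom(V, K^o)) : (\dim {:V} - \dim (lker f) <= 1)%N.
Proof.
have := limg_ker_dim f fullv; rewrite capfv => <-; rewrite addKn.
by have := dimvS (subvf (limg f)); rewrite dimvf.
Qed.

Lemma sum_le1_eq (I : finType) (c : I -> nat) : (forall k, (c k <= 1)%N) ->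
  (\sum_k c k)%N = #|I| -> forall k, c k = 1%N.
Proof.
move=> c1 sumc k; apply/eqP; rewrite eqn_leq c1 lt0n; apply/negP => /eqP ck.
have : (\sum_(l | l != k) c l <= #|predC1 k|)%N by rewrite -sum1_card leq_sum.
move: sumc; rewrite (bigD1 k) //= ck add0n (cardD1 k) => ->.
by rewrite inE add1n (eq_card (B := predC1 k)) ?ltnn // => l; rewrite !inE andbT.
Qed.

End Codimension.

Section CoordinateSpaces.
Variables (K : numFieldType) (N : nat) (S : pred 'I_N).

Definition coord_space : {vspace 'rV[K]_N} := lker (linfun (mulmxr (mask K (predC S)))).

Lemma mem_coord_space h : h \in coord_space <-> forall k, ~~ S k -> h 0 k = 0.
Proof.
rewrite memv_ker lfunE /=; split=> [/eqP e k Sk|h0].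
  by have /rowP/(_ k) := e; rewrite maskr /= Sk mulr1 mxE.
apply/eqP/rowP => k; rewrite maskr mxE /=.
by have [Sk|/h0->] := boolP (S k); rewrite ?mulr0 ?mul0r.
Qed.

Lemma dim_coord_space : \dim coord_space = #|S|.
Proof.
rewrite -(rank_mask K S); apply: dim_vspace_mx => u; rewrite memv_ker lfunE /=.
apply/eqP/submxP => [u0|[c ->]].
  by exists u; rewrite -[LHS]mulmx1 (maskC K S) mulmxDr u0 addr0.
rewrite -mulmxA maskM (_ : mask K _ = 0) ?mulmx0 //.
by apply/matrixP => i j; rewrite !mxE /= andbN mul0rn.
Qed.

End CoordinateSpaces.

Section ChartDirections.
Variables (K : numFieldType) (n m : nat) (d : 'I_m -> nat).

Definition chart_dir (v : 'rV[K]_(flag_dim n d)) : 'M[K]_n :=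
  \sum_k v 0 k *: delta_mx (enum_val k).1 (enum_val k).2.

Lemma chart_dir_is_linear : linear chart_dir.
Proof.
move=> a u v; rewrite /chart_dir scaler_sumr -big_split; apply: eq_bigr => k _.
by rewrite !mxE scalerDl scalerA.
Qed.

HB.instance Definition _ := GRing.isLinear.Build _ _ _ _ chart_dir chart_dir_is_linear.

Lemma chart_dirE v k : chart_dir v (enum_val k).1 (enum_val k).2 = v 0 k.
Proof.
rewrite summxE (bigD1 k) //= big1 => [|l lk].
  by rewrite !mxE !eqxx mulr1 addr0.
have /negbTE : enum_val k != enum_val l by rewrite (inj_eq enum_val_inj) eq_sym.
by rewrite !mxE -[_ && _]/(enum_val k == enum_val l) => ->; rewrite mulr0.
Qed.

Lemma chart_dir0 v a b : (a, b) \notin flag_pos n d -> chart_dir v a b = 0.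
Proof.
move=> npos; rewrite summxE big1 // => k _; rewrite !mxE.
have : (a, b) != enum_val k by apply: contraNneq npos => ->; exact: enum_valP.
by rewrite -[_ && _]/((a, b) == enum_val k) => /negbTE->; rewrite mulr0.
Qed.

Lemma chart_dir_supported (P : rel 'I_n) v :
  (forall a b, P a b -> (a, b) \in flag_pos n d) ->
  supported P (chart_dir v) <-> forall k, ~~ P (enum_val k).1 (enum_val k).2 -> v 0 k = 0.
Proof.
move=> Ppos; split=> [sv k nP|v0 a b nP]; first by rewrite -chart_dirE sv.
have [pos|] := boolP ((a, b) \in flag_pos n d); last exact: chart_dir0.
by have := chart_dirE v (enum_rank_in pos (a, b)); rewrite enum_rankK_in //= => ->;
  apply: v0; rewrite enum_rankK_in.
Qed.

End ChartDirections.

(** * Transversality by counting codimensions *)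

Section Transversality.
Variables (K : numClosedFieldType) (n m : nat) (d : 'I_m -> nat).
Hypothesis d_range : forall i, (0 < d i < n)%N.
Hypothesis d_incr : forall i j : 'I_m, (i < j)%N -> (d i < d j)%N.
Variables (g0 : 'M[K]_n) (w0 : 'S_n).
Hypotheses (ug0 : g0 \in unitmx) (w0_Id : in_Id d w0).
Variables (r : nat) (i : 'I_r -> 'I_m) (s : 'I_r -> K).
Hypothesis r_def : r = perm_length w0.
Let sigma := codom (fun k => (d (i k), s k)).
Hypothesis good_sigma : @good K n sigma.
Implicit Types (E : flag K n d) (x A : 'M[K]_n).

Definition schubert_conditions (a : option 'I_r) : set (flag K n d) :=
  if a is Some k then simple_schubert (i k) (rowspan (osc_mx n 0 (s k) *m g0))
  else schubert_variety w0 (rowspan g0).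

Lemma simple_schubert_det E A j t : A \in unitmx -> adapted (A *m g0) E ->
  simple_schubert j (rowspan (osc_mx n 0 t *m g0)) E <-> \det (incidence (d j) t A) = 0.
Proof.
move=> uA /adaptedP[_ EA].
rewrite /simple_schubert /= EA; split=> [|e]; first by rewrite rowspan_osc_cap // => /eqP.
by rewrite rowspan_osc_cap // e.
Qed.

Let cell_unit w x : cell_mx w x -> x *m perm_mx w \in unitmx.
Proof. by move=> cx; rewrite unitmx_mul unitmx_perm andbT unipotent_unit //; exact: cell_unipotent cx. Qed.

Lemma schubert_conditions_cell E : (forall a, schubert_conditions a E) ->
  exists x, [/\ cell_mx w0 x, adapted (x *m perm_mx w0 *m g0) E,
    conj_mx x = x, meets sigma (x *m perm_mx w0) &
    forall h, supported (inversion w0) h ->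
      tangent sigma (x *m perm_mx w0) (h *m perm_mx w0) -> h = 0].
Proof.
move=> XE; have [w [x [wI cx xE]]] := flag_lift d_range ug0 E.
have [le eqw] := schubert_variety_length d_range ug0 wI cx xE (XE None).
have mx : meets sigma (x *m perm_mx w).
  move=> c /codomP[k ->] /=; apply/(simple_schubert_det _ _ (cell_unit cx) xE).
  exact: XE (Some k).
have [ge tg] := good_sigma cx mx.
have sz : size sigma = r by rewrite size_codom card_ord.
have lw : perm_length w = perm_length w0.
  by apply/eqP; rewrite eqn_leq le -r_def -sz.
have ww := eqw lw; subst w; have [|rx nd] := tg; first by rewrite sz.
by exists x; split.
Qed.

Section Chart.
Variable x : 'M[K]_n.
Hypotheses (cx : cell_mx w0 x)
  (nondeg : forall h, supported (inversion w0) h ->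
      tangent sigma (x *m perm_mx w0) (h *m perm_mx w0) -> h = 0).
Let g := x *m perm_mx w0 *m g0.
Let A := x *m perm_mx w0.

Let ux : x \in unitmx. Proof. exact: unipotent_unit (cell_unipotent cx). Qed.

Let inv_pos a b : inversion w0 a b -> (a, b) \in flag_pos n d.
Proof. exact: in_Id_inversion. Qed.

Let chart_unip (v : 'rV[K]_(flag_dim n d)) a b : (a, b) \notin flag_pos n d ->
  chart_mx v a b = (a == b)%:R.
Proof. by move=> npos; rewrite mxE [X in _ + X]chart_dir0 // mxE addr0. Qed.

Let chart_unit (v : 'rV[K]_(flag_dim n d)) : chart_mx v \in unitmx.
Proof.
apply: unipotent_unit => a b ba; apply: chart_unip; apply/flag_posP => -[j].
by lia.
Qed.

(** Inversions together with the diagonal form a transitive relation, so multiplication by [x] and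
    by its inverse preserves the support. In the chart centred at [x], the cell is therefore a
    coordinate subspace. *)
Lemma supported_inversion_mulr (h : 'M[K]_n) :
  supported (inversion w0) (h *m x) <-> supported (inversion w0) h.
Proof.
have tr a b c : inversion w0 a b -> weak_inversion w0 b c -> inversion w0 a c.
  move=> ab /orP[/eqP<-//|]; move: ab; rewrite /inversion; lia.
have sx := cell_supported cx.
split=> sh; last exact: supported_mulP tr sh sx.
rewrite -[h](mulmxK ux); apply: (supported_mulP tr sh).
by apply: supported_inv => //; [exact: weak_inversion_refl | exact: weak_inversion_trans].
Qed.

Let S (k : 'I_(flag_dim n d)) := inversion w0 (enum_val k).1 (enum_val k).2.

Lemma schubert_variety_smooth :
  smooth_at (chart_set g (schubert_variety w0 (rowspan g0))) 0 (coord_space K S).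
Proof.
apply: (smooth_at_coords (S := S)) => [v|h]; last exact: mem_coord_space.
apply: (iff_trans (schubert_variety_trace d_range d_incr ug0 w0_Id cx (@chart_unip v))).
rewrite -(chart_dir_supported _ inv_pos) -supported_inversion_mulr.
rewrite mulmxDl mul1mx; split=> [cv a b nI|sv a b nI].
  by have := cv a b nI; rewrite mxE cx // -[RHS]addr0 => /addrI.
by rewrite mxE cx // [X in _ + X]sv // addr0.
Qed.

Lemma card_inversion_coords : #|S| = r.
Proof.
rewrite r_def -(card_imset (mem S) (@enum_val_inj _ (mem (flag_pos n d)))).
apply: eq_card => -[a b]; rewrite [RHS]inE; apply/imsetP/idP => [[k Sk e]|inv].
  by move: Sk; rewrite -topredE /= /S -e.
have pos : (a, b) \in flag_pos n d by exact: inv_pos.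
by exists (enum_rank_in pos (a, b)); rewrite -?topredE /= /S ?enum_rankK_in.
Qed.

Definition slope_dir k : 'rV[K]_(flag_dim n d) -> 'M[K]_n :=
  mulmx (top K n (d (i k))) \o mulmxr A \o @chart_dir K n m d.

HB.instance Definition _ k := GRing.Linear.on (slope_dir k).

Let M k := incidence (d (i k)) (s k) A.

Definition slope_form k (v : 'rV[K]_(flag_dim n d)) : K^o := det_slope (M k) (M k) (slope_dir k v).

Lemma slope_form_is_linear k : linear (slope_form k).
Proof.
by move=> a u v; rewrite /slope_form linearD linearZ /= -[slope_dir k v]scale1r det_slopeD scale1r mul1r.
Qed.

HB.instance Definition _ k := GRing.isLinear.Build _ _ _ _ (slope_form k) (slope_form_is_linear k).

Definition cell_tangent (a : option 'I_r) : {vspace 'rV[K]_(flag_dim n d)} :=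
  if a is Some k then lker (linfun (slope_form k)) else coord_space K S.

Let T := cell_tangent.

Let T_cap0 : (\bigcap_a T a)%VS = 0%VS.
Proof.
apply/eqP; rewrite -subv0; apply/subvP => h hT.
have hTa a : h \in T a by move/subvP: (bigcapv_inf (Us := T) a isT (subvv (T a))); apply.
have /mem_coord_space hS := hTa None.
have sh : supported (inversion w0) (chart_dir h *m x).
  by apply/supported_inversion_mulr/chart_dir_supported => //; exact: inv_pos.
have h0 : chart_dir h *m x = 0.
  apply: nondeg => // c /codomP[k ->] /=.
  have := hTa (Some k); rewrite memv_ker lfunE /= => /eqP.
  by rewrite /slope_form /slope_dir /= /A mulmxA.
rewrite memv0; apply/eqP/rowP => k; rewrite -chart_dirE.
by rewrite -[chart_dir h](mulmxK ux) h0 mul0mx !mxE.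
Qed.

(** The tangent spaces meet in 0, which has codimension [flag_dim n d]. The Schubert variety
    accounts for [flag_dim n d - r] of it and each of the [r] conditions for at most 1, so
    subadditivity forces equality throughout. *)
Lemma cell_tangent_codim :
  (flag_dim n d - \dim (\bigcap_a cell_tangent a)%VS)%N =
    (\sum_a (flag_dim n d - \dim (cell_tangent a)))%N /\
  forall k, (flag_dim n d - \dim (cell_tangent (Some k)))%N = 1%N.
Proof.
rewrite -/T; have dN : \dim {:'rV[K]_(flag_dim n d)} = flag_dim n d by rewrite dimvf /dim /= mul1n.
have := codim_bigcap_le T predT; rewrite !dN.
have le1 k : (flag_dim n d - \dim (T (Some k)) <= 1)%N.
  by have := codim_lker_le1 (linfun (slope_form k)); rewrite dN.
rewrite T_cap0 dimv0 subn0 (bigD1 None) //= dim_coord_space card_inversion_coords.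
have -> : (\sum_(a | a != None) (flag_dim n d - \dim (T a)) = \sum_k (flag_dim n d - \dim (T (Some k))))%N.
  by rewrite (reindex_omap Some id) //=; [apply: eq_bigl => k; rewrite eqxx | case].
have rN : (r <= flag_dim n d)%N.
  by rewrite -card_inversion_coords -[leqRHS]card_ord max_card.
have : (\sum_k (flag_dim n d - \dim (T (Some k))) <= r)%N.
  by rewrite -[leqRHS]card_ord -sum1_card leq_sum.
move=> sum_le le; have sumr : (\sum_k (flag_dim n d - \dim (T (Some k))) = r)%N.
  by lia.
split; first by lia.
by apply: sum_le1_eq => //; rewrite sumr card_ord.
Qed.

(** The local equation is the incidence determinant; its differential is nonzero because the kernel
    was counted to have codimension exactly one. *)
Lemma simple_schubert_smooth k :
  smooth_at (chart_set g (schubert_conditions (Some k))) 0 (lker (linfun (slope_form k))).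
Proof.
apply: (smooth_at_det (M := M k) (L := slope_dir k)) => [v||h].
- rewrite /chart_set /schubert_conditions /=.
  have -> : M k + slope_dir k v = incidence (d (i k)) (s k) (chart_mx v *m A).
    by rewrite /incidence /M /slope_dir /= mulmxDl mul1mx mulmxDr addrAC.
  have uvA : chart_mx v *m A \in unitmx by rewrite unitmx_mul chart_unit cell_unit.
  have det_iff E : adapted (chart_mx v *m g) E ->
      simple_schubert (i k) (rowspan (osc_mx n 0 (s k) *m g0)) E <->
      \det (incidence (d (i k)) (s k) (chart_mx v *m A)) = 0.
    by rewrite [chart_mx v *m g]mulmxA => aE; exact: (simple_schubert_det (i k) (s k) uvA aE).
  split=> [[E XE aE]|e]; first exact/(det_iff E aE).
  have [|E aE] := exists_flag d_range d_incr (g := chart_mx v *m g).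
    by rewrite unitmx_mul chart_unit unitmx_mul cell_unit.
  by exists E => //; apply/(det_iff E aE).
- apply: contrapT => /forallNP h0; have [_ /(_ k)] := cell_tangent_codim.
  have -> : cell_tangent (Some k) = fullv.
    apply/eqP; rewrite eqEsubv subvf; apply/subvP => h _.
    rewrite memv_ker lfunE /=; apply/negPn/negP; exact: h0.
  by rewrite dimvf /dim /= mul1n subnn.
- by rewrite memv_ker lfunE /=; split=> /eqP.
Qed.

End Chart.

Lemma schubert_conditions_transverse : transverse schubert_conditions.
Proof.
move=> E XE; have [x [cx xE _ _ nd]] := schubert_conditions_cell XE.
exists (x *m perm_mx w0 *m g0) => //.
exists (cell_tangent x); last by have [] := cell_tangent_codim cx nd.
by move=> [k|]; [exact: simple_schubert_smooth | exact: schubert_variety_smooth].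
Qed.

End Transversality.

From mathcomp Require Import lra complex.

(** * Complex and real flags *)

Section UltrafilterLimits.
Variables (R : realType) (T : Type) (F : set_system T).
Context {UF : UltraFilter F}.

(** A cluster point in a compact interval is a limit as soon as the filter is an ultrafilter. *)
Lemma real_ultra_cvg (f : T -> R) : (\forall t \near F, `|f t| <= 1) ->
  exists l : R, f t @[t --> F] --> l.
Proof.
move=> f1; have [l [_ cl]] : `[-1, 1]%classic `&` cluster (f t @[t --> F]) !=set0.
  apply: (@segment_compact R); apply: filterS f1 => t.
  by rewrite ler_norml /= in_itv.
exists l => U Ul; have [//|nU] := in_ultra_setVsetC (f @^-1` U) UF.
by have [z [nUz Uz]] := cl (~` U) U nU Ul.
Qed.

Lemma complex_ultra_cvg (f : T -> (R[i] : numClosedFieldType)) :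
  (\forall t \near F, `|f t| <= 1) ->
  exists l : (R[i] : numClosedFieldType), f t @[t --> F] --> l.
Proof.
move=> f1.
have norm_le (z : R[i]) : `|complex.Re z| <= 1 /\ `|complex.Im z| <= 1 \/ ~ `|z| <= 1.
  have [z1|] := pselect (`|z| <= 1); [left|by right].
  move: z1; rewrite normc_def -[1]/(1%:C)%C lecR => z1.
  have z2 : (complex.Re z) ^+ 2 + (complex.Im z) ^+ 2 <= 1.
    have s0 : 0 <= (complex.Re z) ^+ 2 + (complex.Im z) ^+ 2 by rewrite addr_ge0 ?sqr_ge0.
    by rewrite -(sqr_sqrtr s0); apply: exprn_ile1 => //; exact: sqrtr_ge0.
  by split; rewrite -(@expr_le1 _ 2) // real_normK ?num_real //; apply: le_trans z2;
    rewrite ?lerDl ?lerDr sqr_ge0.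
have [a al] : exists a : R, complex.Re (f t) @[t --> F] --> a.
  by apply: real_ultra_cvg; apply: filterS f1 => t h; have [[]|] := norm_le (f t).
have [b bl] : exists b : R, complex.Im (f t) @[t --> F] --> b.
  by apply: real_ultra_cvg; apply: filterS f1 => t h; have [[]|] := norm_le (f t).
exists (a +i* b)%C; apply/cvgrPdist_lt => e e0.
move: (e0); rewrite ltcE /= => /andP[/eqP Ie0 Re0].
have e2 : 0 < complex.Re e / 2 by rewrite divr_gt0.
move/cvgrPdist_lt : al => /(_ _ e2) ha; move/cvgrPdist_lt : bl => /(_ _ e2) hb.
apply: filterS2 ha hb => t ha hb.
have -> : e = (complex.Re e)%:C%C by rewrite [LHS]complexE Ie0 mulr0 addr0.
rewrite normc_def ltcR; set z := _ - _.
have -> : complex.Re z = a - complex.Re (f t) by rewrite /z; case: (f t).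
have -> : complex.Im z = b - complex.Im (f t) by rewrite /z; case: (f t).
rewrite -(@ltr_pXn2r _ 2) ?nnegrE ?sqrtr_ge0 // ?(ltW Re0) // sqr_sqrtr ?addr_ge0 ?sqr_ge0 //.
move: ha hb; rewrite !ltr_norml => /andP[a1 a2] /andP[b1 b2].
by nra.
Qed.

End UltrafilterLimits.

Section Complexification.
Variables (R : realType) (n : nat).
Implicit Types (X Y : seq 'rV[R]_n).

Let cplx : 'rV[R]_n -> 'rV[R[i]]_n := map_mx (real_complex R).

Lemma complexify_span_sub X Y : {subset X <= <<Y>>%VS} ->
  (<<map cplx X>> <= <<map cplx Y>>)%VS.
Proof.
move=> XY; apply/span_subvP => _ /mapP[u /XY uY ->].
rewrite (coord_span (X := in_tuple Y) uY) /cplx map_mx_sum; apply: memv_suml => k _.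
rewrite map_mxZ; apply: memvZ; apply: memv_span; apply: map_f; exact: mem_nth.
Qed.

(** Frees the complexification from the basis chosen in its definition. *)
Lemma complexify_span X : complexify <<X>>%VS = <<map cplx X>>%VS.
Proof.
apply/eqP; rewrite eqEsubv !complexify_span_sub //.
  by move=> u uX; rewrite (span_basis (vbasisP _)); exact: memv_span.
by move=> u; exact: vbasis_mem.
Qed.

Lemma rowspan_span (K : numFieldType) (g : 'M[K]_n) k :
  rowspan g k = <<[seq row a g | a : 'I_n <- index_enum _ & (a < k)%N]>>%VS.
Proof. by rewrite span_def big_map big_filter. Qed.

Lemma complexify_rowspan (g : 'M[R]_n) k :
  complexify (rowspan g k) = rowspan (map_mx (real_complex R) g) k.
Proof.
rewrite !rowspan_span complexify_span -map_comp; congr (<<_>>%VS).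
by apply: eq_map => a; exact: map_row.
Qed.

Lemma real_of_conj (x : 'M[R[i]]_n) : conj_mx x = x ->
  x = map_mx (real_complex R) (map_mx (@complex.Re R) x).
Proof.
move=> rx; apply/matrixP => a b; rewrite !mxE.
have := congr1 (fun M : 'M[R[i]]_n => complex.Im (M a b)) rx; rewrite mxE.
case: (x a b) => u v /= /eqP; rewrite -subr_eq0 -opprD oppr_eq0 -mulr2n mulrn_eq0 /=.
by move=> /eqP->.
Qed.

End Complexification.

Section OsculatingFlags.
Variables (R : realType) (n : nat) (p : n.-tuple {poly_n R}).

(** The change of basis from the monomial curve to the given one; it serves as reference basis
    [g0]. *)
Definition coef_mx : 'M[R]_n := \matrix_(j, k) (tnth p k)`_j.

Lemma coef_mx_unit : basis_of fullv p -> coef_mx \in unitmx.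
Proof.
move=> /basis_free /freeP fp; rewrite -unitmx_tr -row_free_unit.
apply/inj_row_free => c c0; apply/rowP => k; rewrite mxE; apply: fp.
apply/val_inj/polyP => j; rewrite raddf_sum /= coef_sum coef0.
have [jn|nj] := ltnP j n.
  have /rowP/(_ (Ordinal jn)) := c0; rewrite !mxE => e0; rewrite -[RHS]e0; apply: eq_bigr => l _.
  by rewrite !mxE /= coefZ (tnth_nth 0).
by apply: big1 => l _; rewrite /= coefZ big_coef_npoly ?mulr0.
Qed.

Lemma curve_derivE (l : 'I_n) (s : R[i]) :
  curve_deriv p l s = row l (osc_mx n 0 s *m map_mx (real_complex R) coef_mx).
Proof.
apply/rowP => k; rewrite !mxE derivn_map.
set q := (tnth p k)^`(l).
have sq : (size (map_poly (real_complex R) q) <= n)%N.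
  rewrite size_map_poly; apply/leq_sizeP => j nj; rewrite coef_derivn.
  by rewrite big_coef_npoly ?mul0rn // (leq_trans nj) // leq_addl.
rewrite (horner_coef_wide _ sq).
pose F j := (((tnth p k)`_j)%:C)%C *+ j ^_ l * s ^+ (j - l).
have vanish j : (n <= j)%N -> F j = 0 by move=> nj; rewrite /F big_coef_npoly // mul0rn mul0r.
(* The terms below [l] are killed by the falling factorial and those from [n] on by the degree
   bound. *)
transitivity (\sum_(j < n) F (l + j)%N).
  apply: eq_bigr => j _; rewrite coef_map coef_derivn /F /= rmorphMn addKn //.
transitivity (\sum_(0 <= j < l + n) F j).
  rewrite (@big_cat_nat _ _ _ l) ?leq_addr //= [X in _ = X + _]big_nat [X in _ = X + _]big1 ?add0r => [|j /andP[_ jl]].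
    by rewrite -[X in \sum_(X <= _ < _) _]add0n big_addn addKn big_mkord; apply: eq_bigr => j _; rewrite addnC.
  by rewrite /F ffact_small // mulr0n mul0r.
rewrite (@big_cat_nat _ _ _ n) ?leq_addl //= [X in _ + X]big_nat [X in _ + X]big1 ?addr0.
  rewrite big_mkord; apply: eq_bigr => j _; rewrite !mxE subn0 /F.
  by rewrite [RHS]mulrAC mulr_natl.
by move=> j /andP[nj _]; exact: vanish.
Qed.

Lemma osculating_rowspan (s : R[i]) j : (j <= n)%N ->
  osculating p s j = rowspan (osc_mx n 0 s *m map_mx (real_complex R) coef_mx) j.
Proof.
move=> jn; rewrite /osculating span_def big_map -[j in iota 0 j]subn0 -/(index_iota 0 j).
rewrite big_mkord (big_ord_widen n (fun l => <[curve_deriv p l s]>%VS)) //.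
by apply: eq_bigr => l _; rewrite curve_derivE.
Qed.

(** At 0 the derivatives of the monomial curve form a diagonal matrix, which does not change the
    flag. *)
Lemma osculating0_rowspan j : basis_of fullv p -> (j <= n)%N ->
  osculating p 0 j = rowspan (map_mx (real_complex R) coef_mx) j.
Proof.
move=> bp jn; rewrite osculating_rowspan // eq_rowspan ?osc_mx_unit //.
  by rewrite map_unitmx coef_mx_unit.
move=> c e ck ke; rewrite mxE /= expr0n subn0 subn_eq0 leqNgt.
by rewrite (leq_trans ck ke) mulr0.
Qed.

End OsculatingFlags.

Theorem corollary2p2 (R : realType) (n m : nat) (d : 'I_m -> nat)
    (d_range : forall i, (0 < d i < n)%N)
    (d_incr : forall i j : 'I_m, (i < j)%N -> (d i < d j)%N)
    (p : n.-tuple {poly_n R}) (p_basis : basis_of fullv p)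
    (w : 'S_n) (w_Id : in_Id d w)
    (r : nat) (r_def : r = perm_length w) (i : 'I_r -> 'I_m) :
  exists s : 'I_r -> R,
    let X : option 'I_r -> set (flag R[i] n d) := fun a =>
      if a is Some k
      then simple_schubert (i k) (osculating p (real_complex R (s k)))
      else schubert_variety w (osculating p 0) in
    transverse X /\ (forall E, (forall a, X a E) -> real_flag E).
Proof.
pose K : numClosedFieldType := R[i].
have [ss [sz /allP pos good_ss]] := @exists_good K n
  (fun F UF f => @complex_ultra_cvg R K F UF f) [seq d (i k) | k <- enum 'I_r].
have size_ss : size ss = r by rewrite sz size_map -cardE card_ord.
(* The entries of [ss] are positive in [R[i]], hence equal to their real parts. *)
pose s (k : 'I_r) := complex.Re (nth 0 ss k); exists s => X.
pose g0 := map_mx (real_complex R) (coef_mx p).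
have ug0 : g0 \in unitmx by rewrite map_unitmx coef_mx_unit.
have ssE : ss = [seq real_complex R (s k) | k <- enum 'I_r].
  apply: (@eq_from_nth _ 0) => [|k kr]; first by rewrite size_map -cardE card_ord.
  rewrite size_ss in kr; rewrite (nth_map (Ordinal kr)) -?cardE ?card_ord // /s.
  rewrite nth_enum_ord //; have := pos _ (mem_nth 0 (_ : (k < size ss)%N)).
  rewrite size_ss => /(_ kr); rewrite ltcE /= => /andP[/eqP Im0 _].
  by rewrite [LHS]complexE Im0 mulr0 addr0.
have good_s : @good K n (codom (fun k => (d (i k), real_complex R (s k)))).
  by move: good_ss; rewrite [in zip _ _]ssE zip_map.
have XE : X = schubert_conditions g0 w i (fun k => real_complex R (s k) : K).
  apply/funext => -[k|] /=; rewrite /X /schubert_conditions.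
    by rewrite /simple_schubert osculating_rowspan ?leq_subr.
  congr closure; apply/predeqP => E; split=> cE k j jn; have := cE k j jn;
    by rewrite osculating0_rowspan.
rewrite XE; split; first exact: schubert_conditions_transverse.
move=> E /(schubert_conditions_cell d_range ug0 r_def good_s)[x [_ xE rx _ _]].
pose xR := map_mx (@complex.Re R) x; pose gR := xR *m perm_mx w *m coef_mx p.
have gE : x *m perm_mx w *m g0 = map_mx (real_complex R) gR.
  by rewrite !map_mxM map_perm_mx -real_of_conj.
have /adaptedP[ug EE] := xE; rewrite gE map_unitmx in ug EE.
have [E0 /adaptedP[_ E0E]] := exists_flag d_range d_incr ug.
by exists E0 => j; rewrite EE E0E complexify_rowspan.
Qed.
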